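(* Let $\lambda>0$ and let $f$ be a locally univalent analytic function in $\mathbb{D}$ (i.e. $f\in\mathcal{L}(\mathbb{D})$). Then $f$ is univalent in $\mathbb{D}$ and a full mapping if and only if, for all $\zeta\in\mathbb{D}$, $$\sum_{n=1}^{\infty}(n-\lambda)\left|A_n(f;\zeta)\right|^2=\lambda .$$
   Context: $\mathbb{D}=\{z\in\mathbb{C}:|z|<1\}$. $\mathcal{L}(\mathbb{D})$ is the class of analytic functions $f$ in $\mathbb{D}$ with $f'(z)\neq 0$ for all $z\in\mathbb{D}$. ''Univalent'' means one-to-one. $f$ is called a full mapping if the Lebesgue measure of $\mathbb{C}\setminus f(\mathbb{D})$ is zero. Mixed Aharonov sequence: for $f\in\mathcal{L}(\mathbb{D})$, $\lambda>0$ and $z\in\mathbb{D}$, the numbers $\Phi_n(f;z)=\Phi_{\lambda,n}(f;z)$, $n\ge 0$, are defined by the expansion, for $w$ close to $z$, $$\left[\frac{f'(z)(w-z)}{f(w)-f(z)}\right]^{\lambda}=\sum_{n=0}^{\infty}\Phi_{\lambda,n}(f;z)(w-z)^n,$$ where the quotient is given the value $1$ at $w=z$ and the branch of the power is the one equal to $1$ at $w=z$ (so $\Phi_{0}\equiv 1$). For real $\alpha$ and integer $m\ge 0$, $\binom{\alpha}{m}=\frac{\alpha(\alpha-1)\cdots(\alpha-m+1)}{m!}$, with $\binom{\alpha}{0}=1$ (in particular $\binom{-1}{0}=1$). The convention $0^0=1$ is used. For $n\ge 0$ and $\zeta\in\mathbb{D}$, $$A_n(f;\zeta):=\sum_{j=0}^{n}(-1)^{n-j}\binom{\lambda}{n-j}\sum_{k=0}^{j}\binom{j-1}{j-k}(-\bar{\zeta})^{n-k}(1-|\zeta|^2)^{k}\,\Phi_{\lambda,k}(f;\zeta).$$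 *)

(* Defs.v *)
From HB Require Import structures.
From mathcomp Require Import all_boot all_order all_algebra.
From mathcomp Require Import complex.
From mathcomp Require Import all_classical all_reals all_analysis.
Set Implicit Arguments.
Unset Strict Implicit.
Unset Printing Implicit Defensive.
Import Order.TTheory GRing.Theory Num.Theory.
Import numFieldNormedType.Exports.
Local Open Scope classical_set_scope.
Local Open Scope ring_scope.
Local Open Scope complex_scope.

(* The topology and the normed-module structure of C = R[i] are those that
   every numFieldType F carries through F^o; derive1 is then the complex
   derivative. *)
HB.instance Definition _ (R : rcfType) := GRing.ComAlgebra.copy R[i] R[i]^o.
HB.instance Definition _ (R : rcfType) := Vector.copy R[i] R[i]^o.
HB.instance Definition _ (R : rcfType) := NormedModule.copy R[i] R[i]^o.

Definition unit_disk (R : realType) : set R[i] := [set z | Normc.normc z < 1].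

Definition has_expansion (R : realType) (g : R[i] -> R[i]) (z : R[i])
    (a : nat -> R[i]) : Prop :=
  \forall w \near z, series (fun n => a n * (w - z) ^+ n) @ \oo --> g w.

Definition analytic_on (R : realType) (D : set R[i]) (f : R[i] -> R[i]) : Prop :=
  forall z, D z -> exists a, has_expansion f z a.

Definition locally_univalent (R : realType) (f : R[i] -> R[i]) : Prop :=
  analytic_on (@unit_disk R) f /\ forall z, unit_disk z -> derive1 f z != 0.

Definition univalent (R : realType) (f : R[i] -> R[i]) : Prop :=
  {in @unit_disk R &, injective f}.

(* C is identified with R * R. Negligible means contained in a Borel set of
   measure zero, i.e. null for the completed (Lebesgue) measure. *)
Definition full_mapping (R : realType) (f : R[i] -> R[i]) : Prop :=
  ((@lebesgue_measure R) \x (@lebesgue_measure R))%E.-negligible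
    [set p : R * R | ~ (f @` @unit_disk R) (p.1 +i* p.2)].

(* Half-angle formula: the principal argument off the half-line ]-oo, 0]. *)
Definition Carg (R : realType) (z : R[i]) : R :=
  atan (complex.Im z / (Normc.normc z + complex.Re z)) *+ 2.

(* The principal branch of z ^ lambda, analytic off ]-oo, 0], with value 1 at 1. *)
Definition Cpow (R : realType) (z : R[i]) (lambda : R) : R[i] :=
  (Normc.normc z `^ lambda)%:C
  * (cos (lambda * Carg z) +i* sin (lambda * Carg z)).

(* f'(z) (w - z) / (f(w) - f(z)) as a function of w. *)
Definition diff_quotient (R : realType) (f : R[i] -> R[i]) (z w : R[i]) : R[i] :=
  if w == z then 1 else derive1 f z * (w - z) / (f w - f z).

(* The diff_quotient is close to 1 for w close to z, so the principal branch
   is there the branch with value 1 at w = z. The sequence of coefficients is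
   unique; the default 0 is not used when f is locally univalent and z is in
   the disk. *)
Definition Phi (R : realType) (lambda : R) (f : R[i] -> R[i]) (z : R[i])
    : nat -> R[i] :=
  xget (fun=> 0)
    [set a | has_expansion (fun w => Cpow (diff_quotient f z w) lambda) z a].

Definition gbinom (R : realType) (alpha : R) (m : nat) : R :=
  (\prod_(i < m) (alpha - i%:R)) / m`!%:R.

Definition Acoef (R : realType) (lambda : R) (f : R[i] -> R[i]) (n : nat)
    (zeta : R[i]) : R[i] :=
  \sum_(j < n.+1) (-1) ^+ (n - j) * (gbinom lambda (n - j))%:C *
    \sum_(k < j.+1) (gbinom (j%:R - 1) (j - k))%:C * (- conjc zeta) ^+ (n - k)
      * ((1 - Normc.normc zeta ^+ 2)%:C) ^+ k * Phi lambda f zeta k.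

(* Main.v *)
(* Fix zeta, let T z = (z + zeta) / (1 + conj zeta z), F = f o T and b = F 0. Where F - b
   has no other zero, h z = (F'(0) z / (F z - b)) ^ lambda is analytic, and since
   F'(0) z / (F z - b) is (1 + conj zeta z) times the quotient of the Aharonov sequence at
   T z, its Taylor coefficients are the A_n. If F is univalent, the argument principle and
   Fubini give, for r < 1,
     int_{C minus F(|z| < r)} |w - b| ^ (- 2 lambda - 2) dA
       = (1 / (2 lambda)) int |F - b| ^ (- 2 lambda) Re (z F' / (F - b)) dt
       = (pi / lambda ^ 2) (|F'(0)| r) ^ (- 2 lambda) sum_n (lambda - n) |A_n| ^ 2 r ^ (2 n),
   the last step being Parseval's identity with z F' / (F - b) = 1 - z h' / (lambda h).
   For r -> 1 the sum over n >= 1 of (n - lambda) |A_n| ^ 2 is lambda minus a positive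
   multiple of the weighted area of the complement of F(D) = f(D), which is zero iff the
   mapping is full. Conversely, convergence bounds the A_n, hence h, and this forbids a
   second zero of F - b; applied at every zeta it gives univalence. *)
Require Import Defs.
From HB Require Import structures.
From mathcomp Require Import all_boot all_order all_algebra.
From mathcomp Require Import complex ring lra.
From mathcomp Require Import all_classical all_reals all_analysis.
From mathcomp Require Import measurable_realfun.
Set Implicit Arguments.
Unset Strict Implicit.
Unset Printing Implicit Defensive.
Import Order.TTheory GRing.Theory Num.Theory.
Import numFieldNormedType.Exports.
Local Open Scope classical_set_scope.
Local Open Scope ring_scope.
Local Open Scope complex_scope.
Import Normc.

(** * Complex numbers and power series *)

(** The density |w - b| ^ (- 2 lambda - 2) is not integrable at b, so the winding number cannot be
    integrated against it over the whole plane. It is cut off to zero on a disk of radius dl about b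
    that lies inside the image; the same dl-dependent term occurs in the total weight and in the
    weight inside the curve, and the two cancel. Winding numbers are needed only for the image of a
    circle under a univalent map, where F - F z0 = (z - z0) k with k free of zeros, and the mean
    value property of z k' / k settles them. The A_n are identified with Taylor coefficients modulo
    z ^ N, so that no double series is rearranged. As r tends to 1 the series is at first only Abel
    summable; it converges because its terms are nonnegative once n > lambda. *)

Section Basics.
Variable R : realType.
Local Notation C := R[i].
Implicit Types z w : C.

Lemma cReD z w : complex.Re (z + w) = complex.Re z + complex.Re w.
Proof. by case: z; case: w. Qed.
Lemma cImD z w : complex.Im (z + w) = complex.Im z + complex.Im w.
Proof. by case: z; case: w. Qed.
Lemma cReN z : complex.Re (- z) = - complex.Re z.
Proof. by case: z. Qed.
Lemma cImN z : complex.Im (- z) = - complex.Im z.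
Proof. by case: z. Qed.
Lemma cReB z w : complex.Re (z - w) = complex.Re z - complex.Re w.
Proof. by rewrite cReD cReN. Qed.
Lemma cImB z w : complex.Im (z - w) = complex.Im z - complex.Im w.
Proof. by rewrite cImD cImN. Qed.
Lemma cReM z w : complex.Re (z * w) =
  complex.Re z * complex.Re w - complex.Im z * complex.Im w.
Proof. by case: z; case: w. Qed.
Lemma cImM z w : complex.Im (z * w) =
  complex.Re z * complex.Im w + complex.Im z * complex.Re w.
Proof. by case: z; case: w. Qed.
Lemma eqRI z w : complex.Re z = complex.Re w -> complex.Im z = complex.Im w -> z = w.
Proof. by case: z; case: w => /= ? ? ? ? -> ->. Qed.
Lemma cRe_sum (I : Type) (r : seq I) P (F : I -> C) :
  complex.Re (\sum_(i <- r | P i) F i) = \sum_(i <- r | P i) complex.Re (F i).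
Proof. by elim/big_rec2 : _ => // i x y _ <-; rewrite cReD. Qed.
Lemma cIm_sum (I : Type) (r : seq I) P (F : I -> C) :
  complex.Im (\sum_(i <- r | P i) F i) = \sum_(i <- r | P i) complex.Im (F i).
Proof. by elim/big_rec2 : _ => // i x y _ <-; rewrite cImD. Qed.

Lemma normcE2 z : normc z ^+ 2 = complex.Re z ^+ 2 + complex.Im z ^+ 2.
Proof. by case: z => x y /=; rewrite sqr_sqrtr// addr_ge0// sqr_ge0. Qed.
Lemma normc_ge0 z : 0 <= normc z.
Proof. by case: z => x y; exact: sqrtr_ge0. Qed.
Lemma normcD z w : normc (z + w) <= normc z + normc w.
Proof. exact: le_normcD. Qed.
Lemma normc_eq0 z : (normc z == 0) = (z == 0).
Proof. by apply/eqP/eqP => [/eq0_normc//|->]; exact: normc0. Qed.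
Lemma normc_gt0 z : (0 < normc z) = (z != 0).
Proof. by rewrite lt_neqAle normc_ge0 andbT eq_sym normc_eq0. Qed.
Lemma normcX z n : normc (z ^+ n) = normc z ^+ n.
Proof. by elim: n => [|n IH]; rewrite ?expr0 ?normc1// !exprS normcM IH. Qed.
Lemma normcB z w : normc (z - w) = normc (w - z).
Proof. by rewrite -normcN opprB. Qed.
Lemma normcBD z w : normc (z - w) <= normc z + normc w.
Proof. by rewrite -(normcN w); exact: normcD. Qed.
Lemma normc_triB z w : normc z - normc w <= normc (z - w).
Proof. by rewrite lerBlDr -{1}(subrK w z); exact: normcD. Qed.
Lemma Re_le_normc z : `|complex.Re z| <= normc z.
Proof.
by rewrite -[leRHS]ger0_norm ?normc_ge0// -ler_sqr ?nnegrE// !real_normK ?num_real//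
  normcE2 lerDl sqr_ge0.
Qed.
Lemma Im_le_normc z : `|complex.Im z| <= normc z.
Proof.
by rewrite -[leRHS]ger0_norm ?normc_ge0// -ler_sqr ?nnegrE// !real_normK ?num_real//
  normcE2 lerDr sqr_ge0.
Qed.
Lemma normcR (x : R) : normc x%:C = `|x|.
Proof. by rewrite /= expr0n /= addr0 sqrtr_sqr. Qed.
Lemma normcRe_Im z : normc z <= `|complex.Re z| + `|complex.Im z|.
Proof.
rewrite -ler_sqr ?nnegrE ?normc_ge0 ?addr_ge0//.
by rewrite normcE2 sqrrD !real_normK ?num_real// lerD2r lerDl mulrn_wge0// mulr_ge0.
Qed.
Lemma normc_sum (I : Type) (r : seq I) P (F : I -> C) :
  normc (\sum_(i <- r | P i) F i) <= \sum_(i <- r | P i) normc (F i).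
Proof.
elim/big_rec2 : _ => [|i x y _ h]; first by rewrite normc0.
by rewrite (le_trans (normcD _ _))// lerD2l.
Qed.
Lemma normc_conj z : normc (z^*) = normc z.
Proof. by case: z => x y /=; rewrite sqrrN. Qed.
Lemma mul_conjc z : z * z^* = (normc z ^+ 2)%:C.
Proof. by rewrite normcE2; case: z => x y /=; apply: eqRI => /=; ring. Qed.

(** The radius of a ball in [R[i]] is itself a complex number; positivity in the partial order of
    [R[i]] forces it to be real, so real radii and [normc] describe all neighbourhoods. *)
Lemma nearC z (P : C -> Prop) : (\forall w \near z, P w) <->
  exists2 e : R, 0 < e & forall w, normc (w - z) < e -> P w.
Proof.
split=> [/nbhs_ballP[e /= e0 H]|[e e0 H]].
  move: e e0 H => [e e'] /=; rewrite ltcE /= => /andP[/eqP -> e0] H.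
  exists e => // w wz; apply: H; rewrite /ball /= /ball_ distrC.
  by rewrite ltcE /= eqxx.
apply/nbhs_ballP; exists (e%:C) => /=; first by rewrite ltcE /= eqxx.
by move=> w; rewrite /ball /= /ball_ distrC ltcE /= eqxx /= => /H.
Qed.

Lemma near_ball z (e : R) : 0 < e -> \forall w \near z, normc (w - z) < e.
Proof. by move=> e0; apply/nearC; exists e. Qed.

Lemma cvgC (T : Type) (F : set_system T) {FF : Filter F} (u : T -> C) (l : C) :
  (u @ F --> l) <-> (forall e : R, 0 < e -> \forall t \near F, normc (u t - l) < e).
Proof.
split=> [ul e e0|H].
  have /ul := near_ball l e0; exact.
move=> P; rewrite /= => /nearC[e e0 eP].
have := H e e0; apply: (@filterS _ F FF) => t; exact: eP.
Qed.

Lemma continuousC (u : C -> C) z : {for z, continuous u} <->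
  (forall e : R, 0 < e -> exists2 d : R, 0 < d &
     forall w, normc (w - z) < d -> normc (u w - u z) < e).
Proof.
have FF := nbhs_filter z.
split=> [/(@cvgC _ (nbhs z) FF) H e e0|H].
  by have /nearC := H e e0.
by apply/(@cvgC _ (nbhs z) FF) => e e0; apply/nearC/H.
Qed.

Lemma cvg_ReIm (T : Type) (F : set_system T) {FF : Filter F} (u : T -> C) (l : C) :
  (u @ F --> l) <-> ((fun t => complex.Re (u t)) @ F --> complex.Re l) /\
                    ((fun t => complex.Im (u t)) @ F --> complex.Im l).
Proof.
split=> [/cvgC H|[/cvgrPdist_lt H1 /cvgrPdist_lt H2]].
  split; apply/cvgrPdist_lt => e e0; have := H e e0; apply: (@filterS _ F FF) => t;
    rewrite distrC; apply: le_lt_trans.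
    by rewrite -cReB Re_le_normc.
  by rewrite -cImB Im_le_normc.
apply/cvgC => e e0; have e20 : 0 < e / 2 by rewrite divr_gt0.
have := @filterI _ F FF _ _ (H1 _ e20) (H2 _ e20); apply: (@filterS _ F FF) => t [h1 h2].
rewrite (le_lt_trans (normcRe_Im _))// cReB cImB !(distrC (_ (u t))).
by rewrite [ltRHS]splitr ltrD.
Qed.

Lemma continuous_Re : continuous (@complex.Re R : C -> R).
Proof. by move=> z; have /(@cvg_ReIm _ (nbhs z) (nbhs_filter z))[] := (@cvg_id _ (nbhs z)). Qed.
Lemma continuous_Im : continuous (@complex.Im R : C -> R).
Proof. by move=> z; have /(@cvg_ReIm _ (nbhs z) (nbhs_filter z))[] := (@cvg_id _ (nbhs z)). Qed.
Lemma continuous_normc : continuous (@normc R : C -> R).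
Proof.
move=> z; apply/(@cvgrPdist_lt _ R^o _ _ (nbhs_filter z)) => e e0; apply/nearC; exists e => // w wz.
rewrite (le_lt_trans _ wz)// ler_norml normcB; apply/andP; split; last exact: normc_triB.
by rewrite lerNl opprB normcB; exact: normc_triB.
Qed.
Lemma continuous_real_complex : continuous (fun x : R => x%:C).
Proof. by move=> x; apply/(@cvg_ReIm _ (nbhs x) (nbhs_filter x)); split; [exact: cvg_id|exact: cvg_cst]. Qed.
End Basics.

Section PowerSeries.
Variable R : realType.
Local Notation C := R[i].
Implicit Types z w : C.

Definition psum (a : nat -> C) (z : C) (n : nat) : C := \sum_(k < n) a k * z ^+ k.

Definition pser (a : nat -> C) (z l : C) : Prop :=
  forall e : R, 0 < e -> exists N, forall n, (N <= n)%N -> normc (psum a z n - l) < e.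

Lemma pserP a z l : pser a z l <-> (series (fun n => a n * z ^+ n) @ \oo --> l).
Proof.
rewrite seriesEord; split=> [H|/(@cvgC R _ \oo _) H e e0].
  apply/(@cvgC R _ \oo _) => e e0; have [N NP] := H e e0.
  by exists N => // n; exact: NP.
by have [N _ NP] := H e e0; exists N => n; exact: NP.
Qed.

Lemma has_expansionP (g : C -> C) z a : has_expansion g z a <->
  exists2 e : R, 0 < e & forall w, normc (w - z) < e -> pser a (w - z) (g w).
Proof.
split=> [/nearC[e e0 H]|[e e0 H]].
  by exists e => // w /H/pserP.
by apply/nearC; exists e => // w /H/pserP.
Qed.

Lemma pser_unique a z l1 l2 : pser a z l1 -> pser a z l2 -> l1 = l2.
Proof.
move=> h1 h2; apply/eqP; rewrite -subr_eq0 -normc_eq0; apply/negP => /negP.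
rewrite normc_eq0 -normc_gt0 => d0.
have d20 : 0 < normc (l1 - l2) / 2 by rewrite divr_gt0.
have [N1 H1] := h1 _ d20; have [N2 H2] := h2 _ d20.
have := ltrD (H1 _ (leq_maxl N1 N2)) (H2 _ (leq_maxr N1 N2)).
rewrite -splitr (normcB _ l1) ltNge; apply/negP; rewrite negbK.
by rewrite (le_trans _ (normcD _ _))// addrA subrK.
Qed.

Lemma geom_sum_le (M q : R) n m : 0 <= M -> 0 <= q < 1 ->
  \sum_(n <= k < m) M * q ^+ k <= M * q ^+ n / (1 - q).
Proof.
move=> M0 /andP[q0 q1]; have q10 : 0 < 1 - q by rewrite subr_gt0.
rewrite ler_pdivlMr// mulrC mulr_sumr.
have [nm|mn] := leqP n m; last first.
  by rewrite big_geq ?(ltnW mn)// mulr_ge0// exprn_ge0.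
rewrite (@telescope_sumr_eq R n m (fun k => - (M * q ^+ k)) _ nm); last first.
  by move=> k _; rewrite exprS; ring.
by rewrite opprK addrC lerBlDr lerDl mulr_ge0// exprn_ge0.
Qed.

(** The explicit remainder serves as much as the convergence: at [n = 0] it also bounds the sum
    itself. *)
Lemma pser_geom a z (M q : R) : 0 <= M -> 0 <= q < 1 ->
  (forall n, normc (a n * z ^+ n) <= M * q ^+ n) ->
  exists2 l, pser a z l & forall n, normc (psum a z n - l) <= M * q ^+ n / (1 - q).
Proof.
move=> M0 q01 H; have /andP[q0 q1] := q01.
have q10 : 0 < 1 - q by rewrite subr_gt0.
have tail n m : (n <= m)%N -> normc (psum a z m - psum a z n) <= M * q ^+ n / (1 - q).
  move=> nm; rewrite /psum -!(big_mkord xpredT (fun k => a k * z ^+ k)).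
  rewrite [X in X - _](@big_cat_nat _ _ _ n)//= addrAC subrr add0r.
  by rewrite (le_trans (normc_sum _ _ _))// (le_trans _ (geom_sum_le n m M0 q01))// ler_sum.
have cgeo : cvgn (series (geometric M q)) by apply: is_cvg_geometric_series; rewrite ger0_norm.
(* Completeness is used in [R] only: [p] is the real or the imaginary part, dominated by a real
   geometric series. *)
have cv (p : C -> R) : (forall z, `|p z| <= normc z) ->
    (forall n, p (psum a z n) = \sum_(k < n) p (a k * z ^+ k)) ->
    exists l : R, (fun n => p (psum a z n)) @ \oo --> l.
  move=> pn ps.
  have : cvgn (series (fun k => p (a k * z ^+ k))).
    apply: normed_cvg; apply: series_le_cvg cgeo => //= n; first exact: geometric_ge0.
    exact: le_trans (pn _) (H n).
  move=> h; exists (limn (series (fun k => p (a k * z ^+ k)))).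
  by under eq_fun do rewrite ps; move: h; rewrite seriesEord.
have [x xl] := cv (@complex.Re R) (@Re_le_normc R) (fun n => cRe_sum _ _ _).
have [y yl] := cv (@complex.Im R) (@Im_le_normc R) (fun n => cIm_sum _ _ _).
have xy : (psum a z @ \oo --> (x +i* y : C)) by apply/cvg_ReIm.
have P : pser a z (x +i* y).
  by move=> e e0; have /(@cvgC R _ \oo _)/(_ e e0)[N _ NP] := xy; exists N => n; exact: NP.
exists (x +i* y) => // n; apply/ler_addgt0Pr => e e0.
have [N NP] := P e e0.
rewrite -(subrK (psum a z (maxn n N)) (psum a z n)) -addrA (le_trans (normcD _ _))//.
by rewrite lerD// ?(ltW (NP _ (leq_maxr _ _)))// normcB tail// leq_maxl.
Qed.

Lemma pser_bound a z l : pser a z l -> exists2 M : R, 0 < M & forall n, normc (a n * z ^+ n) <= M.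
Proof.
move=> h; have [N NP] := h 1 ltr01.
exists (\sum_(k < N) normc (a k * z ^+ k) + 2).
  by rewrite ltr_wpDl// sumr_ge0// => k _; exact: normc_ge0.
move=> n; have [nN|Nn] := ltnP n N.
  rewrite (bigD1 (Ordinal nN))//= -addrA lerDl addr_ge0//.
  by rewrite sumr_ge0// => k _; exact: normc_ge0.
rewrite ler_wpDl ?sumr_ge0// => [k _|]; first exact: normc_ge0.
have -> : a n * z ^+ n = (psum a z n.+1 - l) - (psum a z n - l).
  by rewrite /psum big_ord_recr/=; ring.
by rewrite (le_trans (normcBD _ _))// (_ : 2 = 1 + 1)// lerD// ltW// NP// leqW.
Qed.

Definition pconv (a : nat -> C) (rho : R) (u : C -> C) :=
  forall z, normc z < rho -> pser a z (u z).

Lemma pconv_bound a rho u (r : R) : 0 <= r < rho -> pconv a rho u ->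
  exists2 M : R, 0 < M & forall n, normc (a n) * r ^+ n <= M.
Proof.
move=> /andP[r0 rr] H; have /H/pser_bound[M M0 MP] : normc r%:C < rho by rewrite normcR ger0_norm.
by exists M => // n; rewrite (le_trans _ (MP n))// normcM normcX normcR ger0_norm.
Qed.

(** Bounding the terms at a radius s between r and rho gives the ratio r / s, uniformly on the
    closed disk of radius r. This rate permits integration term by term on circles. *)
Lemma pconv_tail a rho u (r : R) : 0 <= r < rho -> pconv a rho u ->
  exists M q : R, [/\ 0 < M, 0 <= q < 1 &
    forall z, normc z <= r -> forall n, normc (psum a z n - u z) <= M * q ^+ n].
Proof.
move=> /andP[r0 rr] H.
pose s := (r + rho) / 2.
have rs : r < s by rewrite /s ltr_pdivlMr// mulr_natr mulr2n ltrD2l.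
have sr : s < rho by rewrite /s ltr_pdivrMr// mulr_natr mulr2n ltrD2r.
have s0 : 0 < s := le_lt_trans r0 rs.
have [|M M0 MP] := @pconv_bound a rho u s _ H; first by rewrite (ltW s0).
have q01 : 0 <= r / s < 1 by rewrite divr_ge0 ?(ltW s0)//= ltr_pdivrMr// mul1r.
have q10 : 0 < 1 - r / s by rewrite subr_gt0; case/andP: q01.
exists (M / (1 - r / s)), (r / s); split => //; first by rewrite divr_gt0.
move=> z zr n.
have [k|l lz lP] := @pser_geom a z M (r / s) (ltW M0) q01.
  rewrite normcM normcX expr_div_n mulrA ler_pdivlMr ?exprn_gt0//.
  rewrite mulrAC ler_pM ?exprn_ge0 ?mulr_ge0 ?exprn_ge0 ?normc_ge0 ?(ltW s0)//.
  by apply: lerXn2r; rewrite ?nnegrE ?normc_ge0.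
rewrite (_ : u z = l); first by rewrite mulrAC; exact: lP.
by apply: pser_unique lz; apply: H; exact: le_lt_trans rr.
Qed.

(** By Bernoulli's inequality a linear factor is absorbed in a larger ratio. Two applications absorb
    the factor k ^ 2 of a second-order remainder. *)
Lemma lin_le_expr (q s : R) : 0 < q < s -> exists2 K : R, 0 < K &
  forall n, n.+1%:R * q ^+ n <= K * s ^+ n.
Proof.
move=> /andP[q0 qs]; have s0 := lt_trans q0 qs.
pose t := s / q - 1.
have t0 : 0 < t by rewrite subr_gt0 ltr_pdivlMr// mul1r.
exists (1 + t^-1) => [|n]; first by rewrite addr_gt0// invr_gt0.
have bern : 1 + n%:R * t <= (s / q) ^+ n.
  rewrite (_ : s / q = 1 + t); last by rewrite /t addrC subrK.
  elim: n => [|n IH]; first by rewrite mul0r addr0 expr0.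
  rewrite exprS (le_trans _ (ler_wpM2l _ IH))//; last by rewrite addr_ge0// ltW.
  rewrite -subr_ge0 -natr1 (_ : _ - _ = n%:R * t ^+ 2); last by ring.
  by rewrite mulr_ge0// sqr_ge0.
rewrite -ler_pdivlMr ?exprn_gt0// -mulrA -expr_div_n.
apply: le_trans (ler_wpM2l _ bern); last by rewrite addr_ge0// invr_ge0 ltW.
rewrite -subr_ge0 (_ : _ - _ = t^-1 + n%:R * t).
  by rewrite addr_ge0 ?invr_ge0 ?mulr_ge0// ltW.
by rewrite -natr1; field; rewrite gt_eqF.
Qed.

(** The non-strict, quotient-free form holds at w = z as well, so this point needs no exclusion. *)
Lemma is_deriveCP (u : C -> C) z d : is_derive z 1 u d <->
  forall e : R, 0 < e -> exists2 dl : R, 0 < dl & forall w, normc (w - z) < dl ->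
    normc (u w - u z - d * (w - z)) <= e * normc (w - z).
Proof.
have E h : h != 0 -> h^-1 *: (u (h *: 1 + z) - u z) - d = (u (h + z) - u z - d * h) / h.
  move=> h0; rewrite /GRing.scale /= mulr1 mulrBl mulfK// mulrC//.
have FF : Filter ((0 : C)^') by exact: dnbhs_filter.
split=> [[du <-] e e0|H].
  have du' : (fun h : C => h^-1 *: (u (h *: 1 + z) - u z)) @ 0^' --> 'D_1 u z by exact: du.
  have /(_ e e0) := (@cvgC R _ (0^') FF _ _).1 du'.
  rewrite near_withinE => /nearC[dl dl0 dP]; exists dl => // w wz.
  have [->|wz0] := eqVneq w z; first by rewrite !subrr mulr0 subrr normc0 mulr0.
  have h0 : w - z != 0 by rewrite subr_eq0.
  have := dP (w - z); rewrite subr0 => /(_ wz h0)/ltW.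
  rewrite /GRing.scale /= mulr1 subrK => h.
  have -> : u w - u z - 'D_1 u z * (w - z) = ((w - z)^-1 * (u w - u z) - 'D_1 u z) * (w - z).
    by rewrite mulrBl mulrAC mulVf// mul1r.
  by rewrite normcM ler_wpM2r// normc_ge0.
have cv : (fun h : C => h^-1 *: (u (h *: 1 + z) - u z)) @ 0^' --> d.
  apply/(@cvgC R _ (0^') FF _ _) => e e0.
  have e20 : 0 < e / 2 by rewrite divr_gt0.
  have [dl dl0 dP] := H _ e20.
  rewrite near_withinE; apply/nearC; exists dl => // h; rewrite subr0 => hd h0.
  rewrite E// normcM normcV ltr_pdivrMr ?normc_gt0//.
  have := dP (h + z); rewrite addrK => /(_ hd) /le_lt_trans; apply.
  by rewrite ltr_pM2r ?normc_gt0// ltr_pdivrMr// mulr_natr mulr2n ltrDl.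
by apply: DeriveDef; [apply/cvg_ex; exists d|exact: cvg_lim cv].
Qed.

Lemma is_derive_quad (u : C -> C) z d (K e0 : R) : 0 < K -> 0 < e0 ->
  (forall w, normc (w - z) < e0 ->
    normc (u w - u z - d * (w - z)) <= K * normc (w - z) ^+ 2) ->
  is_derive z 1 u d.
Proof.
move=> K0 e00 H; apply/is_deriveCP => e e1.
exists (Num.min e0 (e / K)) => [|w]; first by rewrite lt_min e00 divr_gt0.
rewrite lt_min => /andP[/H h1 h2]; rewrite (le_trans h1)// expr2 mulrA ler_wpM2r ?normc_ge0//.
by rewrite mulrC -ler_pdivlMr// ltW.
Qed.
End PowerSeries.

(** * Termwise differentiation and uniqueness of coefficients *)

Section TermwiseDerivative.
Variable R : realType.
Local Notation C := R[i].
Implicit Types z w : C.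

Lemma has_expansion_pconv (g : C -> C) z a : has_expansion g z a <->
  exists2 e : R, 0 < e & pconv a e (fun h => g (h + z)).
Proof.
rewrite has_expansionP; split=> -[e e0 H]; exists e => // h he.
  by have := H (h + z); rewrite addrK => /(_ he).
by have := H (h - z); rewrite subrK => /(_ he).
Qed.

Definition dcoef (a : nat -> C) (n : nat) : C := n.+1%:R * a n.+1.

Lemma psum_dcoef a z n :
  psum (dcoef a) z n = \sum_(k < n.+1) a k * (k%:R * z ^+ k.-1).
Proof.
rewrite big_ord_recl/= mul0r mulr0 add0r; apply: eq_bigr => k _.
by rewrite /dcoef /bump/= add1n; ring.
Qed.

Lemma lt_dense (x y : R) : x < y -> exists2 r, x < r & r < y.
Proof. by move=> xy; exists ((x + y) / 2); rewrite ?midf_lt//; lra. Qed.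

Lemma normc_natr n : normc (n%:R : C) = n%:R.
Proof. by rewrite -[n%:R](rmorph_nat (real_complex R)) normcR ger0_norm. Qed.

(** The factor r ^ 2 on the left replaces r ^ (n - 2) on the right, so small n are not special. The
    remainder for n + 1 is w times that for n plus n z ^ (n - 1) (w - z) ^ 2. *)
Lemma expr_taylor2 z w (r : R) n : normc z <= r -> normc w <= r ->
  r ^+ 2 * normc (w ^+ n - z ^+ n - n%:R * z ^+ n.-1 * (w - z))
    <= n%:R ^+ 2 * r ^+ n * normc (w - z) ^+ 2.
Proof.
move=> zr wr; have r0 : 0 <= r := le_trans (normc_ge0 z) zr.
elim: n => [|n IH].
  by rewrite !expr0 subrr !mul0r subr0 normc0 mulr0 expr2 !mul0r.
have -> : w ^+ n.+1 - z ^+ n.+1 - n.+1%:R * z ^+ n * (w - z) =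
  w * (w ^+ n - z ^+ n - n%:R * z ^+ n.-1 * (w - z)) + n%:R * z ^+ n.-1 * (w - z) ^+ 2.
  by case: n {IH} => [|n]; rewrite ?expr0 -?natr1 /= !exprS; ring.
apply: (@le_trans _ _ (r * (n%:R ^+ 2 * r ^+ n * normc (w - z) ^+ 2) +
   n%:R * r ^+ n.+1 * normc (w - z) ^+ 2)).
  rewrite (le_trans (ler_wpM2l _ (normcD _ _)))// ?exprn_ge0// mulrDr lerD//.
    by rewrite normcM mulrCA ler_pM// ?mulr_ge0 ?exprn_ge0 ?normc_ge0.
  rewrite normcM [normc ((w - z) ^+ 2)]normcX [normc (n%:R * _)]normcM normc_natr normcX mulrA.
  case: n {IH} => [|n] /=; first by rewrite !(mul0r,mulr0).
  rewrite ler_wpM2r ?exprn_ge0 ?normc_ge0// mulrCA ler_wpM2l ?ler0n//.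
  rewrite expr2 !exprS mulrA ler_wpM2l ?mulr_ge0//.
  by apply: lerXn2r; rewrite ?nnegrE ?normc_ge0.
have -> : r * (n%:R ^+ 2 * r ^+ n * normc (w - z) ^+ 2) +
   n%:R * r ^+ n.+1 * normc (w - z) ^+ 2 =
   (n%:R ^+ 2 + n%:R) * (r ^+ n.+1 * normc (w - z) ^+ 2) by rewrite (exprS r n); ring.
rewrite -[leRHS]mulrA; apply: ler_wpM2r.
  by rewrite mulr_ge0 ?exprn_ge0 ?normc_ge0.
by rewrite -subr_ge0 (_ : _ - _ = n%:R + 1) ?addr_ge0// -natr1; ring.
Qed.

(** The quadratic remainders of the monomials are summed with weights |a k|; the total is again
    quadratic in w - z, with a constant that survives the limit of the partial sums. *)
Lemma pconv_deriv_at a rho u z : pconv a rho u -> normc z < rho ->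
  exists2 d, pser (dcoef a) z d & is_derive z 1 u d.
Proof.
move=> H zrho.
have [r zr rrho] := lt_dense zrho.
have r0 : 0 < r := le_lt_trans (normc_ge0 z) zr.
have [s rs sr] := lt_dense rrho.
have s0 : 0 < s := lt_trans r0 rs.
have [|M M0 MP] := @pconv_bound R a rho u s _ H; first by rewrite (ltW s0).
have MP' k : normc (a k) * r ^+ k <= M * (r / s) ^+ k.
  rewrite expr_div_n mulrA ler_pdivlMr ?exprn_gt0// mulrAC ler_wpM2r// exprn_ge0// ltW//.
(* The ratios q < q' < q2 < 1 leave room to absorb one factor k + 1 at each step. *)
pose q := r / s.
have q0 : 0 < q by rewrite divr_gt0.
have q1 : q < 1 by rewrite ltr_pdivrMr// mul1r.
have [q' qq' q'1] := lt_dense q1.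
have [q2 q'q2 q21] := lt_dense q'1.
have q'0 := lt_trans q0 qq'; have q20 := lt_trans q'0 q'q2.
have [|K1 K10 K1P] := @lin_le_expr R q q'; first by rewrite q0.
have [|K2 K20 K2P] := @lin_le_expr R q' q2; first by rewrite q'0.
have [||k|d dP _] := @pser_geom R (dcoef a) z (M / r * q * K1 / q * q') q'.
- by rewrite !mulr_ge0 ?invr_ge0// ltW.
- by rewrite (ltW q'0).
- rewrite /dcoef !normcM normc_natr normcX.
  apply: (@le_trans _ _ (k.+1%:R * (M * q ^+ k.+1) / r)).
    rewrite ler_pdivlMr// -!mulrA ler_wpM2l// (le_trans _ (MP' _))//.
    rewrite ler_wpM2l ?normc_ge0// exprSr ler_wpM2r ?(ltW r0)//.
    by apply: lerXn2r; rewrite ?nnegrE ?normc_ge0 ?(ltW r0) ?(ltW zr).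
  have -> : k.+1%:R * (M * q ^+ k.+1) / r = M / r * q * (k.+1%:R * q ^+ k).
    by rewrite (exprS q k); ring.
  have -> : M / r * q * K1 / q * q' * q' ^+ k = M / r * q * (K1 * q' ^+ k) * (q' / q) by ring.
  apply: (@le_trans _ _ (M / r * q * (K1 * q' ^+ k))).
    by rewrite ler_wpM2l ?K1P// !mulr_ge0 ?invr_ge0// ltW.
  by rewrite ler_peMr ?ler_pdivlMr// ?mul1r ?(ltW qq')// !mulr_ge0 ?exprn_ge0 ?invr_ge0// ltW.
exists d => //.
pose K := M / r ^+ 2 * (K1 * K2) / (1 - q2).
have q210 : 0 < 1 - q2 by rewrite subr_gt0.
have K0 : 0 < K by rewrite !divr_gt0 ?mulr_gt0 ?invr_gt0 ?exprn_gt0.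
apply: (@is_derive_quad R u z d K (r - normc z)) => //; first by rewrite subr_gt0.
move=> w wz.
have wr : normc w < r.
  by rewrite -(subrK z w) (le_lt_trans (normcD _ _))// -ltrBrDr.
(* The constant K does not depend on n. The partial sums of [a] have one term more than those of
   [dcoef a], being their primitives. *)
have part n : normc (psum a w n.+1 - psum a z n.+1 - psum (dcoef a) z n * (w - z))
    <= K * normc (w - z) ^+ 2.
  rewrite psum_dcoef /psum mulr_suml -!sumrB.
  rewrite (le_trans (normc_sum _ _ _))//.
  apply: (@le_trans _ _ (\sum_(k < n.+1) (M / r ^+ 2 * (K1 * K2)) * normc (w - z) ^+ 2 * q2 ^+ k)).
    apply: ler_sum => k _.
    have -> : a k * w ^+ k - a k * z ^+ k - a k * (k%:R * z ^+ k.-1) * (w - z) =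
      a k * (w ^+ k - z ^+ k - k%:R * z ^+ k.-1 * (w - z)) by ring.
    rewrite normcM -(ler_pM2l (exprn_gt0 2 r0)) mulrCA.
    have h := expr_taylor2 k (ltW zr) (ltW wr).
    apply: le_trans (ler_wpM2l (normc_ge0 _) h) _.
    have -> : r ^+ 2 * (M / r ^+ 2 * (K1 * K2) * normc (w - z) ^+ 2 * q2 ^+ k) =
      M * (K1 * K2 * q2 ^+ k) * normc (w - z) ^+ 2 by field; rewrite gt_eqF.
    rewrite [leLHS]mulrA; apply: ler_wpM2r; first by rewrite exprn_ge0 ?normc_ge0.
    rewrite [leLHS]mulrCA; apply: (@le_trans _ _ (k.+1%:R ^+ 2 * (M * q ^+ k))).
      by rewrite ler_pM ?MP' ?exprn_ge0 ?mulr_ge0 ?normc_ge0 ?exprn_ge0 ?(ltW r0)//;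
        apply: lerXn2r; rewrite ?nnegrE ?ler_nat.
    rewrite [leLHS]mulrCA; apply: ler_wpM2l; first exact: ltW.
    rewrite expr2 -[leLHS]mulrA; apply: le_trans (ler_wpM2l _ (K1P k)) _ => //.
    rewrite [leLHS]mulrCA -[leRHS]mulrA; apply: ler_wpM2l; first exact: ltW.
    exact: K2P.
  rewrite -(big_mkord xpredT (fun k => M / r ^+ 2 * (K1 * K2) * normc (w - z) ^+ 2 * q2 ^+ k)).
  apply: le_trans (geom_sum_le _ _ _ _) _.
  - by rewrite !mulr_ge0 ?exprn_ge0 ?invr_ge0 ?exprn_ge0 ?normc_ge0// ltW.
  - by rewrite (ltW q20).
  - by rewrite expr0 mulr1 /K mulrAC.
apply/ler_addgt0Pr => e e0.
(* Three truncation errors are left: two for the values of u, and one for d that is multiplied by |w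
   - z|. *)
pose e3 := e / (2 + normc (w - z)).
have den : 0 < 2 + normc (w - z) by rewrite ltr_pwDl// normc_ge0.
have e30 : 0 < e3 by rewrite divr_gt0.
have wrho := lt_trans wr rrho.
have [N1 H1] := H w wrho _ e30.
have [N2 H2] := H z zrho _ e30.
have [N3 H3] := dP _ e30.
pose n := maxn N1 (maxn N2 N3).
have {}H1 := H1 n.+1 (leqW (leq_maxl _ _)).
have {}H2 : normc (psum a z n.+1 - u z) < e3.
  by apply: H2; rewrite leqW// leq_max leq_maxl orbT.
have {}H3 : normc (psum (dcoef a) z n - d) < e3.
  by apply: H3; rewrite leq_max leq_maxr orbT.
have -> : u w - u z - d * (w - z) =
  (psum a w n.+1 - psum a z n.+1 - psum (dcoef a) z n * (w - z))
  + ((psum a z n.+1 - u z) - (psum a w n.+1 - u w) + (psum (dcoef a) z n - d) * (w - z)).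
  by ring.
rewrite (le_trans (normcD _ _))// lerD//.
have -> : e = e3 + e3 + e3 * normc (w - z) by rewrite /e3; field; rewrite gt_eqF.
rewrite (le_trans (normcD _ _))// lerD//.
  by rewrite (le_trans (normcBD _ _))// lerD// ltW.
by rewrite normcM ler_wpM2r ?normc_ge0// ltW.
Qed.

Lemma derive1_val (u : C -> C) z d : is_derive z 1 u d -> derive1 u z = d.
Proof. by move=> du; rewrite derive1E; exact: derive_val. Qed.

Lemma pconv_derive1 a rho u : pconv a rho u -> pconv (dcoef a) rho (derive1 u).
Proof.
move=> H z zr; have [d dP /derive1_val dE] := pconv_deriv_at H zr.
by rewrite dE.
Qed.

Lemma pconv_is_derive a rho u z : pconv a rho u -> normc z < rho ->
  is_derive z 1 u (derive1 u z).
Proof.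
move=> H zr; have [d dP du] := pconv_deriv_at H zr.
by move: (du) => /derive1_val ->.
Qed.

Lemma pconv_trunc a rho u n : 0 < rho -> pconv a rho u ->
  exists K e : R, [/\ 0 < K, 0 < e & forall w, normc w < e ->
     normc (psum a w n - u w) <= K * normc w ^+ n].
Proof.
move=> rho0 H; pose r := rho / 2.
have r0 : 0 < r by rewrite divr_gt0.
have rr : 0 <= r < rho by rewrite (ltW r0)/= ltr_pdivrMr// mulr_natr mulr2n ltrDl.
have [M M0 MP] := pconv_bound rr H.
exists (2 * M / r ^+ n), (r / 2); split; rewrite ?divr_gt0 ?mulr_gt0 ?exprn_gt0//.
move=> w wr.
have wr1 : normc w / r < 1 / 2 by rewrite ltr_pdivrMr// mulrC mulrA mulr1.
have q0 : 0 <= normc w / r by rewrite divr_ge0 ?normc_ge0 ?(ltW r0).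
have q1 : normc w / r < 1 by lra.
have [||k|l lP1 lP2] := @pser_geom R a w M (normc w / r).
- exact: ltW.
- by rewrite q0.
- rewrite normcM normcX expr_div_n mulrA ler_pdivlMr ?exprn_gt0// mulrAC.
  by rewrite ler_wpM2r// exprn_ge0// normc_ge0.
have wrho : normc w < rho.
  by rewrite (lt_trans wr)// ltr_pdivrMr// (lt_trans (_ : r < rho))//; [case/andP: rr|lra].
rewrite (pser_unique (H _ wrho) lP1) (le_trans (lP2 n))// expr_div_n.
rewrite ler_pdivrMr ?subr_gt0// (_ : _ / _ * _ * _ = M * (normc w ^+ n / r ^+ n) * (2 * (1 - normc w / r))).
  by rewrite ler_peMr ?mulr_ge0 ?invr_ge0 ?exprn_ge0 ?normc_ge0 ?ltW//; lra.
by ring.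
Qed.

(** Once the lower coefficients vanish, the hypothesis at n + 1 bounds |c n| t ^ n by K t ^ (n + 1)
    for small t > 0. *)
Lemma coef_eq0 (c : nat -> C) : (forall n, exists K e : R, 0 < e /\
    forall w, normc w < e -> normc (psum c w n) <= K * normc w ^+ n) ->
  forall n, c n = 0.
Proof.
move=> H n; elim/ltn_ind: n => n IH.
have [K [e [e0 KP]]] := H n.+1.
apply/eqP; rewrite -normc_eq0 eq_le normc_ge0 andbT; apply/ler_addgt0Pr => d d0.
rewrite add0r.
pose t := Num.min (e / 2) (d / (1 + `|K|)).
have K1 : 0 < 1 + `|K| by rewrite ltr_pwDl.
have t0 : 0 < t by rewrite lt_min !divr_gt0.
have tn : normc t%:C = t by rewrite normcR gtr0_norm.
have := KP t%:C; rewrite tn.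
have te : t < e by rewrite (le_lt_trans (_ : t <= e / 2)) ?ge_min ?lexx// ltr_pdivrMr// mulr_natr mulr2n ltrDl.
move=> /(_ te); rewrite /psum big_ord_recr/= big1 ?add0r => [|k _]; last by rewrite IH ?mul0r.
rewrite normcM normcX tn exprS mulrA ler_pM2r ?exprn_gt0// => /le_trans; apply.
apply: (@le_trans _ _ ((1 + `|K|) * t)).
  by rewrite ler_wpM2r ?(ltW t0)// (le_trans (ler_norm K))// lerDr.
by rewrite mulrC -ler_pdivlMr// ge_min lexx orbT.
Qed.

Lemma psumB a b w n : psum (fun k => a k - b k) w n = psum a w n - psum b w n.
Proof. by rewrite /psum -sumrB; apply: eq_bigr => k _; rewrite mulrBl. Qed.

Lemma pconv_coef_unique a b rho1 rho2 e u v : 0 < rho1 -> 0 < rho2 -> 0 < e ->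
  pconv a rho1 u -> pconv b rho2 v -> (forall w, normc w < e -> u w = v w) -> a = b.
Proof.
move=> r1 r2 e0 H1 H2 uv; apply/funext => n; apply/eqP; rewrite -subr_eq0; apply/eqP.
apply: (@coef_eq0 (fun k => a k - b k)) => {}n.
have [K1 [e1 [K10 e10 KP1]]] := pconv_trunc n r1 H1.
have [K2 [e2 [K20 e20 KP2]]] := pconv_trunc n r2 H2.
exists (K1 + K2), (Num.min e (Num.min e1 e2)); split; first by rewrite !lt_min e0 e10.
move=> w; rewrite !lt_min => /and3P[we we1 we2].
have -> : psum (fun k => a k - b k) w n = (psum a w n - u w) - (psum b w n - v w).
  by rewrite psumB uv//; ring.
by rewrite (le_trans (normcBD _ _))// mulrDl lerD ?KP1 ?KP2.
Qed.

Lemma pconv_coef0 a rho (u : C -> C) : 0 < rho -> pconv a rho u -> a 0%N = u 0.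
Proof.
move=> rho0 H; apply: (@pser_unique R a 0); last by apply: H; rewrite normc0.
move=> e e0; exists 1%N => -[//|n] _.
rewrite /psum big_ord_recl/= expr0 mulr1 big1 ?addr0 ?subrr ?normc0// => k _.
by rewrite /bump/= exprS mul0r mulr0.
Qed.

End TermwiseDerivative.

(** * Integration over circles and Cauchy's formula *)

Section CircleIntegral.
Variable R : realType.
Local Notation C := R[i].
Implicit Types z w : C.

Lemma is_deriveRP (u : R -> R) (x d : R) : is_derive x 1 u d <->
  forall e : R, 0 < e -> exists2 dl : R, 0 < dl & forall w : R, `|w - x| < dl ->
    `|u w - u x - d * (w - x)| <= e * `|w - x|.
Proof.
have E h : h != 0 -> h^-1 *: (u (h *: 1 + x) - u x) - d = (u (h + x) - u x - d * h) / h.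
  by move=> h0; rewrite /GRing.scale /= mulr1 mulrBl mulfK// mulrC//.
split=> [[du <-] e e0|H].
  have du' : (fun h : R => h^-1 *: (u (h *: 1 + x) - u x)) @ 0^' --> 'D_1 u x by exact: du.
  move/cvgrPdist_lt/(_ _ e0): du'.
  rewrite near_withinE => /nbhs_ballP[dl /= dl0 dP]; exists dl => // w wz.
  have [->|wz0] := eqVneq w x; first by rewrite !subrr mulr0 subrr normr0 mulr0.
  have h0 : w - x != 0 by rewrite subr_eq0.
  have := dP (w - x); rewrite /ball/= sub0r normrN => /(_ wz h0)/ltW.
  rewrite /GRing.scale /= mulr1 subrK distrC => h.
  have -> : u w - u x - 'D_1 u x * (w - x) = ((w - x)^-1 * (u w - u x) - 'D_1 u x) * (w - x).
    by rewrite mulrBl mulrAC mulVf// mul1r.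
  by rewrite normrM ler_wpM2r.
have cv : (fun h : R => h^-1 *: (u (h *: 1 + x) - u x)) @ 0^' --> d.
  apply/cvgrPdist_lt => e e0.
  have e20 : 0 < e / 2 by rewrite divr_gt0.
  have [dl dl0 dP] := H _ e20.
  rewrite near_withinE; apply/nbhs_ballP; exists dl => // h; rewrite /ball/= sub0r normrN => hd h0.
  rewrite distrC E// normrM normfV ltr_pdivrMr ?normr_gt0//.
  have := dP (h + x); rewrite addrK => /(_ hd) /le_lt_trans; apply.
  by rewrite ltr_pM2r ?normr_gt0// ltr_pdivrMr// mulr_natr mulr2n ltrDl.
by apply: DeriveDef; [apply/cvg_ex; exists d|exact: cvg_lim cv].
Qed.

(** Derivative of a curve with respect to a real parameter, in the same quotient-free form as
    [is_deriveCP], so that the two compose directly. *)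
Definition pder (g : R -> C) (t : R) (d : C) : Prop :=
  forall e : R, 0 < e -> exists2 dl : R, 0 < dl & forall s, `|s - t| < dl ->
    normc (g s - g t - d * (s - t)%:C) <= e * `|s - t|.

Lemma pder_ReIm (g : R -> C) t d : pder g t d <->
  is_derive t 1 (fun s => complex.Re (g s)) (complex.Re d) /\
  is_derive t 1 (fun s => complex.Im (g s)) (complex.Im d).
Proof.
split=> [H|[/is_deriveRP H1 /is_deriveRP H2]].
  split; apply/is_deriveRP => e e0; have [dl dl0 dP] := H e e0; exists dl => // s /dP;
    apply: le_trans.
    by rewrite (le_trans _ (Re_le_normc _))// !cReB cReM/= mulr0 subr0.
  by rewrite (le_trans _ (Im_le_normc _))// !cImB cImM/= mulr0 add0r.
move=> e e0; have e20 : 0 < e / 2 by rewrite divr_gt0.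
have [d1 d10 P1] := H1 _ e20; have [d2 d20 P2] := H2 _ e20.
exists (Num.min d1 d2) => [|s]; first by rewrite lt_min d10.
rewrite lt_min => /andP[/P1 h1 /P2 h2].
rewrite (le_trans (normcRe_Im _))// (splitr e) mulrDl lerD//.
  by rewrite !cReB cReM/= mulr0 subr0.
by rewrite !cImB cImM/= mulr0 add0r.
Qed.

Lemma pder_lip (g : R -> C) t d : pder g t d ->
  exists2 dl : R, 0 < dl & forall s, `|s - t| < dl ->
    normc (g s - g t) <= (normc d + 1) * `|s - t|.
Proof.
move=> /(_ 1 ltr01)[dl dl0 dP]; exists dl => // s /dP h.
rewrite -(subrK (d * (s - t)%:C) (g s - g t)) (le_trans (normcD _ _))//.
by rewrite addrC mulrDl lerD// normcM normcR.
Qed.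

Lemma pder_comp (u : C -> C) (g : R -> C) t du d : is_derive (g t) 1 u du ->
  pder g t d -> pder (fun s => u (g s)) t (du * d).
Proof.
move=> /is_deriveCP ud gd e e0.
have [d1 d10 P1] := pder_lip gd.
pose L := normc d + 1; have L0 : 0 < L by rewrite ltr_pwDr// normc_ge0.
have eL : 0 < e / 2 / L by rewrite !divr_gt0.
have [d2 d20 P2] := ud _ eL.
have D0 : 0 < 1 + normc du by rewrite ltr_pwDl// normc_ge0.
have eD : 0 < e / 2 / (1 + normc du) by rewrite !divr_gt0.
have [d3 d30 P3] := gd _ eD.
exists (Num.min d1 (Num.min d3 (d2 / L))) => [|s]; first by rewrite !lt_min d10 d30 divr_gt0.
rewrite !lt_min => /and3P[s1 s3 s2].
have gl := P1 _ s1.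
have gs : normc (g s - g t) < d2.
  by rewrite (le_lt_trans gl)// -/L mulrC -ltr_pdivlMr.
have h2 := P2 _ gs; have h3 := P3 _ s3.
have -> : u (g s) - u (g t) - du * d * (s - t)%:C =
  (u (g s) - u (g t) - du * (g s - g t)) + du * (g s - g t - d * (s - t)%:C) by ring.
rewrite (le_trans (normcD _ _))// (splitr e) mulrDl lerD//.
  rewrite (le_trans h2)// -[leLHS]mulrA; apply: ler_wpM2l; first by rewrite divr_ge0// ltW.
  by rewrite mulrC ler_pdivrMr// mulrC.
rewrite normcM (le_trans (ler_wpM2l (normc_ge0 _) h3))// mulrA ler_wpM2r//.
rewrite mulrCA ler_piMr ?divr_ge0 ?(ltW e0)// ler_pdivrMr// mul1r lerDr//.
Qed.

Lemma pder_affine (b c : C) (g : R -> C) t d : pder g t d ->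
  pder (fun s => b + c * g s) t (c * d).
Proof.
move=> gd e e0; have c0 : 0 < normc c + 1 by rewrite ltr_pwDr// normc_ge0.
have [|dl dl0 dP] := gd (e / (normc c + 1)); first by rewrite divr_gt0.
exists dl => // s /dP h.
rewrite (_ : _ - _ = c * (g s - g t - d * (s - t)%:C)); last by ring.
rewrite normcM (le_trans (ler_wpM2l (normc_ge0 _) h))// mulrA ler_wpM2r//.
by rewrite mulrCA ler_piMr ?(ltW e0)// ler_pdivrMr// mul1r lerDl.
Qed.

Lemma pder_real (t : R) : pder (fun s => s%:C) t 1.
Proof.
move=> e e0; exists 1 => // s _; rewrite mul1r -rmorphB subrr.
by rewrite normc0 mulr_ge0// ltW.
Qed.

Definition cis (t : R) : C := cos t +i* sin t.

Lemma normc_cis t : normc (cis t) = 1.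
Proof. by rewrite /= cos2Dsin2 sqrtr1. Qed.
Lemma cis_neq0 t : cis t != 0.
Proof. by rewrite -normc_gt0 normc_cis. Qed.
Lemma continuous_cis : continuous cis.
Proof.
move=> t; apply/(@cvg_ReIm R _ (nbhs t) (nbhs_filter t)); split.
  exact: continuous_cos.
exact: continuous_sin.
Qed.
Lemma pder_cis t : pder cis t ('i * cis t).
Proof.
apply/pder_ReIm; rewrite cReM cImM /= !mul0r mul1r sub0r add0r mul1r.
by split; [exact: is_derive_cos|exact: is_derive_sin].
Qed.

(* A period on which the right half-plane is the left half of the interval, where
   the substitution x = tan t of the polar coordinates lives. *)
Definition J : set R := `[- (pi / 2), pi + pi / 2]%classic.

Lemma measureJ : lebesgue_measure J = (pi *+ 2)%:E.
Proof.
have p0 := @pi_gt0 R; rewrite lebesgue_measure_itv /= lte_fin ifT; last by lra.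
by rewrite -EFinD; congr EFin; lra.
Qed.

Lemma measurableJ : measurable (J : set (measurableTypeR R)).
Proof. exact: measurable_itv. Qed.

Lemma integrableJ (f : R -> R) : continuous f -> lebesgue_measure.-integrable J (EFin \o f).
Proof.
move=> cf; apply: continuous_compact_integrable; first exact: segment_compact.
exact: continuous_subspaceT.
Qed.

(** The integral is with respect to the angle t, not to dz: it is 2 pi times a circular mean. *)
Definition CI (v : R -> C) : C :=
  (\int[lebesgue_measure]_(t in J) complex.Re (v t)) +i*
  (\int[lebesgue_measure]_(t in J) complex.Im (v t)).

Lemma cont_Re (v : R -> C) : continuous v -> continuous (fun t => complex.Re (v t)).
Proof. by move=> cv t; apply: continuous_comp; [exact: cv|exact: continuous_Re]. Qed.
Lemma cont_Im (v : R -> C) : continuous v -> continuous (fun t => complex.Im (v t)).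
Proof. by move=> cv t; apply: continuous_comp; [exact: cv|exact: continuous_Im]. Qed.

Lemma eq_CI (v v' : R -> C) : v =1 v' -> CI v = CI v'.
Proof. by move=> /funext ->. Qed.

Local Notation IJ f := (\int[lebesgue_measure]_(t in J) f t).

Lemma IJ_D (f g : R -> R) : continuous f -> continuous g ->
  IJ (fun t => f t + g t) = IJ f + IJ g.
Proof. by move=> cf cg; exact: (RintegralD measurableJ (integrableJ cf) (integrableJ cg)). Qed.
Lemma IJ_B (f g : R -> R) : continuous f -> continuous g ->
  IJ (fun t => f t - g t) = IJ f - IJ g.
Proof. by move=> cf cg; exact: (RintegralB measurableJ (integrableJ cf) (integrableJ cg)). Qed.
Lemma IJ_Z (c : R) (f : R -> R) : continuous f -> IJ (fun t => c * f t) = c * IJ f.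
Proof. by move=> cf; exact: (RintegralZl _ measurableJ (integrableJ cf)). Qed.
Lemma cont_Z (c : R) (f : R -> R) : continuous f -> continuous (fun t => c * f t).
Proof.
move=> cf t; have h : {for t, continuous (fun _ : R => c)} by exact: cst_continuous.
exact: (continuousM h (cf t)).
Qed.

Lemma CI_D v v' : continuous v -> continuous v' -> CI (fun t => v t + v' t) = CI v + CI v'.
Proof.
move=> cv cv'; apply: eqRI.
  rewrite cReD /= -(IJ_D (cont_Re cv) (cont_Re cv')); congr Rintegral.
  by apply/funext => t; rewrite cReD.
rewrite cImD /= -(IJ_D (cont_Im cv) (cont_Im cv')); congr Rintegral.
by apply/funext => t; rewrite cImD.
Qed.

Lemma CI_Z (c : C) v : continuous v -> CI (fun t => c * v t) = c * CI v.
Proof.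
move=> cv; have cR := cont_Re cv; have cI := cont_Im cv.
apply: eqRI.
  rewrite cReM /= -(IJ_Z _ cR) -(IJ_Z _ cI) -(IJ_B (@cont_Z _ _ cR) (@cont_Z _ _ cI)).
  by congr Rintegral; apply/funext => t; rewrite cReM.
rewrite cImM /= -(IJ_Z _ cR) -(IJ_Z _ cI) -(IJ_D (@cont_Z _ _ cI) (@cont_Z _ _ cR)).
by congr Rintegral; apply/funext => t; rewrite cImM.
Qed.

Lemma contC_M (f g : R -> C) : continuous f -> continuous g -> continuous (fun t => f t * g t).
Proof. by move=> cf cg t; exact: (continuousM (cf t) (cg t)). Qed.
Lemma contC_D (f g : R -> C) : continuous f -> continuous g -> continuous (fun t => f t + g t).
Proof. by move=> cf cg t; exact: (continuousD (cf t) (cg t)). Qed.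
Lemma contC_Z (c : C) (f : R -> C) : continuous f -> continuous (fun t => c * f t).
Proof.
move=> cf t; have h : {for t, continuous (fun _ : R => c)} by exact: cst_continuous.
exact: (continuousM h (cf t)).
Qed.

Lemma CI_B v v' : continuous v -> continuous v' -> CI (fun t => v t - v' t) = CI v - CI v'.
Proof.
move=> cv cv'.
have E : (fun t => v t - v' t) = (fun t => v t + -1 * v' t).
  apply/funext => t. congr (_ + _). exact: (esym (mulN1r _)).
have F := CI_D cv (@contC_Z (-1) _ cv').
rewrite E. rewrite F.
congr (_ + _). rewrite (@CI_Z _ _ cv'). exact: mulN1r.
Qed.

Lemma CI_conj (v : R -> C) : continuous v -> CI (fun t => (v t)^*) = (CI v)^*.
Proof.
move=> cv; apply: eqRI => /=.
  by congr Rintegral; apply/funext => t; case: (v t).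
rewrite -[RHS]mulN1r -(IJ_Z _ (cont_Im cv)).
by congr Rintegral; apply/funext => t; case: (v t) => x y /=; rewrite mulN1r.
Qed.
End CircleIntegral.

Section CircleEstimates.
Variable R : realType.
Local Notation C := R[i].
Implicit Types z w : C.

Local Notation IJ f := (\int[lebesgue_measure]_(t in @J R) f t).

Lemma contC_cst (c : C) : continuous (fun _ : R => c).
Proof. by move=> t; exact: cst_continuous. Qed.

Lemma contC_comp (u : C -> C) (g : R -> C) : continuous g ->
  (forall t, {for g t, continuous u}) -> continuous (fun t => u (g t)).
Proof. by move=> cg cu t; exact: (continuous_comp (cg t) (cu t)). Qed.

Lemma pder_continuous (g : R -> C) t d : pder g t d -> {for t, continuous g}.
Proof.
move=> /pder_lip[dl dl0 dP].
apply/(@cvgC R _ (nbhs t) (nbhs_filter t)) => e e0.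
have L0 : 0 < normc d + 1 by rewrite ltr_pwDr// normc_ge0.
apply/nbhs_ballP; exists (Num.min dl (e / (normc d + 1))) => /=.
  by rewrite lt_min dl0 divr_gt0.
move=> s; rewrite /ball/= distrC lt_min => /andP[/dP h1 h2].
by rewrite (le_lt_trans h1)// mulrC -ltr_pdivlMr.
Qed.

Lemma IJ_cst (M : R) : IJ (fun=> M) = M * (pi *+ 2).
Proof.
rewrite (Rintegral_cst _ (@measurableJ R)); congr (_ * _).
exact: (congr1 fine (@measureJ R)).
Qed.

Lemma IJ_le (f : R -> R) (M : R) : continuous f -> (forall t, J t -> `|f t| <= M) ->
  `|IJ f| <= M * (pi *+ 2).
Proof.
move=> cf fM.
have cn : continuous (fun t => `|f t|).
  by move=> t; apply: continuous_comp; [exact: cf|exact: norm_continuous].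
have mJ := @measurableJ R.
apply: le_trans (le_normr_Rintegral mJ (integrableJ cf)) _.
rewrite -IJ_cst.
apply: (le_Rintegral mJ (integrableJ cn)) => [|t tJ]; last exact: fM.
by apply: integrableJ => t; exact: cst_continuous.
Qed.

(** The two components are bounded separately, which costs a factor 2 over the sharp constant 2
    pi. *)
Lemma CI_le (v : R -> C) (M : R) : continuous v -> (forall t, J t -> normc (v t) <= M) ->
  normc (CI v) <= M * (pi *+ 4).
Proof.
move=> cv vM; apply: le_trans (normcRe_Im _) _.
rewrite (_ : 4 = 2 + 2)%N// mulrnDr mulrDr lerD//=.
  by apply: (IJ_le (cont_Re cv)) => t tJ; exact: le_trans (Re_le_normc _) (vM t tJ).
by apply: (IJ_le (cont_Im cv)) => t tJ; exact: le_trans (Im_le_normc _) (vM t tJ).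
Qed.

Lemma IJ_FTC (f g : R -> R) : (forall t : R, is_derive t 1 f (g t)) -> continuous g ->
  IJ g = f (pi + pi / 2) - f (- (pi / 2)).
Proof.
move=> fg cg.
have p0 := @pi_gt0 R.
have cf : continuous f.
  by move=> t; apply/differentiable_continuous/derivable1_diffP; case: (fg t).
rewrite /Rintegral (@continuous_FTC2 R g f).
- by rewrite -EFinD.
- by lra.
- exact: continuous_subspaceT.
- split; first by move=> t _; case: (fg t).
    exact/cvg_at_right_filter/cf.
  exact/cvg_at_left_filter/cf.
- by move=> t _; rewrite derive1E; exact: derive_val.
Qed.

Lemma CI_FTC (v v' : R -> C) : (forall t, pder v t (v' t)) -> continuous v' ->
  CI v' = v (pi + pi / 2) - v (- (pi / 2)).
Proof.
move=> h cv'; have h1 t := (pder_ReIm v t (v' t)).1 (h t).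
apply: eqRI.
  rewrite cReB; apply: (@IJ_FTC (fun t => complex.Re (v t)) (fun t => complex.Re (v' t)));
    [by move=> t; case: (h1 t)|exact: cont_Re].
rewrite cImB; apply: (@IJ_FTC (fun t => complex.Im (v t)) (fun t => complex.Im (v' t)));
    [by move=> t; case: (h1 t)|exact: cont_Im].
Qed.

Lemma cis_J : cis (pi + pi / 2) = cis (- (pi / 2)) :> C.
Proof.
apply: eqRI => /=.
  by rewrite addrC cosDpi cosN cos_pihalf oppr0.
by rewrite addrC sinDpi sinN.
Qed.

(** The primitive takes equal values at the ends of [J], because the circle closes up. *)
Lemma CI_closed (v : C -> C) (v' : R -> C) (r : R) (z : C) :
  (forall t, pder (fun t => v (z + r%:C * cis t)) t (v' t)) -> continuous v' ->
  CI v' = 0.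
Proof. by move=> h c; rewrite (CI_FTC h c) /= cis_J subrr. Qed.

Lemma expr_is_derive (z : C) n : is_derive z 1 (fun z => z ^+ n) (n%:R * z ^+ n.-1).
Proof.
have h := @exprn_derivable _ n z 1; have E := @exp_derive _ n z 1.
apply: DeriveDef; first exact: h.
by rewrite E /GRing.scale /= mulr1 -mulr_natl.
Qed.

Lemma contC_X (g : R -> C) n : continuous g -> continuous (fun t => g t ^+ n).
Proof.
move=> cg; elim: n => [|n IH].
  by rewrite (_ : (fun _ => _) = (fun=> 1)); [exact: contC_cst|apply/funext => t; rewrite expr0].
rewrite (_ : (fun _ => _) = (fun t => g t * g t ^+ n)); first exact: contC_M.
by apply/funext => t; rewrite exprS.
Qed.

Lemma CI_cisX n : CI (fun t => cis t ^+ n) = (if n is 0%N then (pi *+ 2)%:C else 0 : C).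
Proof.
case: n => [|n].
  rewrite (_ : (fun _ => _) = (fun=> 1)); last by apply/funext => t; rewrite expr0.
  by apply: eqRI => /=; rewrite IJ_cst ?mul1r ?mul0r.
have c1 := @contC_X _ n.+1 (@continuous_cis R).
pose w t : C := (n.+1%:R * 'i) * cis t ^+ n.+1.
have h : CI w = 0.
  have hc : continuous w by exact: contC_Z.
  apply: (fun hp => @CI_closed (fun z : C => z ^+ n.+1) w 1 0 hp hc) => t.
  have e : (fun t => (0 + 1%:C * cis t : C) ^+ n.+1) = (fun t => cis t ^+ n.+1).
    by apply/funext => s; rewrite add0r mul1r.
  have -> : w t = n.+1%:R * cis t ^+ n * ('i * cis t) by rewrite /w exprS; ring.
  rewrite e; have := pder_comp (expr_is_derive (cis t) n.+1) (pder_cis t).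
  exact.
have ni0 : n.+1%:R * 'i != 0 :> C by rewrite mulf_neq0 ?neq0Ci// pnatr_eq0.
by move: h; rewrite /w CI_Z// => /eqP; rewrite mulf_eq0 (negbTE ni0) => /eqP.
Qed.

Lemma cisV t : (cis t)^-1 = (cis t)^* :> C.
Proof.
apply: (mulfI (cis_neq0 t)); rewrite divff ?cis_neq0// mul_conjc normc_cis expr1n//.
Qed.

Lemma contC_conj (v : R -> C) : continuous v -> continuous (fun t => (v t)^*).
Proof.
move=> cv.
have h (z : C) : {for z, continuous (fun z : C => z^*)}.
  apply/continuousC => e e0; exists e => // w wt.
  by rewrite (_ : w^* - z^* = (w - z)^*) ?normc_conj// rmorphB.
exact: (contC_comp cv (fun t => h (v t))).
Qed.

Lemma contC_V (v : R -> C) : continuous v -> (forall t, v t != 0) -> continuous (fun t => (v t)^-1).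
Proof. by move=> cv v0 t; exact: (cvgV (v0 t) (cv t)). Qed.

Lemma CI_cisV n : CI (fun t => (cis t)^-1 ^+ n) = (if n is 0%N then (pi *+ 2)%:C else 0 : C).
Proof.
have -> : (fun t : R => (cis t)^-1 ^+ n) = (fun t => (cis t ^+ n)^*).
  by apply/funext => t; rewrite cisV rmorphXn.
rewrite CI_conj ?CI_cisX; last exact/contC_X/continuous_cis.
by case: n => [|n]; [rewrite conjc_real|rewrite conjc0].
Qed.

Lemma continuous_sum (F : nat -> R -> C) n : (forall k, continuous (F k)) ->
  continuous (fun t => \sum_(k < n) F k t).
Proof.
move=> cF; elim: n => [|n IH].
  by rewrite (_ : (fun _ => _) = (fun=> 0)); [exact: contC_cst|apply/funext => t; rewrite big_ord0].
rewrite (_ : (fun _ => _) = (fun t => \sum_(k < n) F k t + F n t)).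
  exact: (contC_D IH (cF n)).
by apply/funext => t; rewrite big_ord_recr.
Qed.

Lemma CI_sum (F : nat -> R -> C) n : (forall k, continuous (F k)) ->
  CI (fun t => \sum_(k < n) F k t) = \sum_(k < n) CI (F k).
Proof.
move=> cF; elim: n => [|n IH].
  rewrite big_ord0 (_ : (fun _ => _) = (fun=> 0)); last by apply/funext => t; rewrite big_ord0.
  by apply: eqRI => /=; rewrite IJ_cst mul0r.
rewrite (_ : (fun _ => _) = (fun t => \sum_(k < n) F k t + F n t)).
  by rewrite CI_D// ?IH ?big_ord_recr//; exact: continuous_sum.
by apply/funext => t; rewrite big_ord_recr.
Qed.

Lemma geom_small (M q : R) e : 0 <= q < 1 -> 0 < e ->
  exists N, forall n, (N <= n)%N -> M * q ^+ n < e.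
Proof.
move=> /andP[q0 q1] e0.
have q1' : `|q| < 1 by rewrite ger0_norm.
have /cvgrPdist_lt/(_ _ e0)[N _ NP] := @cvg_geometric R M q q1'.
exists N => n /NP /=; rewrite sub0r normrN; apply: le_lt_trans; exact: ler_norm.
Qed.

Lemma CI_series (F : nat -> R -> C) (v : R -> C) (M q : R) : 0 <= q < 1 ->
  (forall k, continuous (F k)) -> continuous v ->
  (forall t n, J t -> normc (\sum_(k < n) F k t - v t) <= M * q ^+ n) ->
  forall e : R, 0 < e -> exists N, forall n, (N <= n)%N ->
    normc (\sum_(k < n) CI (F k) - CI v) < e.
Proof.
move=> q01 cF cv H e e0.
have [N NP] := geom_small (M * (pi *+ 4)) q01 e0.
exists N => n /NP h; apply: le_lt_trans h.
have cS := @continuous_sum _ n cF.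
have cB : continuous (fun t => \sum_(k < n) F k t - v t).
  by move=> t; exact: (continuousB (cS t) (cv t)).
rewrite -(@CI_sum _ n cF) -(CI_B cS cv) mulrAC.
by apply: (CI_le cB) => t tJ; exact: H.
Qed.
End CircleEstimates.

(** * Contracting a circle integral to a point *)

Section CauchyHomotopy.
Variable R : realType.
Local Notation C := R[i].
Implicit Types z w : C.

Local Notation IJ f := (\int[lebesgue_measure]_(t in @J R) f t).
Local Notation mu := (@lebesgue_measure R).

(** Continuity of the derivative is included because it permits differentiation under the integral
    sign; sums of power series have it. *)
Definition hol (rho : R) (u : C -> C) := forall z, normc z < rho ->
  derivable u z 1 /\ {for z, continuous (derive1 u)}.

Lemma derivable_is_derive (u : C -> C) z : derivable u z 1 -> is_derive z 1 u (derive1 u z).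
Proof. by move=> h; rewrite derive1E; exact: (DeriveDef h (erefl _)). Qed.

Lemma derivable_continuousC (u : C -> C) z : derivable u z 1 -> {for z, continuous u}.
Proof.
move=> du; have h : differentiable u z by apply/derivable1_diffP.
exact: (differentiable_continuous h).
Qed.

Section homotopy.
Variables (u : C -> C) (rho r : R) (z c : C) (k : R -> C).
Hypothesis hu : hol rho u.
Hypothesis zr : normc z < r.
Hypothesis rrho : r < rho.
Hypothesis ck : continuous k.
Hypothesis kE : forall t, k t * (r%:C * cis t - z) = c * (r%:C * cis t).

(** By [kE] the factor [k] is [c] times the Cauchy kernel. The values [c = 1] and [c = - 'i] will
    give the real and the imaginary part of Cauchy's formula. *)
Let g (s t : R) : C := z + s%:C * (r%:C * cis t - z).

Let r0 : 0 < r. Proof. exact: le_lt_trans (normc_ge0 z) zr. Qed.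
(** Room on both sides of [0, 1], so that F is differentiable at the end points too. The path then
    stays within (1 + 2 eta) r, which is the midpoint of r and rho. *)
Let eta : R := (rho - r) / (4 * r).
Let eta0 : 0 < eta. Proof. by rewrite divr_gt0 ?subr_gt0 ?mulr_gt0. Qed.

Let gE s t : g s t = (z - s%:C * z) + (s * r)%:C * cis t.
Proof. by rewrite /g rmorphM; ring. Qed.

Let g_lt s t : - eta <= s <= 1 + eta -> normc (g s t) < rho.
Proof.
move=> /andP[s1 s2]; rewrite (_ : g s t = (1 - s)%:C * z + (s * r)%:C * cis t); last first.
  by rewrite gE rmorphB rmorph1; ring.
rewrite (le_lt_trans (normcD _ _))// !normcM !normcR normc_cis mulr1.
rewrite normrM (gtr0_norm r0).
apply: (@le_lt_trans _ _ ((1 + 2 * eta) * r)).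
  apply: (@le_trans _ _ ((`|1 - s| + `|s|) * r)).
    by rewrite mulrDl lerD2r ler_wpM2l// ltW.
  rewrite ler_wpM2r ?(ltW r0)//.
  by have [h1|h1] := ger0P (1 - s); have [h2|h2] := ger0P s; have := eta0; lra.
have -> : (1 + 2 * eta) * r = r + (rho - r) / 2 by rewrite /eta; field; rewrite gt_eqF.
have := rrho; lra.
Qed.

Let cg s : continuous (g s).
Proof.
have h : continuous (fun t => (s * r)%:C * cis t) := @contC_Z R _ _ (@continuous_cis R).
have h2 := contC_D (@contC_cst R (z - s%:C * z)) h.
by have -> : g s = (fun t => z - s%:C * z + (s * r)%:C * cis t) by apply/funext => t; exact: gE.
Qed.

Let f s t : R := complex.Re (u (g s t) * k t).

Let g_itv s : s \in `]- eta, 1 + eta[ -> - eta <= s <= 1 + eta.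
Proof. by rewrite in_itv /= => /andP[s1 s2]; rewrite !ltW. Qed.

Let cf s : - eta <= s <= 1 + eta -> continuous (f s).
Proof.
move=> sI; apply: cont_Re; apply: contC_M; last exact: ck.
apply: (contC_comp (@cg s)) => t.
by apply: derivable_continuousC; apply: (hu _).1; exact: g_lt.
Qed.

Let derf s t : - eta <= s <= 1 + eta ->
  is_derive s 1 (f ^~ t) (complex.Re (derive1 u (g s t) * (c * (r%:C * cis t)))).
Proof.
move=> sI; have du := derivable_is_derive (hu (g_lt t sI)).1.
have pg : pder (fun s => g s t) s (r%:C * cis t - z).
  have := @pder_affine R z (r%:C * cis t - z) _ _ _ (@pder_real R s).
  rewrite mulr1; congr pder; apply/funext => s'; rewrite /g; ring.
have := pder_affine 0 (k t) (@pder_comp R u (fun s => g s t) s _ _ du pg).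
rewrite (_ : k t * _ = derive1 u (g s t) * (c * (r%:C * cis t))); last by rewrite -kE; ring.
move=> /pder_ReIm[+ _]; congr is_derive.
by apply/funext => s'; rewrite /f add0r mulrC.
Qed.

(** Compactness of the rectangle of parameters yields the constant that dominates the
    s-derivative. *)
Let cont_bound : exists G : R, forall s t, - eta <= s <= 1 + eta -> J t ->
  `|complex.Re (derive1 u (g s t) * (c * (r%:C * cis t)))| <= G.
Proof.
pose K : set (R * R) := `[- eta, 1 + eta]%classic `*` @J R.
pose F (p : R * R) : R := normc (derive1 u (g p.1 p.2)).
have cK : compact K by apply: compact_setX; exact: segment_compact.
have K0 : K !=set0.
  exists (0, 0); split; rewrite /= ?/J /= ?in_itv/=; have := eta0; have := @pi_gt0 R; lra.
have cgg : continuous (fun p : R * R => g p.1 p.2).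
  move=> p; rewrite /g.
  have c1 : {for p, continuous (fun p : R * R => (p.1)%:C : C)}.
    by apply: continuous_comp; [exact: cvg_fst|exact: continuous_real_complex].
  have c2 : {for p, continuous (fun p : R * R => cis p.2 : C)}.
    by apply: continuous_comp; [exact: cvg_snd|exact: continuous_cis].
  have k1 (x : C) : {for p, continuous (fun _ : R * R => x)} by exact: cst_continuous.
  exact: (continuousD (k1 z) (continuousM c1 (continuousB (continuousM (k1 _) c2) (k1 z)))).
have cF : {within K, continuous F}.
  apply: continuous_in_subspaceT => p; rewrite inE => -[/=]; rewrite ?in_itv/= => pI _.
  have h1 : {for g p.1 p.2, continuous (derive1 u)} := (hu (g_lt p.2 pI)).2.
  have h2 := continuous_comp (cgg p) h1.
  exact: (continuous_comp h2 (@continuous_normc R _)).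
have [q _ qP] := compact_EVT_max K0 cK cF.
exists (F q * (normc c * r)) => s t sI tJ.
rewrite (le_trans (Re_le_normc _))// !normcM normc_cis mulr1 normcR (gtr0_norm r0).
have h : (s, t) \in K by rewrite inE; split; [rewrite /= in_itv|exact: tJ].
have cr : 0 <= normc c * r by rewrite mulr_ge0 ?normc_ge0 ?(ltW r0).
by have := ler_wpM2r cr (qP (s, t) h).
Qed.

Let F (s : R) : R := IJ (f s).

Let derF s : - eta < s < 1 + eta ->
  is_derive s 1 F (IJ (fun t => complex.Re (derive1 u (g s t) * (c * (r%:C * cis t))))).
Proof.
move=> sI; have [G GP] := cont_bound.
have sI' : s \in `]- eta, 1 + eta[ by rewrite in_itv.
have mJ := @measurableJ R.
have G0 : 0 <= G.
  apply: le_trans (GP 0 0 _ _); rewrite ?normr_ge0//; rewrite /J/= ?in_itv/=; have := eta0; have := @pi_gt0 R; lra.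
have H1 x : `]- eta, 1 + eta[%classic x -> mu.-integrable (@J R) (EFin \o f x).
  by move=> xI; apply/integrableJ/cf/g_itv.
have H2 x t : `]- eta, 1 + eta[%classic x -> J t -> derivable (f ^~ t) x 1.
  by move=> xI _; case: (derf t (g_itv xI)).
have H3 : forall y : measurableTypeR R, 0 <= (cst G : R -> R) y by [].
have H4 : mu.-integrable (@J R) (EFin \o (cst G : R -> R)).
  by apply: integrableJ => t; exact: cst_continuous.
have H5 x (t : measurableTypeR R) : `]- eta, 1 + eta[%classic x -> J t ->
    `|partial1of2 f x t| <= (cst G : R -> R) t.
  move=> xI tJ; rewrite partial1of2E /=.
  have /@derive_val -> := derf t (g_itv xI).
  by apply: GP => //; exact: g_itv.
have D1 := derivable_under_integral mJ sI' H1 H2 H3 H4 H5.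
have D2 := differentiation_under_integral mJ sI' H1 H2 H3 H4 H5.
apply: DeriveDef; first exact: D1.
rewrite -derive1E D2; congr Rintegral; apply/funext => t.
by rewrite partial1of2E; apply: derive_val; apply: derf; apply: g_itv.
Qed.

Let derF0 (s : R) : 0 < s < 1 -> is_derive s 1 F 0.
Proof.
move=> /andP[s0 s1].
have sI : - eta < s < 1 + eta by have := eta0; lra.
have sI' : - eta <= s <= 1 + eta by have := eta0; lra.
suff <- : IJ (fun t => complex.Re (derive1 u (g s t) * (c * (r%:C * cis t)))) = 0.
  exact: derF.
(* [v] is the t-derivative of [u (g s t)]. Recovering the s-derivative from it divides by s, which
   is why only 0 < s is treated; the mean value theorem asks for no more. *)
pose v (t : R) : C := derive1 u (g s t) * ((s * r)%:C * ('i * cis t)).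
have cdu : continuous (fun t => derive1 u (g s t)).
  by apply: (contC_comp (@cg s)) => t; apply: (hu _).2; exact: g_lt.
have cv : continuous v.
  by apply: (contC_M cdu); do 2 apply: contC_Z; exact: continuous_cis.
have v0 : CI v = 0.
  apply: (@CI_closed R u v (s * r) (z - s%:C * z)) => // t.
  have := derivable_is_derive (hu (g_lt t sI')).1; rewrite gE => du.
  have := @pder_comp R u (fun t => z - s%:C * z + (s * r)%:C * cis t) t _ _ du
    (pder_affine (z - s%:C * z) ((s * r)%:C) (@pder_cis R t)).
  by rewrite /v gE.
have s00 : s%:C * 'i != 0 :> C by rewrite mulf_neq0 ?neq0Ci// fmorph_eq0 gt_eqF.
have : CI (fun t => (c / (s%:C * 'i)) * v t) = 0 by rewrite CI_Z// v0 mulr0.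
move=> /(congr1 (@complex.Re R)) /= <-; congr Rintegral; apply/funext => t.
congr (complex.Re _); rewrite /v rmorphM.
field.
by move: s00; rewrite mulf_eq0 negb_or => /andP[-> ->].
Qed.

(* Along the homotopy g s t from the point z (s = 0) to the circle (s = 1), kE makes
   the s-derivative of the integrand a t-derivative, so the integral is constant. *)
Lemma homotopy_Re : IJ (fun t => complex.Re (u (r%:C * cis t) * k t)) =
  IJ (fun t => complex.Re (u z * k t)).
Proof.
have [||x _] := @MVT_segment R F (fun=> 0) 0 1 ler01.
- by move=> x; rewrite in_itv/=; exact: derF0.
- apply: continuous_in_subspaceT => x; rewrite inE/= in_itv/= => xI.
  apply/differentiable_continuous/derivable1_diffP.
  have [] : is_derive x 1 F (IJ (fun t => complex.Re (derive1 u (g x t) * (c * (r%:C * cis t))))) => //.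
  by apply: derF; have := eta0; lra.
rewrite mul0r => /eqP; rewrite subr_eq0 => /eqP h.
transitivity (F 1).
  by congr Rintegral; apply/funext => t; rewrite /f /g rmorph1 mul1r addrC subrK.
by rewrite h; congr Rintegral; apply/funext => t; rewrite /f /g rmorph0 mul0r addr0.
Qed.
End homotopy.
End CauchyHomotopy.

(** * Cauchy's formula and expansion in power series *)

Section CauchyFormula.
Variable R : realType.
Local Notation C := R[i].
Implicit Types z w : C.

Lemma J_bounded (v : R -> C) : continuous v -> exists M : R, forall t, J t -> normc (v t) <= M.
Proof.
move=> cv.
have cn : continuous (fun t => normc (v t)).
  by move=> t; exact: (continuous_comp (cv t) (@continuous_normc R (v t))).
have J0 : @J R !=set0.
  by exists 0; rewrite /J /= ?in_itv /=; have := @pi_gt0 R; lra.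
have [q _ qP] := compact_EVT_max J0 (@segment_compact R _ _) (continuous_subspaceT (A := @J R) cn).
by exists (normc (v q)) => t tJ; apply: qP; rewrite inE.
Qed.

Section kernel.
Variables (r : R) (z : C).
Hypothesis zr : normc z < r.

Let r0 : 0 < r. Proof. exact: le_lt_trans (normc_ge0 z) zr. Qed.

Lemma circ_neq0 t : r%:C * cis t != 0.
Proof. by rewrite mulf_neq0 ?cis_neq0// fmorph_eq0 gt_eqF. Qed.

Lemma circ_sub_neq0 t : r%:C * cis t - z != 0.
Proof.
rewrite subr_eq0; apply/eqP => h; move: zr.
by rewrite -h normcM normcR normc_cis mulr1 gtr0_norm// ltxx.
Qed.

(** The Cauchy form dw / (w - z) divided by i dt, at w = r cis t. *)
Definition kern (t : R) : C := r%:C * cis t / (r%:C * cis t - z).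

Lemma contC_circ : continuous (fun t => r%:C * cis t).
Proof. exact: (contC_Z (@continuous_cis R)). Qed.

Lemma contC_kern : continuous kern.
Proof.
have h : continuous (fun t => r%:C * cis t - z).
  exact: (contC_D contC_circ (@contC_cst R (- z))).
exact: (contC_M contC_circ (contC_V h circ_sub_neq0)).
Qed.

(** The kernel is the geometric series in z / (r cis t), whose modulus |z| / r < 1 does not depend
    on t; the remainder is explicit and uniform on the circle. *)
Lemma kern_series (v : R -> C) : continuous v ->
  pser (fun j => CI (fun t => v t * (r%:C * cis t)^-1 ^+ j)) z (CI (fun t => v t * kern t)).
Proof.
move=> cv; have [B BP] := J_bounded cv.
pose q := normc z / r.
have q0 : 0 <= q by rewrite divr_ge0 ?normc_ge0 ?(ltW r0).
have q1 : q < 1 by rewrite ltr_pdivrMr// mul1r.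
have q10 : 0 < 1 - q by rewrite subr_gt0.
pose F j t : C := z ^+ j * (v t * (r%:C * cis t)^-1 ^+ j).
have cw j : continuous (fun t => v t * (r%:C * cis t)^-1 ^+ j).
  exact: (contC_M cv (@contC_X R _ j (contC_V contC_circ circ_neq0))).
have cF j : continuous (F j) by exact: (@contC_Z R _ _ (cw j)).
have cvk : continuous (fun t => v t * kern t) by exact: (contC_M cv contC_kern).
move=> e e0.
have [||N NP] := @CI_series R F (fun t => v t * kern t) (B / (1 - q)) q _ cF cvk _ e e0.
- by rewrite q0.
- move=> t n tJ.
  pose x : C := z / (r%:C * cis t).
  have nx : normc x = q by rewrite /x normcM normcV normcM normcR normc_cis mulr1 gtr0_norm.
  have x1 : 1 - x != 0.
    by rewrite subr_eq0; apply/eqP => h; move: q1; rewrite -nx -h normc1 ltxx.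
  have kx : kern t = (1 - x)^-1.
    have h1 := circ_neq0 t; have h2 := circ_sub_neq0 t.
    move: h1; rewrite mulf_eq0 negb_or => /andP[h3 h4].
    apply: (mulIf x1); rewrite mulVf// /kern /x.
    by field; apply/and3P; split; [exact: h4|exact: h3|exact: h2].
  have -> : \sum_(j < n) F j t - v t * kern t = - (v t * x ^+ n * (1 - x)^-1).
    have -> : \sum_(j < n) F j t = v t * \sum_(j < n) x ^+ j.
      by rewrite mulr_sumr; apply: eq_bigr => j _; rewrite /F /x expr_div_n exprVn; ring.
    have E : \sum_(j < n) x ^+ j = (1 - x ^+ n) / (1 - x).
      apply: (canRL (mulfK x1)).
      by rewrite -[1 - x ^+ n]opprB subrX1; ring.
    by rewrite E kx; ring.
  rewrite normcN !normcM normcV normcX nx mulrAC; apply: ler_wpM2r; first exact: exprn_ge0.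
  have n1 : 1 - q <= normc (1 - x) by rewrite -nx -[1 in leLHS](@normc1 R) normc_triB.
  have n10 : 0 < normc (1 - x) := lt_le_trans q10 n1.
  apply: ler_pM; rewrite ?normc_ge0 ?invr_ge0 ?normc_ge0 ?BP//.
  by rewrite lef_pV2.
exists N => n /NP; congr (normc (_ - _) < _); apply: eq_bigr => j _.
by rewrite /F (@CI_Z R _ _ (cw j)) mulrC.
Qed.
End kernel.

Section coefficients.
Variables (u : C -> C) (rho : R).
Hypothesis hu : hol rho u.

Lemma contC_circle r : 0 <= r < rho -> continuous (fun t => u (r%:C * cis t)).
Proof.
move=> /andP[r0 rr]; apply: (@contC_comp R u (fun t => r%:C * cis t)).
  exact: (@contC_Z R _ _ (@continuous_cis R)).
move=> t.
by apply: derivable_continuousC; apply: (hu _).1; rewrite normcM normcR normc_cis mulr1 ger0_norm.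
Qed.

(** The homotopy argument speaks of real parts only; the imaginary part is the real part after
    multiplication of the kernel by - i. *)
Lemma CI_kern r z : normc z < r -> r < rho ->
  CI (fun t => u (r%:C * cis t) * kern r z t) = u z * CI (kern r z).
Proof.
move=> zr rr; have kE := circ_sub_neq0 zr.
have ck := contC_kern zr.
have hR := @homotopy_Re R u rho r z 1 (kern r z) hu zr rr ck.
have ck2 : continuous (fun t => - 'i * kern r z t) := @contC_Z R _ _ ck.
have hI := @homotopy_Re R u rho r z (- 'i) (fun t => - 'i * kern r z t) hu zr rr ck2.
have iE (x : C) : complex.Re (x * (- 'i)) = complex.Im x.
  by case: x => a b /=; ring.
rewrite -(@CI_Z R (u z) _ ck); apply: eqRI => /=.
  by apply: hR => t; rewrite /kern mul1r divfK.
have E (a : R -> C) (b : R -> C) : (fun t => complex.Im (a t * b t)) =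
    (fun t => complex.Re (a t * (- 'i * b t))).
  by apply/funext => t; rewrite -iE; congr complex.Re; ring.
rewrite E (E (fun=> u z)); apply: hI => t.
by rewrite -mulrA /kern divfK.
Qed.

(** Of the geometric series of the kernel only the constant term has a nonzero mean. *)
Lemma CI_kern1 r z : normc z < r -> CI (kern r z) = (pi *+ 2)%:C.
Proof.
move=> zr; have r0 : 0 < r := le_lt_trans (normc_ge0 z) zr.
have := @kern_series r z zr (fun=> 1) (@contC_cst R 1).
rewrite (_ : (fun t => 1 * kern r z t) = kern r z); last by apply/funext => t; rewrite mul1r.
move=> h; apply: (pser_unique h) => e e0; exists 1%N => -[//|n] _.
have cE j : CI (fun t => 1 * (r%:C * cis t)^-1 ^+ j) = if j is 0%N then (pi *+ 2)%:C else 0.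
  have -> : (fun t => 1 * (r%:C * cis t : C)^-1 ^+ j) =
      (fun t => r%:C^-1 ^+ j * (cis t)^-1 ^+ j).
    by apply/funext => t; rewrite mul1r invfM exprMn.
  rewrite CI_Z ?CI_cisV; last exact: (@contC_X R _ j (contC_V (@continuous_cis R) (@cis_neq0 R))).
  by case: j => [|j]; rewrite ?expr0 ?mul1r ?mulr0.
rewrite /psum big_ord_recl cE expr0 mulr1 big1 ?addr0 ?subrr ?normc0// => k _.
by rewrite cE /bump /= mul0r.
Qed.

Definition ccoef (r : R) (j : nat) : C :=
  (pi *+ 2)%:C^-1 * CI (fun t => u (r%:C * cis t) * (r%:C * cis t)^-1 ^+ j).

Lemma pi2C_neq0 : (pi *+ 2)%:C != 0 :> C.
Proof. by rewrite fmorph_eq0 mulrn_eq0/= gt_eqF// pi_gt0. Qed.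

Lemma pser_scale a z l (c : C) : pser a z l -> pser (fun n => c * a n) z (c * l).
Proof.
move=> h e e0; have c0 : 0 < normc c + 1 by rewrite ltr_pwDr// normc_ge0.
have [|N NP] := h (e / (normc c + 1)); first by rewrite divr_gt0.
exists N => n /NP hn.
have -> : psum (fun n => c * a n) z n - c * l = c * (psum a z n - l).
  by rewrite mulrBr /psum mulr_sumr; congr (_ - _); apply: eq_bigr => k _; rewrite mulrA.
rewrite normcM; apply: (@le_lt_trans _ _ ((normc c + 1) * normc (psum a z n - l))).
  by rewrite ler_wpM2r ?normc_ge0// lerDl.
by rewrite mulrC -ltr_pdivlMr.
Qed.

Lemma ccoef_pconv r : r < rho -> pconv (ccoef r) r u.
Proof.
move=> rr z zr; have r0 : 0 < r := le_lt_trans (normc_ge0 z) zr.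
have cu := @contC_circle r; rewrite (ltW r0) rr in cu.
have := pser_scale ((pi *+ 2)%:C^-1) (@kern_series r z zr _ (cu isT)).
rewrite CI_kern// CI_kern1//.
by rewrite (_ : _^-1 * (u z * _) = u z)// mulrCA mulVf ?mulr1// pi2C_neq0.
Qed.

(** By uniqueness of coefficients, those computed on one circle agree with those computed on any
    other, so the circle of radius rho / 2 serves the whole disk. *)
Theorem hol_pconv : 0 < rho -> exists a, pconv a rho u.
Proof.
move=> rho0; exists (ccoef (rho / 2)) => z zr.
have [r zr' rr] := lt_dense zr.
have r0 : 0 < r := le_lt_trans (normc_ge0 z) zr'.
have h2 : rho / 2 < rho by lra.
have h20 : 0 < rho / 2 by rewrite divr_gt0.
have -> : ccoef (rho / 2) = ccoef r.
  exact: (pconv_coef_unique h20 r0 r0 (ccoef_pconv h2) (ccoef_pconv rr) (fun w _ => erefl (u w))).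
exact: ccoef_pconv.
Qed.

Lemma CI_mean r : 0 < r < rho -> CI (fun t => u (r%:C * cis t)) = (pi *+ 2)%:C * u 0.
Proof.
move=> /andP[r0 rr]; have z0 : normc (0 : C) < r by rewrite normc0.
have := CI_kern z0 rr; rewrite CI_kern1// mulrC => <-; apply: eq_CI => t.
by rewrite /kern subr0 divff ?mulr1// (circ_neq0 z0).
Qed.
End coefficients.
End CauchyFormula.

(** * Analytic functions, exponential and logarithm *)

Section Analytic.
Variable R : realType.
Local Notation C := R[i].
Implicit Types z w : C.

Implicit Types u v p : C -> C.

Definition an (u : C -> C) (z : C) := exists a, has_expansion u z a.

Lemma continuousC_near (f g : C -> C) z (e : R) : 0 < e ->
  (forall w, normc (w - z) < e -> f w = g w) -> {for z, continuous g} -> {for z, continuous f}.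
Proof.
move=> e0 fg /continuousC cg; apply/continuousC => d d0.
have [d1 d10 P] := cg d d0; exists (Num.min e d1); first by rewrite lt_min e0.
move=> w; rewrite lt_min => /andP[/fg -> /P].
by rewrite (fg z)// subrr normc0.
Qed.

Lemma is_derive_near (f g : C -> C) z d (e : R) : 0 < e ->
  (forall w, normc (w - z) < e -> f w = g w) -> is_derive z 1 g d -> is_derive z 1 f d.
Proof.
move=> e0 fg /is_deriveCP dg; apply/is_deriveCP => x x0.
have [d1 d10 P] := dg x x0; exists (Num.min e d1); first by rewrite lt_min e0.
move=> w; rewrite lt_min => /andP[/fg -> /P].
by rewrite (fg z)// subrr normc0.
Qed.

Lemma is_derive_shiftC (u : C -> C) z h d :
  is_derive (h + z) 1 u d <-> is_derive h 1 (fun h => u (h + z)) d.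
Proof.
split=> /is_deriveCP H; apply/is_deriveCP => e e0; have [dl dl0 P] := H e e0;
  exists dl => // w wh.
  by have := P (w + z); rewrite (_ : w + z - (h + z) = w - h); [apply|ring].
have := P (w - z); rewrite subrK (_ : w - z - h = w - (h + z)); last by ring.
exact.
Qed.

Lemma pconv_hol a rho u : pconv a rho u -> hol rho u.
Proof.
move=> H z zr; split; first by case: (pconv_is_derive H zr).
by apply: derivable_continuousC; case: (pconv_is_derive (pconv_derive1 H) zr).
Qed.

(** Complex differentiability with continuous derivative nearby characterises analyticity. Sums,
    products, inverses and compositions are then handled by derivatives, without manipulating
    coefficients. *)
Lemma anP u z : an u z <-> exists2 e : R, 0 < e & forall w, normc (w - z) < e ->
  derivable u w 1 /\ {for w, continuous (derive1 u)}.
Proof.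
pose v h := u (h + z).
have dv h : derivable u (h + z) 1 -> derive1 v h = derive1 u (h + z).
  by move=> /derivable_is_derive/is_derive_shiftC/derive1_val.
split=> [[a /has_expansion_pconv[e e0 H]]|[e e0 H]].
  exists e => // w wz.
  have du h : normc h < e -> derivable u (h + z) 1.
    by move=> he; have /is_derive_shiftC[] := pconv_is_derive H he.
  have wE : w = (w - z) + z by rewrite subrK.
  split; first by rewrite wE; exact: du.
  have /continuousC cw := (pconv_hol H wz).2.
  apply/continuousC => d d0; have [d1 d10 P] := cw d d0.
  have ew : 0 < e - normc (w - z) by rewrite subr_gt0.
  exists (Num.min (e - normc (w - z)) d1); first by rewrite lt_min ew.
  move=> w'; rewrite lt_min => /andP[h1 h2].
  have w'z : normc (w' - z) < e.
    rewrite (_ : w' - z = (w' - w) + (w - z)); last by ring.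
    by rewrite (le_lt_trans (normcD _ _))// -ltrBrDr.
  have := P (w' - z); rewrite (_ : w' - z - (w - z) = w' - w); last by ring.
  move=> /(_ h2); rewrite !dv ?subrK//.
    by have := du _ wz; rewrite subrK.
  by have := du _ w'z; rewrite subrK.
suff [a aP] : exists a, pconv a e v by exists a; apply/has_expansion_pconv; exists e.
apply: hol_pconv => // h he.
have hz : normc (h + z - z) < e by rewrite addrK.
have [d1 c1] := H _ hz.
split; first by have /is_derive_shiftC[] := derivable_is_derive d1.
have ew : 0 < e - normc h by rewrite subr_gt0.
have cs : {for h, continuous (fun h => derive1 u (h + z))}.
  have ch : {for h, continuous (fun h : C => h + z)}.
    have i1 : {for h, continuous (fun h : C => h)} by exact: cvg_id.
    have i2 : {for h, continuous (fun _ : C => z)} by exact: cst_continuous.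
    exact: (continuousD i1 i2).
  exact: (continuous_comp ch c1).
apply: (continuousC_near ew _ cs) => w wh; apply: dv; apply: (H _ _).1; rewrite addrK.
by rewrite -(subrK h w) (le_lt_trans (normcD _ _))// -ltrBrDr.
Qed.

Lemma an_near u z : an u z -> exists2 e : R, 0 < e & forall w, normc (w - z) < e -> an u w.
Proof.
move=> /anP[e e0 H]; exists e => // w wz; apply/anP.
exists (e - normc (w - z)); first by rewrite subr_gt0.
move=> w' w'w; apply: H; rewrite (_ : w' - z = (w' - w) + (w - z)); last by ring.
by rewrite (le_lt_trans (normcD _ _))// -ltrBrDr.
Qed.

Lemma normc_subrr z (e : R) : 0 < e -> normc (z - z) < e.
Proof. by rewrite subrr normc0. Qed.

Lemma an_is_derive u z : an u z -> is_derive z 1 u (derive1 u z).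
Proof.
by move=> /anP[e e0 H]; apply: derivable_is_derive; case: (H z (normc_subrr z e0)).
Qed.
Lemma an_continuous u z : an u z -> {for z, continuous u}.
Proof. by move=> /an_is_derive[h _]; exact: derivable_continuousC. Qed.

Lemma an_intro u (d : C -> C) z (e : R) : 0 < e -> (forall w, normc (w - z) < e ->
  is_derive w 1 u (d w) /\ {for w, continuous d}) -> an u z.
Proof.
move=> e0 H; apply/anP; exists e; first exact: e0.
move=> w wz; have [h1 h2] := H _ wz.
split; first exact: (@ex_derive _ _ _ _ _ _ _ h1).
have ew : 0 < e - normc (w - z) by rewrite subr_gt0.
apply: (continuousC_near ew _ h2) => w' w'w.
apply: derive1_val; apply: (H _ _).1; rewrite (_ : w' - z = (w' - w) + (w - z)); last by ring.
by rewrite (le_lt_trans (normcD _ _))// -ltrBrDr.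
Qed.

Lemma an_derive1 u z : an u z -> an (derive1 u) z.
Proof.
move=> [a /has_expansion_pconv[e e0 H]]; exists (dcoef a).
apply/has_expansion_pconv; exists e => // h he.
have := pconv_derive1 H he.
by have /is_derive_shiftC/derive1_val -> := pconv_is_derive H he.
Qed.

Lemma eq_an u v z (e : R) : 0 < e -> (forall w, normc (w - z) < e -> u w = v w) ->
  an v z -> an u z.
Proof.
move=> e0 uv [a /has_expansionP[e1 e10 H]]; exists a; apply/has_expansionP.
exists (Num.min e e1) => [|w]; first by rewrite lt_min e0.
by rewrite lt_min => /andP[/uv ->]; exact: H.
Qed.

Lemma an_cst (c : C) z : an (fun=> c) z.
Proof.
apply: (@an_intro _ (fun=> 0) _ 1); first exact: ltr01.
move=> w _; split; last exact: cst_continuous.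
exact: is_derive_cst.
Qed.
Lemma an_id z : an (fun w => w) z.
Proof.
apply: (@an_intro _ (fun=> 1) _ 1); first exact: ltr01.
move=> w _; split; last exact: cst_continuous.
exact: is_derive_id.
Qed.

Lemma an2 u v z : an u z -> an v z ->
  exists2 e : R, 0 < e & forall w, normc (w - z) < e -> an u w /\ an v w.
Proof.
move=> /an_near[e1 e10 H1] /an_near[e2 e20 H2]; exists (Num.min e1 e2).
  by rewrite lt_min e10.
by move=> w; rewrite lt_min => /andP[/H1 ? /H2].
Qed.

Lemma an_D u v z : an u z -> an v z -> an (fun w => u w + v w) z.
Proof.
move=> uz vz; have [e e0 H] := an2 uz vz.
apply: (@an_intro _ (fun w => derive1 u w + derive1 v w) _ e); first exact: e0.
move=> w /H[h1 h2].
split; first exact: (is_deriveD (an_is_derive h1) (an_is_derive h2)).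
exact: (continuousD (an_continuous (an_derive1 h1)) (an_continuous (an_derive1 h2))).
Qed.

Lemma is_deriveMC u v z (du dv : C) : is_derive z 1 u du -> is_derive z 1 v dv ->
  is_derive z 1 (fun w => u w * v w) (u z * dv + v z * du).
Proof. by move=> h1 h2; exact: (is_deriveM h1 h2). Qed.

Lemma an_M u v z : an u z -> an v z -> an (fun w => u w * v w) z.
Proof.
move=> uz vz; have [e e0 H] := an2 uz vz.
apply: (@an_intro _ (fun w => u w * derive1 v w + v w * derive1 u w) _ e); first exact: e0.
move=> w /H[h1 h2].
split; first exact: (is_deriveMC (an_is_derive h1) (an_is_derive h2)).
exact: (continuousD
  (continuousM (an_continuous h1) (an_continuous (an_derive1 h2)))
  (continuousM (an_continuous h2) (an_continuous (an_derive1 h1)))).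
Qed.

Lemma an_Z (c : C) u z : an u z -> an (fun w => c * u w) z.
Proof. by move=> uz; exact: (an_M (an_cst c z) uz). Qed.
Lemma an_N u z : an u z -> an (fun w => - u w) z.
Proof.
move=> uz; rewrite (_ : (fun w => - u w) = (fun w => -1 * u w)); first exact: an_Z.
by apply/funext => w; rewrite mulN1r.
Qed.
Lemma an_B u v z : an u z -> an v z -> an (fun w => u w - v w) z.
Proof. by move=> uz vz; exact: (an_D uz (an_N vz)). Qed.
Lemma an_X u z n : an u z -> an (fun w => u w ^+ n) z.
Proof.
move=> uz; elim: n => [|n IH].
  by rewrite (_ : (fun _ => _) = (fun=> 1)); [exact: an_cst|apply/funext => w; rewrite expr0].
rewrite (_ : (fun _ => _) = (fun w => u w * u w ^+ n)); first exact: (an_M uz IH).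
by apply/funext => w; rewrite exprS.
Qed.
Lemma near_neq0 u z : {for z, continuous u} -> u z != 0 ->
  exists2 e : R, 0 < e & forall w, normc (w - z) < e -> u w != 0.
Proof.
move=> /continuousC cu; rewrite -normc_gt0 => /cu[d d0 H]; exists d => // w /H h.
apply/eqP => w0; move: h; rewrite w0 sub0r normcN ltxx//.
Qed.

Lemma is_deriveVC u z (du : C) : u z != 0 -> is_derive z 1 u du ->
  is_derive z 1 (fun w => (u w)^-1) (- du / u z ^+ 2).
Proof.
move=> u0 [h <-]; have hd := derivableV u0 h; have hv := deriveV u0 h.
apply: DeriveDef; first exact: hd.
by rewrite hv /GRing.scale /= mulNr mulrC mulNr.
Qed.

Lemma an_V u z : an u z -> u z != 0 -> an (fun w => (u w)^-1) z.
Proof.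
move=> uz u0; have [e1 e10 H1] := an_near uz.
have [e2 e20 H2] := near_neq0 (an_continuous uz) u0.
apply: (@an_intro _ (fun w => - derive1 u w / u w ^+ 2) _ (Num.min e1 e2)).
  by rewrite lt_min e10.
move=> w; rewrite lt_min => /andP[/H1 h1 /H2 h2].
split; first exact: (is_deriveVC h2 (an_is_derive h1)).
have i1 := continuousN (an_continuous (an_derive1 h1)).
have i2 := an_continuous (an_X 2 h1).
have h3 : u w ^+ 2 != 0 by rewrite expf_neq0.
exact: (continuousM i1 (cvgV h3 i2)).
Qed.
Lemma an_div u v z : an u z -> an v z -> v z != 0 -> an (fun w => u w / v w) z.
Proof. by move=> uz vz v0; exact: (an_M uz (an_V vz v0)). Qed.

Lemma is_derive_compC (u v : C -> C) z (du dv : C) : is_derive z 1 u du ->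
  is_derive (u z) 1 v dv -> is_derive z 1 (fun w => v (u w)) (dv * du).
Proof.
move=> /is_deriveCP hu /is_deriveCP hv; apply/is_deriveCP => e e0.
have [d1 d10 P1] := hu 1 ltr01.
pose L := normc du + 1; have L0 : 0 < L by rewrite ltr_pwDr// normc_ge0.
have eL : 0 < e / 2 / L by rewrite !divr_gt0.
have [d2 d20 P2] := hv _ eL.
have D0 : 0 < 1 + normc dv by rewrite ltr_pwDl// normc_ge0.
have eD : 0 < e / 2 / (1 + normc dv) by rewrite !divr_gt0.
have [d3 d30 P3] := hu _ eD.
exists (Num.min d1 (Num.min d3 (d2 / L))) => [|s]; first by rewrite !lt_min d10 d30 divr_gt0.
rewrite !lt_min => /and3P[s1 s3 s2].
have gl : normc (u s - u z) <= L * normc (s - z).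
  rewrite -(subrK (du * (s - z)) (u s - u z)) (le_trans (normcD _ _))//.
  by rewrite addrC /L mulrDl normcM; apply: lerD => //; exact: P1.
have gs : normc (u s - u z) < d2.
  by rewrite (le_lt_trans gl)// mulrC -ltr_pdivlMr.
have h2 := P2 _ gs; have h3 := P3 _ s3.
have -> : v (u s) - v (u z) - dv * du * (s - z) =
  (v (u s) - v (u z) - dv * (u s - u z)) + dv * (u s - u z - du * (s - z)) by ring.
rewrite (le_trans (normcD _ _))// (splitr e) mulrDl; apply: lerD.
  rewrite (le_trans h2)// -[leLHS]mulrA; apply: ler_wpM2l; first by rewrite divr_ge0// ltW.
  by rewrite mulrC ler_pdivrMr// mulrC.
rewrite normcM (le_trans (ler_wpM2l (normc_ge0 _) h3))// mulrA; apply: ler_wpM2r.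
  exact: normc_ge0.
by rewrite mulrCA ler_piMr ?divr_ge0 ?(ltW e0)// ler_pdivrMr// mul1r lerDr.
Qed.

Lemma an_comp u v z : an u z -> an v (u z) -> an (fun w => v (u w)) z.
Proof.
move=> uz vz; have [e1 e10 H1] := an_near uz; have [e2 e20 H2] := an_near vz.
have /continuousC/(_ _ e20)[e3 e30 H3] := an_continuous uz.
apply: (@an_intro _ (fun w => derive1 v (u w) * derive1 u w) _ (Num.min e1 e3)).
  by rewrite lt_min e10.
move=> w; rewrite lt_min => /andP[/H1 h1 /H3/H2 h2].
split; first exact: (is_derive_compC (an_is_derive h1) (an_is_derive h2)).
exact: (continuousM (continuous_comp (an_continuous h1) (an_continuous (an_derive1 h2)))
  (an_continuous (an_derive1 h1))).
Qed.

Definition andisk rho u := forall z, normc z < rho -> an u z.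

Lemma andisk_hol rho u : andisk rho u -> hol rho u.
Proof.
move=> H z /H zr; split; first by case: (an_is_derive zr).
exact: an_continuous (an_derive1 zr).
Qed.
Lemma andisk_pconv rho u : 0 < rho -> andisk rho u -> exists a, pconv a rho u.
Proof. by move=> rho0 h; exact: (hol_pconv (andisk_hol h) rho0). Qed.
Lemma pconv_andisk a rho u : pconv a rho u -> andisk rho u.
Proof.
move=> /pconv_hol H z zr; apply/anP; exists (rho - normc z); first by rewrite subr_gt0.
move=> w wz; apply: H; rewrite -(subrK z w).
by rewrite (le_lt_trans (normcD _ _))// -ltrBrDr.
Qed.

Lemma pconv_const (c : C) rho : pconv (fun n => if n is 0%N then c else 0) rho (fun=> c).
Proof.
move=> z _ e e0; exists 1%N => -[//|n] _.
rewrite /psum big_ord_recl/= expr0 mulr1 big1 ?addr0 ?subrr ?normc0// => k _.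
by rewrite mul0r.
Qed.

Lemma andisk_const rho u : andisk rho u -> (forall z, normc z < rho -> is_derive z 1 u 0) ->
  forall z, normc z < rho -> u z = u 0.
Proof.
move=> hu d0 z zr; have rho0 : 0 < rho := le_lt_trans (normc_ge0 z) zr.
have [a aP] := andisk_pconv rho0 hu.
have da0 := pconv_coef_unique rho0 rho0 rho0 (pconv_derive1 aP) (@pconv_const 0 rho)
  (fun w wr => derive1_val (d0 w wr)).
have aE : a = (fun n => if n is 0%N then u 0 else 0).
  apply/funext => -[|n]; first exact: (pconv_coef0 rho0 aP).
  have := congr1 (@^~ n) da0; rewrite /dcoef => h; apply/eqP.
  have : n.+1%:R * a n.+1 = 0 by rewrite h; case: (n).
  by move/eqP; rewrite mulf_eq0 pnatr_eq0.
by apply: (pser_unique (aP z zr)); rewrite aE; exact: (@pconv_const (u 0) rho z zr).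
Qed.

(** Termwise integration; the integrated terms are dominated by those of p, up to the factor r. *)
Lemma antiderivative rho p : 0 < rho -> andisk rho p ->
  exists l, [/\ andisk rho l, l 0 = 0 & forall z, normc z < rho -> is_derive z 1 l (p z)].
Proof.
move=> rho0 hp; have [a aP] := andisk_pconv rho0 hp.
pose b n := if n is n'.+1 then a n' / n'.+1%:R else 0.
have bP z : normc z < rho -> exists l, pser b z l.
  move=> zr; have [r zr' rr] := lt_dense zr.
  have r0 : 0 < r := le_lt_trans (normc_ge0 z) zr'.
  have [|M M0 MP] := @pconv_bound R a rho p r _ aP; first by rewrite (ltW r0).
  have q1 : normc z / r < 1 by rewrite ltr_pdivrMr// mul1r.
  have q0 : 0 <= normc z / r by rewrite divr_ge0 ?normc_ge0 ?(ltW r0).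
  have [||k|l lP _] := @pser_geom R b z (M * r) (normc z / r).
  - by rewrite mulr_ge0// ltW.
  - by rewrite q0.
  - case: k => [|k]; first by rewrite mul0r normc0 expr0 mulr1 mulr_ge0// ltW.
    have -> : M * r * (normc z / r) ^+ k.+1 = M / r ^+ k * normc z ^+ k.+1.
      by rewrite expr_div_n (exprS r k); field; rewrite expf_neq0 gt_eqF.
    rewrite /b normcM normcX normcM normcV normc_natr; apply: ler_wpM2r.
      by rewrite exprn_ge0// normc_ge0.
    rewrite ler_pdivlMr ?exprn_gt0// (le_trans _ (MP k))//; apply: ler_wpM2r.
      by rewrite exprn_ge0// ltW.
    by rewrite ler_piMr ?normc_ge0// invf_le1// ler1n.
  by exists l.
pose l z := xget 0 [set l | pser b z l].
have lP : pconv b rho l by move=> z /bP[x xP]; apply: (xgetPex 0); exists x.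
exists l; split.
- exact: pconv_andisk lP.
- by rewrite -(pconv_coef0 rho0 lP).
- move=> z zr; have := pconv_is_derive lP zr.
  rewrite (_ : derive1 l z = p z)//.
  apply: (pser_unique (pconv_derive1 lP zr)).
  rewrite (_ : dcoef b = a); first exact: aP.
  by apply/funext => n; rewrite /dcoef /b mulrC divfK// pnatr_eq0.
Qed.

Definition ddiff (u : C -> C) (z w : C) : C :=
  if w == z then derive1 u z else (u w - u z) / (w - z).

Lemma ddiffM u z w : u w - u z = ddiff u z w * (w - z).
Proof.
rewrite /ddiff; case: eqVneq => [->|wz]; first by rewrite !subrr mulr0.
by rewrite divfK// subr_eq0.
Qed.

(** The divided difference has the coefficients of u shifted by one; its value at z is the
    coefficient of index 1. *)
Lemma an_ddiff_self u z : an u z -> an (ddiff u z) z.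
Proof.
move=> [a /has_expansion_pconv[e e0 H]]; exists (fun n => a n.+1).
apply/has_expansion_pconv; exists e => // h he d d0.
have du := pconv_is_derive H; have a1 : a 1%N = derive1 u z.
  have z0 : normc (0 : C) < e by rewrite normc0.
  have := pconv_coef0 e0 (pconv_derive1 H); rewrite /dcoef mul1r => ->.
  have h1 := (is_derive_shiftC u z 0 _).2 (du 0 z0); rewrite add0r in h1.
  exact: (esym (derive1_val h1)).
rewrite /ddiff -subr_eq0 addrK; case: eqVneq => [->|h0].
  exists 1%N => -[//|n] _; rewrite /psum big_ord_recl/= expr0 mulr1 a1 big1 ?addr0 ?subrr ?normc0//.
  by move=> k _; rewrite /bump/= exprS mul0r mulr0.
have hd : 0 < d * normc h by rewrite mulr_gt0// normc_gt0.
have [N NP] := H h he _ hd; exists N => n Nn.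
have := NP n.+1 (leqW Nn); rewrite mulrC -ltr_pdivrMl ?normc_gt0//.
congr (_ < _); rewrite -normcV -normcM; congr normc.
have a0 : a 0%N = u z by rewrite (pconv_coef0 e0 H) add0r.
rewrite /psum big_ord_recl/= expr0 mulr1 a0.
have -> : \sum_(i < n) a (bump 0 i) * h ^+ bump 0 i = h * \sum_(i < n) a i.+1 * h ^+ i.
  by rewrite mulr_sumr; apply: eq_bigr => i _; rewrite /bump/= add1n exprS; ring.
by field.
Qed.

Lemma an_ddiff u z w : an u z -> an u w -> an (ddiff u z) w.
Proof.
move=> uz uw; have [->|wz] := eqVneq w z; first exact: an_ddiff_self.
have wz0 : 0 < normc (w - z) by rewrite normc_gt0 subr_eq0.
have wz1 : w - z != 0 by rewrite subr_eq0.
have h := an_div (an_B uw (an_cst (u z) w)) (an_B (an_id w) (an_cst z w)) wz1.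
apply: (eq_an wz0 _ h) => w' w'w; rewrite /ddiff ifF//.
by apply/negbTE/eqP => E; move: w'w; rewrite E normcB ltxx.
Qed.
End Analytic.

(** * Complex exponential and principal logarithm *)

Section ExpLog.
Variable R : realType.
Local Notation C := R[i].
Implicit Types z w : C.

Definition Cexp z : C := (expR (complex.Re z))%:C * cis (complex.Im z).

Lemma cisD (s t : R) : cis (s + t) = cis s * cis t :> C.
Proof. by apply: eqRI => /=; rewrite ?cosD ?sinD// addrC. Qed.
Lemma cis0 : cis 0 = 1 :> C.
Proof. by apply: eqRI => /=; rewrite ?cos0 ?sin0. Qed.

Lemma CexpD z w : Cexp (z + w) = Cexp z * Cexp w.
Proof. by rewrite /Cexp cReD cImD expRD cisD rmorphM; ring. Qed.
Lemma Cexp0 : Cexp 0 = 1.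
Proof. by rewrite /Cexp /= expR0 cis0 mulr1. Qed.
Lemma normc_Cexp z : normc (Cexp z) = expR (complex.Re z).
Proof. by rewrite normcM normcR normc_cis mulr1 ger0_norm// expR_ge0. Qed.
Lemma Cexp_neq0 z : Cexp z != 0.
Proof. by rewrite -normc_gt0 normc_Cexp expR_gt0. Qed.
Lemma CexpN z : Cexp (- z) = (Cexp z)^-1.
Proof.
by apply: (mulfI (Cexp_neq0 z)); rewrite divff ?Cexp_neq0// -CexpD subrr Cexp0.
Qed.

Lemma is_derive_Cexp0 : is_derive (0 : C) 1 Cexp 1.
Proof.
apply/is_deriveCP => e e0.
have e3 : 0 < e / 4 by rewrite divr_gt0.
pose e' := Num.min 1 (e / 4).
have e'0 : 0 < e' by rewrite lt_min ltr01.
have e'1 : e' <= 1 by rewrite ge_min lexx.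
have e'e : e' <= e / 4 by rewrite ge_min lexx orbT.
have /is_deriveRP/(_ _ e'0)[d1 d10 P1] := is_derive_expR (0 : R).
have [d2 d20 P2] := @pder_cis R 0 _ e'0.
exists (Num.min (Num.min d1 d2) (e' / 2)); first by rewrite !lt_min d10 d20 divr_gt0.
move=> [x y]; rewrite subr0 !lt_min => /andP[/andP[w1 w2] w3].
have xw : `|x| <= normc (x +i* y) := Re_le_normc (x +i* y).
have yw : `|y| <= normc (x +i* y) := Im_le_normc (x +i* y).
have h1 : `|expR x - 1 - x| <= e' * `|x|.
  by have := P1 x; rewrite subr0 expR0 mul1r; apply; exact: le_lt_trans w1.
have h2 : normc (cis y - 1 - 'i * y%:C) <= e' * `|y|.
  have := P2 y; rewrite subr0 cis0 mulr1; apply; exact: le_lt_trans w2.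
have h3 : `|expR x - 1| <= e'.
  rewrite -(subrK x (expR x - 1)) (le_trans (ler_normD _ _))//.
  apply: (@le_trans _ _ (`|x| + `|x|)).
    by rewrite lerD2r (le_trans h1)// ler_piMl.
  by have := le_lt_trans xw w3; lra.
have h4 : expR x <= 2 by move: h3; rewrite ler_norml; lra.
(* The remainder splits into that of [expR], that of [cis] scaled by expR x <= 2, and a cross term;
   they receive e / 4, e / 2 and e / 4. *)
have -> : Cexp (x +i* y) - Cexp 0 - 1 * (x +i* y) =
   (expR x - 1 - x)%:C + ((expR x)%:C * (cis y - 1 - 'i * y%:C) + (expR x - 1)%:C * ('i * y%:C)).
  rewrite Cexp0 /Cexp /=; apply: eqRI => /=.
    ring.
  ring.
have nw := normc_ge0 (x +i* y).
have eE : e = e / 4 + (e / 4 * 2 + e / 4) by lra.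
apply: le_trans (normcD _ _) _; rewrite [e in leRHS]eE.
rewrite [in leRHS]mulrDl; apply: lerD.
  rewrite normcR (le_trans h1)//; apply: ler_pM => //; exact: ltW.
apply: le_trans (normcD _ _) _; rewrite [in leRHS]mulrDl; apply: lerD.
  rewrite normcM normcR (ger0_norm (expR_ge0 _)).
  rewrite [e / 4 * 2]mulrC -mulrA; apply: ler_pM; rewrite ?expR_ge0 ?normc_ge0//.
  by rewrite (le_trans h2)//; apply: ler_pM => //; exact: ltW.
have ni : normc ('i : C) = 1 by rewrite /= expr0n expr1n /= add0r sqrtr1.
rewrite !normcM !normcR ni mul1r.
by apply: ler_pM => //; exact: le_trans h3 e'e.
Qed.

Lemma is_derive_Cexp z : is_derive z 1 Cexp (Cexp z).
Proof.
have /is_deriveCP H := is_derive_Cexp0; apply/is_deriveCP => e e0.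
have eC : 0 < e / normc (Cexp z) by rewrite divr_gt0// normc_gt0 Cexp_neq0.
have [d d0 P] := H _ eC; exists d => // w wz.
have := P (w - z); rewrite subr0 => /(_ wz) h.
have -> : Cexp w - Cexp z - Cexp z * (w - z) = Cexp z * (Cexp (w - z) - Cexp 0 - 1 * (w - z)).
  have -> : Cexp w = Cexp (w - z) * Cexp z by rewrite -CexpD subrK.
  by rewrite Cexp0; ring.
rewrite normcM (le_trans (ler_wpM2l (normc_ge0 _) h))//.
by rewrite mulrA mulrCA divff ?mulr1// gt_eqF// normc_gt0 Cexp_neq0.
Qed.

Lemma an_Cexp z : an Cexp z.
Proof.
apply: (@an_intro R Cexp Cexp z 1); first exact: ltr01.
move=> w _; split; first exact: is_derive_Cexp.
by apply: derivable_continuousC; case: (is_derive_Cexp w).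
Qed.

(** The principal logarithm. Its analytic properties are established on the right half-plane, which
    contains the values close to 1 and the values 1 + c z with |c|, |z| < 1 to which it is
    applied. *)
Definition Lg z : C := ln (normc z) +i* Carg z.

Lemma Lg1 : Lg 1 = 0.
Proof.
by apply: eqRI; rewrite /Lg /Carg /= ?expr0n ?expr1n /= ?addr0 ?sqrtr1 ?ln1 ?mul0r ?atan0 ?mul0rn.
Qed.

Lemma Re_gt0_neq0 z : 0 < complex.Re z -> z != 0.
Proof. by move=> h; apply/eqP => z0; move: h; rewrite z0 ltxx. Qed.

(** With t = Im z / (|z| + Re z), the tangent of the half angle, one has 1 + t ^ 2 = 2 |z| / (|z| +
    Re z), and the double-angle formulas return Re z / |z| and Im z / |z|. *)
Lemma Cexp_Lg z : 0 < complex.Re z -> Cexp (Lg z) = z.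
Proof.
move=> zr; have n0 : 0 < normc z by rewrite normc_gt0 Re_gt0_neq0.
rewrite /Cexp /Lg /= lnK ?posrE//.
set X := complex.Re z; set Y := complex.Im z; set rho := normc z.
have rE : rho ^+ 2 = X ^+ 2 + Y ^+ 2 := normcE2 z.
have D0 : 0 < rho + X by rewrite addr_gt0.
pose t := Y / (rho + X); pose a := atan t.
have c0 : 0 < cos a by apply: cos_gt0_pihalf; rewrite atan_gtNpi2 atan_ltpi2.
have t1 : 0 < 1 + t ^+ 2 by rewrite ltr_pwDl// sqr_ge0.
have cE : cos a ^+ 2 = (1 + t ^+ 2)^-1.
  by rewrite cos_atan exprVn sqr_sqrtr// ltW.
have sE : sin a = t * cos a.
  by have := atanK t; rewrite /tan -/a => {1}<-; rewrite divfK// gt_eqF.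
have tE : 1 + t ^+ 2 = 2 * rho / (rho + X).
  apply: (mulIf (x := (rho + X) ^+ 2)); first by rewrite expf_neq0// gt_eqF.
  rewrite /t; transitivity ((rho + X) ^+ 2 + Y ^+ 2); first by field; rewrite gt_eqF.
  transitivity (2 * rho * (rho + X)); last by field; rewrite gt_eqF.
  have -> : Y ^+ 2 = rho ^+ 2 - X ^+ 2 by rewrite rE; ring.
  ring.
have r0 : rho != 0 by rewrite gt_eqF.
have D1 : rho + X != 0 by rewrite gt_eqF.
have -> : Carg z = a *+ 2 by [].
apply: eqRI => /=.
  rewrite mul0r subr0 cos_mulr2n cE tE; field.
  by rewrite r0 D1.
rewrite mul0r addr0 sin_mulr2n sE mulrCA -expr2 cE tE /t; field.
by rewrite r0 D1.
Qed.

Lemma Re_gt0_near z : 0 < complex.Re z ->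
  exists2 e : R, 0 < e & forall w, normc (w - z) < e -> 0 < complex.Re w.
Proof.
move=> zr; exists (complex.Re z) => // w /(le_lt_trans (Re_le_normc _)).
by rewrite cReB ltr_norml => /andP[+ _]; lra.
Qed.

Lemma continuous_Lg z : 0 < complex.Re z -> {for z, continuous Lg}.
Proof.
move=> zr; have n0 : 0 < normc z by rewrite normc_gt0 Re_gt0_neq0.
apply/(@cvg_ReIm R _ (nbhs z) (nbhs_filter z)); split.
  exact: (continuous_comp (@continuous_normc R z) (continuous_ln n0)).
have D1 : normc z + complex.Re z != 0 by rewrite gt_eqF// addr_gt0.
have c1 : {for z, continuous (fun w : C => normc w + complex.Re w)}.
  exact: (continuousD (@continuous_normc R z) (@continuous_Re R z)).
have c2 : {for z, continuous (fun w : C => complex.Im w / (normc w + complex.Re w))}.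
  exact: (continuousM (@continuous_Im R z) (cvgV D1 c1)).
have c3 := continuous_comp c2 (@continuous_atan R _).
have E : (fun t : C => complex.Im (Lg t)) =
   (fun w : C => atan (complex.Im w / (normc w + complex.Re w)) + atan (complex.Im w / (normc w + complex.Re w))).
  by apply/funext => w; rewrite /Lg /= /Carg mulr2n.
by rewrite E; exact: (continuousD c3 c3).
Qed.

(** [Lg] is a continuous right inverse of [Cexp], so its derivative is read off from the first-order
    expansion of [Cexp] at [Lg z]. *)
Lemma is_derive_Lg z : 0 < complex.Re z -> is_derive z 1 Lg z^-1.
Proof.
move=> zr; have z0 := Re_gt0_neq0 zr; have nz : 0 < normc z by rewrite normc_gt0.
have [d1 d10 P1] := Re_gt0_near zr.
apply/is_deriveCP => e e0.
(* The first bound lets the error be absorbed in |z m|, which gives |m| <= (2 / |z|) |w - z|; the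
   second turns the remainder into e |w - z|. *)
pose e' := Num.min (normc z / 2) (e * normc z ^+ 2 / 2).
have e'0 : 0 < e' by rewrite lt_min !divr_gt0// mulr_gt0// exprn_gt0.
have e'1 : e' <= normc z / 2 by rewrite ge_min lexx.
have e'2 : e' <= e * normc z ^+ 2 / 2 by rewrite ge_min lexx orbT.
have /is_deriveCP/(_ _ e'0)[d2 d20 P2] := is_derive_Cexp (Lg z).
have /continuousC/(_ _ d20)[d3 d30 P3] := continuous_Lg zr.
exists (Num.min d1 d3); first by rewrite lt_min d10.
move=> w; rewrite lt_min => /andP[/P1 wr /P3/P2].
rewrite !Cexp_Lg//; set m := Lg w - Lg z => h.
have m1 : normc m <= 2 / normc z * normc (w - z).
  rewrite mulrAC ler_pdivlMr//.
  have : normc (z * m) <= normc (w - z) + normc z / 2 * normc m.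
    rewrite (_ : z * m = (w - z) - (w - z - z * m)); last by ring.
    rewrite (le_trans (normcBD _ _))// lerD2l (le_trans h)//.
    by apply: ler_wpM2r => //; exact: normc_ge0.
  by rewrite normcM mulrC; lra.
have -> : m - z^-1 * (w - z) = - (z^-1 * (w - z - z * m)).
  by field.
rewrite normcN normcM normcV mulrC ler_pdivrMr// (le_trans h)//.
rewrite (le_trans (ler_wpM2l (ltW e'0) m1))// [leLHS]mulrA [leRHS]mulrAC; apply: ler_wpM2r.
  exact: normc_ge0.
rewrite mulrA ler_pdivrMr//.
by move: e'2; rewrite expr2 mulrA; lra.
Qed.

Lemma an_Lg z : 0 < complex.Re z -> an Lg z.
Proof.
move=> zr; have [d d0 P] := Re_gt0_near zr.
apply: (@an_intro R Lg (fun w => w^-1) z d d0) => w /P wr; split; first exact: is_derive_Lg.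
exact: an_continuous (an_V (an_id w) (Re_gt0_neq0 wr)).
Qed.

Lemma Cpow_Cexp z lambda : z != 0 -> Cpow z lambda = Cexp (lambda%:C * Lg z).
Proof.
move=> z0; have n0 : 0 < normc z by rewrite normc_gt0.
rewrite /Cpow /Cexp cReM cImM /= !mul0r subr0 addr0 /powR gt_eqF//.
Qed.
End ExpLog.

(** * Polar coordinates *)

Section Substitution.
Variable R : realType.
Local Notation C := R[i].
Implicit Types z w : C.

Local Notation MR := (measurableTypeR R).
Local Notation mu := (@lebesgue_measure R).
Local Open Scope ereal_scope.

Lemma ge0_integral_mrestr d (T : measurableType d) (m : {measure set T -> \bar R})
    (S : set T) (mS : measurable S) (f : T -> \bar R) :
  measurable_fun setT f -> (forall x, 0 <= f x) ->
  \int[mrestr m mS]_x f x = \int[m]_(x in S) f x.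
Proof.
move=> mf f0.
rewrite (@ge0_negligible_integral _ _ _ (mrestr m mS) setT (~` S))//; last 2 first.
- exact: measurableC.
- by change (m (~` S `&` S) = 0); rewrite setICl measure0.
rewrite setTD setCK.
apply: eq_measure_integral => A mA AS.
by change (m (A `&` S) = m A); rewrite setIidl.
Qed.

Lemma lebesgue_measure_0itv (c : R) : (0 <= c)%R -> mu `[0%R, c]%classic = c%:E.
Proof.
rewrite lebesgue_measure_itv/= lte_fin le_eqVlt => /predU1P[<-|->].
  by rewrite ltxx.
by rewrite sube0.
Qed.

(** The measure with density [dg] on [D], pushed forward by [g], agrees with Lebesgue measure on
    half-open intervals and hence everywhere. Neither injectivity nor smoothness of [g] enters
    beyond that. *)
Lemma ge0_substitution (g dg : MR -> MR) (D : set MR) : measurable D ->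
  measurable_fun setT g -> measurable_fun setT dg -> (forall x, (0 <= dg x)%R) ->
  (forall a b : R, (a <= b)%R ->
     \int[mu]_(x in D `&` g @^-1` `]a, b]%classic) (dg x)%:E = (b - a)%:E) ->
  forall H : MR -> \bar R, measurable_fun setT H -> (forall x, 0 <= H x) ->
  \int[mu]_x H x = \int[mu]_(x in D) (H (g x) * (dg x)%:E).
Proof.
move=> mD mg mdg dg0 E H mH H0.
(* The density is realised as area under its graph: the product measure restricted to the subgraph
   of [dg] is a measure by construction. *)
pose S : set (MR * MR) := [set p | D p.1] `&` ([set p | (0 <= p.2)%R] `&` [set p | (p.2 <= dg p.1)%R]).
have mS : measurable S.
  apply: measurableI.
    by rewrite -[X in measurable X]setTI; exact: measurable_fst.
  apply: measurableI.
    have := @measurable_fun_le _ _ R setT (fun _ : MR * MR => 0%R) snd measurableT.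
    by rewrite setTI; apply.
  have := @measurable_fun_le _ _ R setT (snd : MR * MR -> MR) (dg \o fst) measurableT.
  by rewrite setTI; apply => //; exact: measurableT_comp.
pose m2 := mu \x mu.
have mgf : measurable_fun setT (g \o fst : MR * MR -> MR) by exact: measurableT_comp.
pose nu := pushforward (mrestr m2 mS) (g \o fst).
have nuE K : measurable_fun setT K -> (forall x, 0 <= K x) ->
    \int[nu]_x K x = \int[mu]_(x in D) (K (g x) * (dg x)%:E).
  move=> mK K0.
  rewrite ge0_integral_pushforward// preimage_setT.
  have mKg : measurable_fun setT (K \o (g \o fst) : MR * MR -> \bar R) by exact: measurableT_comp.
  rewrite (ge0_integral_mrestr _ mS mKg)//; last by move=> x; exact: K0.
  rewrite integral_mkcond.
  have mKS : measurable_fun setT ((K \o (g \o fst)) \_ S).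
    by apply: (measurable_restrictT _ mS).1; exact: measurable_funTS.
  have KS0 p : 0 <= ((K \o (g \o fst)) \_ S) p.
    by rewrite patchE; case: ifP => // _; exact: K0.
  rewrite (fubini_tonelli1 _ mKS KS0) [RHS]integral_mkcond.
  apply: eq_integral => x _; rewrite /fubini_F patchE.
  case: ifPn => [/set_mem xD|/negP xD]; last first.
    apply: integral0_eq => y _; rewrite patchE ifF//.
    by apply/negP => /set_mem[/= xD' _]; apply: xD; rewrite inE.
  transitivity (\int[mu]_y ((cst (K (g x))) \_ `[0%R, dg x]%classic) y).
    apply: eq_integral => y _; rewrite !patchE; congr (if _ then _ else _).
    apply/idP/idP => /set_mem.
      by move=> [_ [/= y0 y1]]; rewrite inE/= in_itv/= y0 y1.
    by rewrite /= in_itv/= => /andP[y0 y1]; rewrite inE; split.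
  rewrite -integral_mkcond integral_cst//; congr (_ * _).
  exact: lebesgue_measure_0itv.
have nuA A : measurable A -> nu A = \int[mu]_(x in D `&` g @^-1` A) (dg x)%:E.
  move=> mA; transitivity (\int[nu]_x (\1_A x)%:E).
    by rewrite integral_indic// setIT.
  rewrite nuE; last 2 first.
  - by apply/measurable_EFinP; exact: measurable_indic.
  - by move=> x; rewrite lee_fin.
  rewrite integral_mkcondr; apply: eq_integral => x _.
  rewrite patchE indicE /=; case: ifPn => [/set_mem h|h].
    by rewrite mem_set// mul1e.
  by rewrite memNset ?mul0e//= => gA; move: h; rewrite mem_set.
have nuL A : measurable A -> mu A = nu A.
  apply: lebesgue_measure_unique => _ [[a b] _ <-] /=.
  rewrite lebesgue_measure_itv/= lte_fin.
  have mab : measurable (`]a, b]%classic : set MR) by exact: measurable_itv.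
  have h := nuA _ mab.
  case: ifPn => [/ltW ab|]; first by rewrite -EFinB -(E a b ab).
  rewrite -leNgt => ba; apply: esym; apply: (eq_trans h).
  rewrite (_ : `]a, b]%classic = set0) ?preimage_set0 ?setI0 ?integral_set0//.
  apply/seteqP; split => // x /=; rewrite in_itv/= => /andP[ax xb].
  by have := lt_le_trans ax xb; rewrite ltNge ba.
rewrite -nuE//; apply: eq_measure_integral => A mA _; exact: nuL.
Qed.

Lemma ge0_integral_shift (c : R) (H : MR -> \bar R) : measurable_fun setT H ->
  (forall x, 0 <= H x) -> \int[mu]_x H x = \int[mu]_x H (x + c)%R.
Proof.
move=> mH H0; rewrite (@ge0_substitution (fun x => x + c)%R (fun=> 1%R) setT)//.
- by apply: eq_integral => x _; rewrite mule1.
- by apply: continuous_measurable_fun => x; apply: cvgD; [exact: cvg_id|exact: cvg_cst].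
- move=> a b ab; rewrite setTI.
  rewrite (_ : _ @^-1` _ = `](a - c)%R, (b - c)%R]%classic); last first.
    by apply/seteqP; split => x /=; rewrite !in_itv/= ltrBlDr lerBrDr.
  have mm : measurable (`](a - c)%R, (b - c)%R]%classic : set MR) by exact: measurable_itv.
  rewrite (integral_cst mu mm 1%R%:E) mul1e; apply: (eq_trans (lebesgue_measure_itv _)).
  rewrite /= lte_fin; case: ifPn => [_|h]; first by rewrite -EFinB; congr EFin; ring.
  by congr EFin; lra.
Qed.

Lemma ge0_integral_opp (H : MR -> \bar R) : measurable_fun setT H ->
  (forall x, 0 <= H x) -> \int[mu]_x H x = \int[mu]_x H (- x)%R.
Proof.
move=> mH H0; rewrite (@ge0_substitution (fun x => - x)%R (fun=> 1%R) setT)//.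
- by apply: eq_integral => x _; rewrite mule1.
- by apply: continuous_measurable_fun; exact: opp_continuous.
- move=> a b ab; rewrite setTI.
  rewrite (_ : _ @^-1` _ = `[(- b)%R, (- a)%R[%classic); last first.
    by apply/seteqP; split => x /=; rewrite !in_itv/= ltrNr lerNl andbC.
  have mm : measurable (`[(- b)%R, (- a)%R[%classic : set MR) by exact: measurable_itv.
  rewrite (integral_cst mu mm 1%R%:E) mul1e; apply: (eq_trans (lebesgue_measure_itv _)).
  rewrite /= lte_fin; case: ifPn => [_|h]; first by rewrite -EFinB; congr EFin; ring.
  by congr EFin; lra.
Qed.

Lemma ge0_integral_scale (c : R) (H : MR -> \bar R) : (0 < c)%R -> measurable_fun setT H ->
  (forall x, 0 <= H x) -> \int[mu]_x H x = \int[mu]_x (H (x * c)%R * c%:E).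
Proof.
move=> c0 mH H0; rewrite (@ge0_substitution (fun x => x * c)%R (fun=> c) setT)//.
- by apply: continuous_measurable_fun => x; apply: cvgM; [exact: cvg_id|exact: cvg_cst].
- by move=> x; exact: ltW.
- move=> a b ab; rewrite setTI.
  rewrite (_ : _ @^-1` _ = `](a / c)%R, (b / c)%R]%classic); last first.
    by apply/seteqP; split => x /=; rewrite !in_itv/= ltr_pdivrMr// ler_pdivlMr.
  have mm : measurable (`](a / c)%R, (b / c)%R]%classic : set MR) by exact: measurable_itv.
  rewrite (integral_cst mu mm c%:E); transitivity (c%:E * ((b / c - a / c)%R)%:E).
    congr (_ * _); apply: (eq_trans (lebesgue_measure_itv _)); rewrite /= lte_fin.
    case: ifPn => [_|h]; first by rewrite -EFinB.
    congr EFin; suff -> : b = a by rewrite subrr.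
    apply/eqP; rewrite eq_le ab andbT leNgt; apply/negP => ab'; move/negP: h; apply.
    by rewrite ltr_pM2r// invr_gt0.
  by rewrite -EFinM; congr EFin; field; rewrite gt_eqF.
Qed.

Lemma ge0_integral_tan (H : MR -> \bar R) : measurable_fun setT H ->
  (forall x, 0 <= H x) ->
  \int[mu]_x H x = \int[mu]_(x in `](- (pi / 2))%R, (pi / 2)%R[) (H (tan x) * ((cos x) ^- 2)%:E).
Proof.
move=> mH H0.
pose D : set MR := `](- (pi / 2))%R, (pi / 2)%R[%classic.
have mD : measurable D by exact: measurable_itv.
have cos0 x : D x -> (0 < cos x)%R by rewrite /D/= in_itv/=; exact: cos_gt0_pihalf.
have mt : measurable_fun D (tan : MR -> MR).
  apply: open_continuous_measurable_fun; first exact: interval_open.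
  by move=> x /set_mem xD; apply: continuous_tan; rewrite gt_eqF// cos0.
pose g : MR -> MR := tan \_ D.
have mg : measurable_fun setT g by apply: (measurable_restrictT _ mD).1.
pose dg : MR -> MR := (fun x => (cos x) ^- 2)%R \_ D.
have mdg : measurable_fun setT dg.
  apply: (measurable_restrictT _ mD).1; apply: open_continuous_measurable_fun; first exact: interval_open.
  move=> x /set_mem xD; apply: cvgV; first by rewrite expf_neq0// gt_eqF// cos0.
  exact: (continuousM (@continuous_cos R x) (@continuous_cos R x)).
rewrite (@ge0_substitution g dg D)//.
- by apply: eq_integral => x xD; rewrite /g /dg !patchE xD.
- by move=> x; rewrite /dg patchE; case: ifP => // _; rewrite invr_ge0 sqr_ge0.
- move=> a b ab.
  have -> : D `&` g @^-1` `]a, b]%classic = `]atan a, atan b]%classic.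
    apply/seteqP; split => x /=.
      move=> [xD]; rewrite /g patchE mem_set//= !in_itv/= => /andP[h1 h2].
      have xE : atan (tan x) = x by rewrite tanK// inE.
      by rewrite -xE lt_atan// le_atan.
    rewrite !in_itv/= => /andP[h1 h2].
    have xD : D x.
      rewrite /D /= in_itv/= (lt_trans (atan_gtNpi2 a))//=.
      by rewrite (le_lt_trans h2)// atan_ltpi2.
    split => //; rewrite /g patchE mem_set//.
    have xE : atan (tan x) = x by rewrite tanK// inE.
    move: h1 h2; rewrite -xE => h1 h2; rewrite atanK; apply/andP; split.
      by rewrite ltNge; apply/negP => /le_atan; rewrite leNgt h1.
    by rewrite leNgt; apply/negP => /lt_atan; rewrite ltNge h2.
  move: ab; rewrite le_eqVlt => /predU1P[->|ab].
    rewrite subrr (_ : `]_, _]%classic = set0) ?integral_set0//.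
    apply/seteqP; split => // x /=; rewrite in_itv/= => /andP[h1 h2].
    by have := lt_le_trans h1 h2; rewrite ltxx.
  have atab : (atan a < atan b)%R by exact: lt_atan.
  have sub x : (atan a <= x <= atan b)%R -> D x.
    move=> /andP[h1 h2]; rewrite /D /= in_itv/= (lt_le_trans (atan_gtNpi2 a))//=.
    by rewrite (le_lt_trans h2)// atan_ltpi2.
  rewrite integral_itv_obnd_cbnd; last first.
    by apply/measurable_EFinP; exact: measurable_funTS.
  have cc : {within `[atan a, atan b], continuous (fun x : R => (cos x) ^- 2)%R}.
    apply: continuous_in_subspaceT => x; rewrite inE/= in_itv/= => /sub/cos0 cx.
    apply: cvgV; first by rewrite expf_neq0// gt_eqF.
    exact: (continuousM (@continuous_cos R x) (@continuous_cos R x)).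
  have ct x : (atan a <= x <= atan b)%R -> {for x, continuous (@tan R)}.
    by move=> /sub/cos0 cx; apply: continuous_tan; rewrite gt_eqF.
  transitivity (\int[mu]_(x in `[atan a, atan b]) ((cos x) ^- 2)%:E).
    by apply: eq_integral => x; rewrite inE/= in_itv/= => /sub xD; rewrite /dg patchE mem_set.
  rewrite (@continuous_FTC2 R (fun x => (cos x) ^- 2)%R (@tan R))//.
  + by rewrite !atanK EFinB.
  + split.
    * by move=> x; rewrite in_itv/= => /andP[/ltW h1 /ltW h2]; apply: derivable_tan;
        rewrite gt_eqF// cos0//; apply: sub; rewrite h1 h2.
    * by apply: cvg_at_right_filter; apply: ct; rewrite lexx ltW.
    * by apply: cvg_at_left_filter; apply: ct; rewrite lexx ltW.
  + move=> x; rewrite in_itv/= => /andP[/ltW h1 /ltW h2].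
    have c0 : (cos x != 0)%R by rewrite gt_eqF// cos0//; apply: sub; rewrite h1 h2.
    by rewrite derive1E; have [_ ->] := is_derive_tan c0.
Qed.
End Substitution.

Section Polar.
Variable R : realType.
Local Notation C := R[i].
Implicit Types z w : C.

Local Notation MR := (measurableTypeR R).
Local Notation mu := (@lebesgue_measure R).
Local Open Scope ereal_scope.

Local Notation pos := (`]0%R, +oo[%classic : set MR).

Lemma measurable_cosR : measurable_fun setT (cos : MR -> MR).
Proof. by apply: continuous_measurable_fun; exact: continuous_cos. Qed.
Lemma measurable_sinR : measurable_fun setT (sin : MR -> MR).
Proof. by apply: continuous_measurable_fun; exact: continuous_sin. Qed.

Definition polar_integrand (Psi : MR * MR -> \bar R) (p : MR * MR) : \bar R :=
  Psi ((p.2 * cos p.1)%R, (p.2 * sin p.1)%R) * (p.2)%:E.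

Lemma measurable_polar_integrand Psi : measurable_fun setT Psi ->
  measurable_fun setT (polar_integrand Psi).
Proof.
move=> mP; apply: emeasurable_funM.
  apply: (measurableT_comp mP); apply: measurable_fun_pair.
    by apply: measurable_funM; [exact: measurable_snd|
      exact: (measurableT_comp measurable_cosR measurable_fst)].
  by apply: measurable_funM; [exact: measurable_snd|
    exact: (measurableT_comp measurable_sinR measurable_fst)].
by apply/measurable_EFinP; exact: measurable_snd.
Qed.

Definition ray (Psi : MR * MR -> \bar R) (t : MR) : \bar R :=
  \int[mu]_(s in pos) polar_integrand Psi (t, s).

Let mpos2 : measurable ([set p | pos p.2] : set (MR * MR)).
Proof. by rewrite -[X in measurable X]setTI; apply: measurable_snd => //; exact: measurable_itv. Qed.
Let mpos1 : measurable ([set p | pos p.1] : set (MR * MR)).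
Proof. by rewrite -[X in measurable X]setTI; apply: measurable_fst => //; exact: measurable_itv. Qed.

Let posE (x : MR) : (x \in pos) = (0 < x)%R.
Proof. by apply/idP/idP => [/set_mem|h]; rewrite ?inE /= in_itv/= andbT. Qed.

Lemma ray_ge0 Psi t : (forall p, 0 <= Psi p) -> 0 <= ray Psi t.
Proof.
move=> P0; apply: integral_ge0 => s /=; rewrite in_itv/= andbT => s0.
by rewrite mule_ge0// lee_fin ltW.
Qed.

Lemma measurable_ray Psi : measurable_fun setT Psi -> (forall p, 0 <= Psi p) ->
  measurable_fun setT (ray Psi).
Proof.
move=> mP P0.
have mQ : measurable_fun setT (polar_integrand Psi \_ [set p | pos p.2]).
  by apply: (measurable_restrictT _ mpos2).1; apply: measurable_funTS; exact: measurable_polar_integrand.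
have Q0 p : 0 <= (polar_integrand Psi \_ [set p | pos p.2]) p.
  rewrite patchE; case: ifPn => // /set_mem /=; rewrite in_itv/= andbT => s0.
  by rewrite mule_ge0// lee_fin ltW.
have := measurable_fun_fubini_tonelli_F _ mQ Q0 (m2 := mu).
congr (measurable_fun _ _); apply/funext => t.
by rewrite /ray integral_mkcond; apply: eq_integral => s _; rewrite !patchE /= !posE
  (_ : ((t, s) \in _) = (0 < s)%R)//; apply/idP/idP => [/set_mem|h];
  rewrite ?inE /= in_itv/= andbT.
Qed.

(** One-dimensional substitutions suffice: y = x u for fixed x, exchange of the integrals, u = tan
    t, and finally x = s cos t for fixed t. *)
Lemma polar_right Psi : measurable_fun setT Psi -> (forall p, 0 <= Psi p) ->
  \int[mu]_(x in pos) \int[mu]_y Psi (x, y) =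
  \int[mu]_(t in `](- (pi / 2))%R, (pi / 2)%R[) ray Psi t.
Proof.
move=> mP P0.
pose F0 (p : MR * MR) : \bar R := Psi (p.1, (p.2 * p.1)%R) * (p.1)%:E.
pose F := F0 \_ [set p | pos p.1].
have mF0 : measurable_fun setT F0.
  apply: emeasurable_funM.
    apply: (measurableT_comp mP); apply: measurable_fun_pair; first exact: measurable_fst.
    by apply: measurable_funM; [exact: measurable_snd|exact: measurable_fst].
  by apply/measurable_EFinP; exact: measurable_fst.
have mF : measurable_fun setT F.
  by apply: (measurable_restrictT _ mpos1).1; exact: measurable_funTS.
have FE x t : F (x, t) = if (0 < x)%R then Psi (x, (t * x)%R) * x%:E else 0.
  rewrite /F patchE (_ : ((x, t) \in _) = (0 < x)%R)//.
  by apply/idP/idP => [/set_mem|h]; rewrite ?inE /= in_itv/= andbT.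
have F_ge0 p : 0 <= F p.
  case: p => x t; rewrite FE; case: ifP => // x0.
  by rewrite mule_ge0// lee_fin ltW.
transitivity (\int[mu]_x \int[mu]_t F (x, t)).
  rewrite integral_mkcond; apply: eq_integral => x _; rewrite patchE posE.
  case: ifPn => x0; last first.
    by apply/esym; apply: integral0_eq => t _; rewrite FE (negbTE x0).
  have mPx : measurable_fun setT (fun y : MR => Psi (x, y)) by exact: measurable_fun_pair2.
  apply: (eq_trans (ge0_integral_scale x0 mPx (fun y => P0 _))).
  by apply: eq_integral => t _; rewrite FE x0.
rewrite (fubini_tonelli (m1 := mu) (m2 := mu) F mF F_ge0).
have mG := measurable_fun_fubini_tonelli_G F mF F_ge0 (m1 := mu).
have G0 t : 0 <= \int[mu]_x F (x, t) by apply: integral_ge0.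
rewrite (ge0_integral_tan mG G0).
apply: eq_integral => t; rewrite inE/= in_itv/= => tD.
have c0 : (0 < cos t)%R by exact: cos_gt0_pihalf.
have mFt : measurable_fun setT (fun x : MR => F (x, tan t)) by exact: measurable_fun_pair1.
transitivity ((\int[mu]_x (F ((x * cos t)%R, tan t) * (cos t)%:E)) * ((cos t) ^- 2)%:E).
  congr (_ * _); exact: (ge0_integral_scale c0 mFt (fun x => F_ge0 (x, tan t))).
rewrite -ge0_integralZr//; last 3 first.
- apply: emeasurable_funM; last exact: measurable_cst.
  by apply: (measurableT_comp mFt); apply: measurable_funM; [exact: measurable_id|exact: measurable_cst].
- by move=> s _; rewrite mule_ge0// lee_fin ltW.
- by rewrite lee_fin invr_ge0 sqr_ge0.
rewrite /ray [RHS]integral_mkcond; apply: eq_integral => s _.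
rewrite patchE posE FE pmulr_lgt0//; case: ifPn => s0; last by rewrite !mul0e.
rewrite /polar_integrand /=.
have -> : (tan t * (s * cos t) = s * sin t)%R.
  by rewrite /tan mulrCA -mulrA mulVf ?mulr1// gt_eqF.
rewrite -!muleA; congr (_ * _).
by rewrite -!EFinM; congr EFin; field; rewrite gt_eqF.
Qed.

(** A reflection through the origin turns this into the right half-plane and shifts the angle by
    pi. *)
Lemma polar_left Psi : measurable_fun setT Psi -> (forall p, 0 <= Psi p) ->
  \int[mu]_(x in `]-oo, 0%R[) \int[mu]_y Psi (x, y) =
  \int[mu]_(t in `](pi / 2)%R, (pi + pi / 2)%R[) ray Psi t.
Proof.
move=> mP P0.
pose Psi' (p : MR * MR) := Psi ((- p.1)%R, (- p.2)%R).
have mN : measurable_fun setT (fun x : MR => (- x)%R : MR).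
  by apply: continuous_measurable_fun; exact: opp_continuous.
have mP' : measurable_fun setT Psi'.
  apply: (measurableT_comp mP); apply: measurable_fun_pair.
    exact: (measurableT_comp mN measurable_fst).
  exact: (measurableT_comp mN measurable_snd).
have P'0 p : 0 <= Psi' p by exact: P0.
have mF := measurable_fun_fubini_tonelli_F Psi mP P0 (m2 := mu).
have neg : measurable (`]-oo, 0%R[%classic : set MR) by exact: measurable_itv.
have mFn : measurable_fun setT ((fun x : MR => \int[mu]_y Psi (x, y)) \_ `]-oo, 0%R[).
  by apply: (measurable_restrictT _ neg).1; exact: measurable_funTS.
have Fn0 x : 0 <= ((fun x : MR => \int[mu]_y Psi (x, y)) \_ `]-oo, 0%R[) x.
  by rewrite patchE; case: ifP => // _; exact: integral_ge0.
transitivity (\int[mu]_(x in pos) \int[mu]_y Psi' (x, y)).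
  rewrite integral_mkcond (ge0_integral_opp mFn Fn0) [RHS]integral_mkcond.
  apply: eq_integral => x _; rewrite !patchE posE.
  rewrite (_ : (_ \in _) = (0 < x)%R); last first.
    by apply/idP/idP => [/set_mem|h]; rewrite ?inE /= in_itv/= oppr_lt0.
  case: ifP => // _.
  have mPx : measurable_fun setT (fun y : MR => Psi ((- x)%R, y)) by exact: measurable_fun_pair2.
  exact: (ge0_integral_opp mPx (fun y => P0 _)).
rewrite (polar_right mP' P'0).
have mR := measurable_ray mP P0.
pose K := (ray Psi) \_ `](pi / 2)%R, (pi + pi / 2)%R[.
have mD' : measurable (`](pi / 2)%R, (pi + pi / 2)%R[%classic : set MR) by exact: measurable_itv.
have mK : measurable_fun setT K.
  by apply: (measurable_restrictT _ mD').1; exact: measurable_funTS.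
have K0 t : 0 <= K t by rewrite /K patchE; case: ifP => // _; exact: ray_ge0.
rewrite [RHS]integral_mkcond -/K (ge0_integral_shift pi mK K0) integral_mkcond.
apply: eq_integral => t _; rewrite /K !patchE.
rewrite (_ : (_ \in _) = (t + pi \in `](pi / 2)%R, (pi + pi / 2)%R[%classic)%R); last first.
  have p0 := @pi_gt0 R.
  apply/idP/idP => /set_mem /=; rewrite in_itv/= => /andP[h1 h2]; rewrite inE /= in_itv/=.
    rewrite [(pi + _)%R]addrC ltrD2r h2 andbT.
    by move: h1; rewrite -(ltrD2r pi) (_ : - (pi / 2) + pi = pi / 2)%R//; lra.
  move: h2; rewrite [(pi + _)%R]addrC ltrD2r => ->; rewrite andbT.
  by rewrite -(ltrD2r pi) (_ : - (pi / 2) + pi = pi / 2)%R//; lra.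
case: ifP => // _; apply: eq_integral => s _.
by rewrite /polar_integrand /Psi' /= cosDpi sinDpi !mulrN.
Qed.

(** The vertical line through the centre and the direction pi / 2 are null and are discarded before
    the two half-planes are joined. *)
Theorem polar (b1 b2 : R) (Phi : MR * MR -> \bar R) :
  measurable_fun setT Phi -> (forall p, 0 <= Phi p) ->
  \int[mu \x mu]_p Phi p = \int[mu]_(t in @J R)
    ray (fun p => Phi ((b1 + p.1)%R, (b2 + p.2)%R)) t.
Proof.
move=> mP P0; pose Psi (p : MR * MR) := Phi ((b1 + p.1)%R, (b2 + p.2)%R).
have mD (c : MR) : measurable_fun setT (fun x : MR => (c + x)%R : MR).
  by apply: continuous_measurable_fun => x; apply: cvgD; [exact: cvg_cst|exact: cvg_id].
have mPsi : measurable_fun setT Psi.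
  apply: (measurableT_comp mP); apply: measurable_fun_pair.
    exact: (measurableT_comp (mD b1) measurable_fst).
  exact: (measurableT_comp (mD b2) measurable_snd).
have Psi0 p : 0 <= Psi p by exact: P0.
have mF := measurable_fun_fubini_tonelli_F Phi mP P0 (m2 := mu).
have mG := measurable_fun_fubini_tonelli_F Psi mPsi Psi0 (m2 := mu).
have G0 x : 0 <= fubini_F mu Psi x by exact: integral_ge0.
rewrite (fubini_tonelli1 Phi mP P0) (ge0_integral_shift b1 mF); last by move=> x; exact: integral_ge0.
transitivity (\int[mu]_x fubini_F mu Psi x).
  apply: eq_integral => x _; rewrite /fubini_F.
  have mPx : measurable_fun setT (fun y : MR => Phi ((x + b1)%R, y)) by exact: measurable_fun_pair2.
  apply: (eq_trans (ge0_integral_shift b2 mPx (fun y => P0 _))); apply: eq_integral => y _.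
  by rewrite /Psi /= addrC (addrC y).
rewrite -(@integral_setD1 _ _ 0%R setT); last 2 first.
- exact: measurableD.
- exact: measurable_funTS.
have mneg : measurable (`]-oo, 0%R[%classic : set MR) by exact: measurable_itv.
have mpos : measurable pos by exact: measurable_itv.
have -> : [set: MR] `\ 0%R = pos `|` `]-oo, 0%R[%classic.
  apply/seteqP; split => x /=.
    move=> [_ x0]; rewrite !in_itv/= andbT.
    by have [h|h|h] := ltgtP (0%R : R) (x : R); [left|right|case: x0].
  by rewrite !in_itv/= andbT => -[h|h]; split => // x0; move: h; rewrite x0 ltxx.
rewrite ge0_integral_setU//; last 2 first.
- exact: measurable_funTS.
- apply/disj_setPS => x [/=]; rewrite !in_itv/= andbT => h1 h2.
  by have := lt_trans h1 h2; rewrite ltxx.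
rewrite (polar_right mPsi Psi0) (polar_left mPsi Psi0).
have mR := measurable_ray mPsi Psi0.
rewrite /J [RHS]integral_itv_bndoo; last exact: measurable_funTS.
have mO : measurable (`](- (pi / 2))%R, (pi + pi / 2)%R[%classic `\ (pi / 2)%R : set MR).
  by apply: measurableD => //; exact: measurable_itv.
rewrite -[RHS](@integral_setD1 _ _ (pi / 2)%R _ mO); last exact: measurable_funTS.
have p0 := @pi_gt0 R.
have -> : (`](- (pi / 2))%R, (pi + pi / 2)%R[%classic `\ (pi / 2)%R : set MR) =
   `](- (pi / 2))%R, (pi / 2)%R[%classic `|` `](pi / 2)%R, (pi + pi / 2)%R[%classic.
  apply/seteqP; split => x /=.
    rewrite !in_itv/= => -[/andP[h1 h2] h3].
    by have [h|h|h] := ltgtP (x : R) (pi / 2)%R; [left; rewrite h1|right; rewrite h2|case: h3].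
  rewrite !in_itv/= => -[/andP[h1 h2]|/andP[h1 h2]].
    split; last by move=> xE; move: h2; rewrite xE ltxx.
    by rewrite h1 (lt_trans h2)//; lra.
  split; last by move=> xE; move: h1; rewrite xE ltxx.
  by rewrite h2 andbT (lt_trans _ h1)//; lra.
rewrite ge0_integral_setU//.
- exact: measurable_funTS.
- by move=> t _; exact: ray_ge0.
- apply/disj_setPS => x [/=]; rewrite !in_itv/= => /andP[_ h1] /andP[h2 _].
  by have := lt_trans h1 h2; rewrite ltxx.
Qed.
End Polar.

(** * The argument principle on circles *)

Section ArgPrinciple.
Variable R : realType.
Local Notation C := R[i].
Implicit Types z w : C.

Lemma circle_param z r : 0 < r -> normc z = r -> exists2 t : R, J t & z = r%:C * cis t.
Proof.
move=> r0 zr; have rC : r%:C != 0 :> C by rewrite fmorph_eq0 gt_eqF.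
pose u : C := z / r%:C.
have nu : normc u = 1 by rewrite normcM normcV zr normcR gtr0_norm// divff// gt_eqF.
have uE : complex.Re u ^+ 2 + complex.Im u ^+ 2 = 1 by rewrite -normcE2 nu expr1n.
have iu : -1 <= complex.Im u <= 1.
  by rewrite -ler_norml -nu Im_le_normc.
pose a := asin (complex.Im u).
have sa : sin a = complex.Im u by rewrite asinK// in_itv.
have a1 : - (pi / 2) <= a <= pi / 2 by rewrite asin_geNpi2// asin_lepi2.
have ca : cos a ^+ 2 = complex.Re u ^+ 2 by rewrite cos2sin2 sa -uE; ring.
have ca0 : 0 <= cos a by exact: cos_ge0_pihalf.
have p0 := @pi_gt0 R.
suff [t tJ ut] : exists2 t : R, J t & u = cis t.
  by exists t => //; rewrite -ut /u mulrCA divff// mulr1.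
(* The arcsine finds the angle up to reflection in the imaginary axis; the sign of the real part
   decides between a and pi - a, and both lie in [J]. *)
have [h|h] := lerP 0 (complex.Re u).
  exists a; first by rewrite /J /= in_itv /=; move/andP: a1 => [a1 a2]; rewrite a1 /=; lra.
  apply: eqRI => /=; last by rewrite sa.
  by apply/eqP; rewrite -(@eqrXn2 _ 2)//; apply/eqP.
exists (pi - a); first by rewrite /J /= in_itv /=; lra.
apply: eqRI => /=; last by rewrite sinB sinpi cospi mul0r sub0r mulN1r opprK sa.
rewrite cosB cospi sinpi mul0r addr0 mulN1r; apply/eqP; rewrite -eqr_oppLR.
by rewrite -(@eqrXn2 _ 2)// ?sqrrN ?ca// oppr_ge0 ltW.
Qed.

Section univalent_map.
Variable F : C -> C.
Hypothesis hF : andisk 1 F.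
Hypothesis Finj : forall z w, normc z < 1 -> normc w < 1 -> F z = F w -> z = w.
Hypothesis dF0 : forall z, normc z < 1 -> derive1 F z != 0.

Lemma ddiff_neq0 z0 z : normc z0 < 1 -> normc z < 1 -> ddiff F z0 z != 0.
Proof.
move=> h0 h; rewrite /ddiff; case: (eqVneq z z0) => [_|zz0]; first exact: dF0.
rewrite mulf_neq0 ?invr_neq0 ?subr_eq0//.
by apply/eqP => E; move/eqP: zz0; apply; exact: Finj.
Qed.

Variable r : R.
Hypothesis r01 : 0 < r < 1.

Let r0 : 0 < r. Proof. by case/andP: r01. Qed.
Let r1 : r < 1. Proof. by case/andP: r01. Qed.

Let circ (t : R) : C := r%:C * cis t.
Let ncirc t : normc (circ t) = r.
Proof. by rewrite normcM normcR normc_cis mulr1 gtr0_norm. Qed.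
Let circ1 t : normc (circ t) < 1. Proof. by rewrite ncirc. Qed.

Definition wcurve (t : R) : C := F (circ t).
Definition wspeed (t : R) : C := circ t * derive1 F (circ t).

Lemma contC_an (u : C -> C) : andisk 1 u -> continuous (fun t => u (circ t)).
Proof.
move=> hu; apply: (@contC_comp R u circ); first exact: (@contC_Z R _ _ (@continuous_cis R)).
by move=> t; apply: an_continuous; exact: hu.
Qed.

Lemma contC_wcurve : continuous wcurve.
Proof. exact: contC_an. Qed.

Lemma contC_wspeed : continuous wspeed.
Proof.
have h : andisk 1 (derive1 F) by move=> z /hF; exact: an_derive1.
exact: (contC_M (@contC_Z R _ _ (@continuous_cis R)) (contC_an h)).
Qed.

Definition offcurve w := forall z, normc z = r -> F z != w.

Lemma offcurve_neq0 w t : offcurve w -> wcurve t - w != 0.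
Proof. by move=> h; rewrite subr_eq0; exact: h. Qed.

Lemma contC_wkernel w : offcurve w -> continuous (fun t => wspeed t / (wcurve t - w)).
Proof.
move=> ow; have h := contC_D contC_wcurve (@contC_cst R (- w)).
exact: (contC_M contC_wspeed (contC_V h (fun t => offcurve_neq0 t ow))).
Qed.

(* 2 pi times the winding number about w of the image of the circle. *)
Definition windint w : C := CI (fun t => wspeed t / (wcurve t - w)).

(** z F' / (F - w) is analytic on a disk slightly larger than |z| <= r and vanishes at 0, so its
    mean over the circle is 0. *)
Lemma windint_out w : (forall z, normc z <= r -> F z != w) -> windint w = 0.
Proof.
move=> ow.
(* By injectivity w is attained at one point at most, and outside the closed disk; the modulus of
   that point, or 1 if there is none, is the radius. *)
have [rho [rr rho1 H]] : exists rho, [/\ r < rho, rho <= 1 & forall z, normc z < rho -> F z != w].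
  have [[z1 [h1 h2]]|no] := pselect (exists z, normc z < 1 /\ F z = w).
    have zr : r < normc z1.
      by rewrite ltNge; apply/negP => /ow/eqP; apply.
    exists (normc z1); split => //; first exact: ltW.
    move=> z zz1; apply/eqP => E.
    have := Finj (lt_trans zz1 h1) h1; rewrite E h2 => /(_ erefl) zE.
    by move: zz1; rewrite zE ltxx.
  exists 1; split => // z z1; apply/eqP => E; apply: no; exists z => //.
pose v z := z * derive1 F z / (F z - w).
have hv : andisk rho v.
  move=> z zr; have hz := hF (lt_le_trans zr rho1).
  have h0 : F z - w != 0 by rewrite subr_eq0; exact: H.
  exact: (an_div (an_M (an_id z) (an_derive1 hz)) (an_B hz (an_cst w z)) h0).
rewrite /windint (_ : (fun t => _) = (fun t => v (r%:C * cis t)))//.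
rewrite (CI_mean (andisk_hol hv)) ?r0//.
by rewrite /v !mul0r mulr0.
Qed.

(** With F - F z0 = (z - z0) k and k free of zeros, the integrand is z k' / k, of mean 0, plus the
    Cauchy kernel at z0, of integral 2 pi. *)
Lemma windint_in z0 : normc z0 < r -> windint (F z0) = (pi *+ 2)%:C.
Proof.
move=> zr; have z01 := lt_trans zr r1.
pose k := ddiff F z0.
have hk : andisk 1 k by move=> z z1; exact: (an_ddiff (hF z01) (hF z1)).
have k0 z : normc z < 1 -> k z != 0 by exact: ddiff_neq0.
have dFE z : normc z < 1 -> derive1 F z = derive1 k z * (z - z0) + k z.
  move=> z1.
  have d1 : is_derive z 1 (fun z => z - z0) 1.
    apply/is_deriveCP => e e0; exists 1 => // w _.
    by rewrite (_ : _ - _ = 0) ?normc0 ?mulr_ge0 ?normc_ge0 ?ltW//; ring.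
  have d2 := is_deriveMC (an_is_derive (hk _ z1)) d1.
  have d3 : is_derive z 1 F (k z * 1 + (z - z0) * derive1 k z).
    apply/is_deriveCP => e e0; have /is_deriveCP/(_ _ e0)[d dp P] := d2.
    exists d => // w /P; rewrite -/(k w) -!ddiffM.
    by rewrite (_ : F w - F z0 - (F z - F z0) = F w - F z)//; ring.
  by rewrite (derive1_val d3); ring.
pose v z := z * derive1 k z / k z.
have hv : andisk 1 v.
  move=> z z1; exact: (an_div (an_M (an_id z) (an_derive1 (hk _ z1))) (hk _ z1) (k0 _ z1)).
have E : (fun t => wspeed t / (wcurve t - F z0)) = (fun t => v (r%:C * cis t) + kern r z0 t).
  apply/funext => t; rewrite /wspeed /wcurve ddiffM dFE// /v /kern -/(circ t) -/k.
  have h1 : k (circ t) != 0 by exact: k0.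
  have h2 : circ t - z0 != 0 by exact: (circ_sub_neq0 zr).
  by field; rewrite h1 h2.
rewrite /windint E CI_D; last 2 first.
- exact: contC_an.
- exact: (contC_kern zr).
rewrite (CI_kern1 zr) (CI_mean (andisk_hol hv)) ?r0 ?r1//.
by rewrite /v !mul0r mulr0 add0r.
Qed.

Lemma wcurve_away : exists2 m : R, 0 < m & forall t, m <= normc (wcurve t - F 0).
Proof.
have cn : continuous (fun t => normc (wcurve t - F 0)).
  have h := contC_D contC_wcurve (@contC_cst R (- F 0)).
  by move=> t; exact: (continuous_comp (h t) (@continuous_normc R _)).
have J0 : @J R !=set0.
  by exists 0; rewrite /J /= ?in_itv /=; have := @pi_gt0 R; lra.
have [q _ qP] := compact_EVT_min J0 (@segment_compact R _ _) (continuous_subspaceT (A := @J R) cn).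
exists (normc (wcurve q - F 0)).
  rewrite normc_gt0 subr_eq0; apply/eqP => /Finj; rewrite normc0 => /(_ (circ1 q) ltr01) h.
  by move: (ncirc q) r0; rewrite h normc0 => ->; rewrite ltxx.
move=> t; have [t' t'J E] := circle_param r0 (ncirc t).
by rewrite /wcurve E; apply: qP; rewrite inE.
Qed.

(** Openness of F at 0, obtained from the winding integral: near F 0 it differs from its value 2 pi
    by at most pi, so it is not 0 and w is attained. The disk found is the one to be cut out of the
    weight. *)
Lemma wdisk : exists2 d : R, 0 < d &
  (forall t, d < normc (wcurve t - F 0)) /\
  (forall w, normc (w - F 0) <= d -> exists2 z, normc z < r & F z = w).
Proof.
have [m m0 mP] := wcurve_away.
have [M MP] := J_bounded contC_wspeed.
pose M' := `|M| + 1; have M'0 : 0 < M' by rewrite ltr_pwDr.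
have M'P t : J t -> normc (wspeed t) <= M'.
  by move=> /MP h; rewrite (le_trans h)// (le_trans (ler_norm M))// lerDl.
(* The first bound keeps w at distance m / 2 from the curve; the second makes the integrands differ
   by at most 1 / 4, hence the integrals by at most 4 pi / 4. *)
pose d := Num.min (m / 2) (m ^+ 2 / (8 * M')).
have d0 : 0 < d by rewrite lt_min !divr_gt0// ?exprn_gt0// mulr_gt0.
have d1 : d <= m / 2 by rewrite ge_min lexx.
have d2 : d <= m ^+ 2 / (8 * M') by rewrite ge_min lexx orbT.
have dm : d < m by lra.
exists d => //; split; first by move=> t; exact: lt_le_trans (mP t).
move=> w wd.
have off w' : normc (w' - F 0) <= d -> offcurve w'.
  move=> w'd z zr; have [t _ E] := circle_param r0 zr; apply/eqP => h.
  by have := mP t; rewrite /wcurve /circ -E h leNgt (le_lt_trans w'd).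
have off0 : offcurve (F 0) by apply: off; rewrite subrr normc0 ltW.
have cw := contC_wkernel (off _ wd); have c0 := contC_wkernel off0.
have I0 : windint (F 0) = (pi *+ 2)%:C by apply: windint_in; rewrite normc0.
have cB : continuous (fun t => wspeed t / (wcurve t - w) - wspeed t / (wcurve t - F 0)).
  by move=> t; exact: (continuousB (cw t) (c0 t)).
have bd : normc (windint w - windint (F 0)) <= 4^-1 * (pi *+ 4).
  rewrite /windint -(CI_B cw c0); apply: (CI_le cB) => t tJ.
  have n0 := offcurve_neq0 t off0; have nw := offcurve_neq0 t (off _ wd).
  have -> : wspeed t / (wcurve t - w) - wspeed t / (wcurve t - F 0) =
    wspeed t * (w - F 0) / ((wcurve t - w) * (wcurve t - F 0)) by field; rewrite n0 nw.
  have p1 := mP t.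
  have p2 : m / 2 <= normc (wcurve t - w).
    rewrite (_ : wcurve t - w = (wcurve t - F 0) - (w - F 0)); last by ring.
    by apply: le_trans (normc_triB _ _); lra.
  rewrite (normcM (wspeed t * (w - F 0))) (normcM (wspeed t)) normcV (normcM (wcurve t - w)).
  rewrite ler_pdivrMr; last by rewrite mulr_gt0//; lra.
  apply: (@le_trans _ _ (M' * d)).
    by apply: ler_pM; [exact: normc_ge0|exact: normc_ge0|exact: M'P|exact: wd].
  apply: (@le_trans _ _ (4^-1 * (m / 2 * m))); last first.
    apply: ler_wpM2l => //; apply: ler_pM => //; first by rewrite divr_ge0// ltW.
    exact: ltW.
  have := ler_wpM2l (ltW M'0) d2.
  by rewrite (_ : M' * (m ^+ 2 / (8 * M')) = 4^-1 * (m / 2 * m))//; field; rewrite gt_eqF.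
have Iw : windint w != 0.
  apply/eqP => h; move: bd; rewrite h I0 sub0r normcN normcR ger0_norm; last by rewrite mulrn_wge0// pi_ge0.
  have := @pi_gt0 R; rewrite (_ : 4^-1 * (pi *+ 4) = pi :> R); last by field.
  rewrite mulr2n; lra.
have [[z [zr zw]]|no] := pselect (exists z, normc z <= r /\ F z = w).
  exists z => //; rewrite lt_neqAle zr andbT; apply/eqP => zE.
  by have := off _ wd _ zE; rewrite zw eqxx.
case/eqP: Iw; apply: windint_out => z zr; apply/eqP => E; apply: no; exists z => //.
Qed.

Lemma windint_dichotomy w : offcurve w ->
  ((exists2 z, normc z < r & F z = w) /\ windint w = (pi *+ 2)%:C) \/
  (~ (exists2 z, normc z < r & F z = w) /\ windint w = 0).
Proof.
move=> ow; have [[z zr zw]|no] := pselect (exists2 z, normc z < r & F z = w).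
  by left; split; [exists z|rewrite -zw; exact: windint_in].
right; split => //; apply: windint_out => z; rewrite le_eqVlt => /predU1P[/ow//|zr].
by apply/eqP => E; apply: no; exists z.
Qed.
End univalent_map.
End ArgPrinciple.

(** * The area formula *)

Section PowerIntegrals.
Variable R : realType.
Local Notation C := R[i].
Implicit Types z w : C.

Local Notation MR := (measurableTypeR R).
Local Notation mu := (@lebesgue_measure R).
Local Notation m2 := (mu \x mu)%E.
Variable al : R.
Hypothesis al0 : 0 < al.

Let prim (s : R) : R := - (s `^ (- al)) / al.

Let is_derive_prim (x : R) : 0 < x -> is_derive x 1 prim (x `^ (- al - 1)).
Proof.
move=> x0.
have h := is_derive1_powR (- al) x0.
have -> : x `^ (- al - 1) = - al^-1 *: (- al * x `^ (- al - 1)).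
  by rewrite /GRing.scale/=; field; rewrite gt_eqF.
have -> : prim = (- al^-1) \*: (fun s : R => s `^ (- al)).
  by apply/funext => s; rewrite /prim mulNr mulrC -mulNr.
exact: is_deriveZ.
Qed.

Let continuous_prim (x : R) : 0 < x -> {for x, continuous prim}.
Proof.
move=> x0; have [d _] := is_derive_prim x0; apply: differentiable_continuous; exact/derivable1_diffP.
Qed.

Lemma continuous_powR_gt0 (p x : R) : 0 < x -> {for x, continuous (fun s : R => s `^ p)}.
Proof.
move=> x0; have [d _] := is_derive1_powR p x0; apply: differentiable_continuous; exact/derivable1_diffP.
Qed.

Let primE (x : R) : 0 < x -> derive1 prim x = x `^ (- al - 1).
Proof. by move=> x0; rewrite derive1E; have [_ ->] := is_derive_prim x0. Qed.

Lemma integral_powR_itv (a b : R) : 0 < a -> a < b ->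
  (\int[mu]_(s in `[a, b]) (s `^ (- al - 1))%:E = ((a `^ (- al) - b `^ (- al)) / al)%:E)%E.
Proof.
move=> a0 ab; have b0 := lt_trans a0 ab.
rewrite (@continuous_FTC2 R (fun s : R => s `^ (- al - 1)) prim)//.
- by rewrite -EFinB /prim; congr EFin; field; rewrite gt_eqF.
- apply: continuous_in_subspaceT => x; rewrite inE/= in_itv/= => /andP[h _].
  by apply: continuous_powR_gt0; exact: lt_le_trans h.
- split.
  + by move=> x; rewrite in_itv/= => /andP[h _]; have [] := is_derive_prim (lt_trans a0 h).
  + by apply: cvg_at_right_filter; exact: continuous_prim.
  + by apply: cvg_at_left_filter; exact: continuous_prim.
- by move=> x; rewrite in_itv/= => /andP[h _]; exact: (primE (lt_trans a0 h)).
Qed.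

Lemma cvg_powRN_pinfty : (s : R) `^ (- al) @[s --> +oo] --> 0.
Proof.
apply/cvgrPdist_lt => e e0; near=> s.
rewrite sub0r normrN ger0_norm ?powR_ge0// powRN.
have s1 : (e^-1) `^ al^-1 < s by near: s; apply: nbhs_pinfty_gt; rewrite num_real.
have s0 : 0 < s by apply: le_lt_trans s1; exact: powR_ge0.
rewrite invf_plt ?posrE ?powR_gt0//.
have -> : e^-1 = ((e^-1) `^ al^-1) `^ al.
  by rewrite -powRrM mulVf ?gt_eqF// powRr1// invr_ge0 ltW.
by apply: gt0_ltr_powR => //; rewrite nnegrE ?powR_ge0// ltW.
Unshelve. all: by end_near. Qed.

Lemma integral_powR_pinfty (a : R) : 0 < a ->
  (\int[mu]_(s in `[a, +oo[) (s `^ (- al - 1))%:E = (a `^ (- al) / al)%:E)%E.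
Proof.
move=> a0.
rewrite (@ge0_continuous_FTC2y R (fun s : R => s `^ (- al - 1)) prim a 0)//.
- by rewrite -EFinB /prim; congr EFin; field; rewrite gt_eqF.
- by move=> x _; exact: powR_ge0.
- apply: continuous_in_subspaceT => x; rewrite inE/= in_itv/= andbT => h.
  by apply: continuous_powR_gt0; exact: lt_le_trans h.
- rewrite (_ : 0 = - al^-1 * 0); last by rewrite mulr0.
  have -> : prim = fun s => - al^-1 * s `^ (- al) by apply/funext => s; rewrite /prim mulNr mulrC -mulNr.
  by apply: cvgM; [exact: cvg_cst|exact: cvg_powRN_pinfty].
- by move=> x h; have [] := is_derive_prim (lt_trans a0 h).
- by apply: cvg_at_right_filter; exact: continuous_prim.
- by move=> x; rewrite in_itv/= andbT => h; exact: (primE (lt_trans a0 h)).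
Qed.

Section measurable_complex.
Context d (T : measurableType d).
Implicit Types u v : T -> C.

Definition measurableC_fun u :=
  measurable_fun setT (fun x => complex.Re (u x) : MR) /\
  measurable_fun setT (fun x => complex.Im (u x) : MR).

Lemma measurableC_cst z : measurableC_fun (fun=> z).
Proof. by split; exact: measurable_cst. Qed.

Lemma measurableC_funB u v :
  measurableC_fun u -> measurableC_fun v -> measurableC_fun (fun x => u x - v x).
Proof.
move=> [u1 u2] [v1 v2]; split; under eq_fun do rewrite ?cReB ?cImB; exact: measurable_funB.
Qed.

Lemma measurableC_funM u v :
  measurableC_fun u -> measurableC_fun v -> measurableC_fun (fun x => u x * v x).
Proof.
move=> [u1 u2] [v1 v2]; split; under eq_fun do rewrite ?cReM ?cImM.
  by apply: measurable_funB; exact: measurable_funM.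
by apply: measurable_funD; exact: measurable_funM.
Qed.

Lemma measurable_normc2 u : measurableC_fun u ->
  measurable_fun setT (fun x => complex.Re (u x) ^+ 2 + complex.Im (u x) ^+ 2 : MR).
Proof.
move=> [u1 u2]; under eq_fun do rewrite !expr2.
by apply: measurable_funD; exact: measurable_funM.
Qed.

Lemma measurable_normc u : measurableC_fun u ->
  measurable_fun setT (fun x => normc (u x) : MR).
Proof.
move=> /measurable_normc2 h.
rewrite (_ : (fun x => _) = (fun x : MR => x `^ 2^-1) \o
   (fun x => complex.Re (u x) ^+ 2 + complex.Im (u x) ^+ 2)).
  apply: measurableT_comp h; exact: measurable_powR.
apply/funext => x /=; rewrite powR12_sqrt ?addr_ge0 ?sqr_ge0//.
by case: (u x).
Qed.

Lemma measurableC_funV u : measurableC_fun u -> measurableC_fun (fun x => (u x)^-1).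
Proof.
move=> hu; have h := measurable_normc2 hu.
have m : measurable_fun setT
    (fun x => (complex.Re (u x) ^+ 2 + complex.Im (u x) ^+ 2)^-1 : MR).
  rewrite (_ : (fun x => _) = (fun x : MR => x `^ (-1)) \o
     (fun x => complex.Re (u x) ^+ 2 + complex.Im (u x) ^+ 2)).
    apply: measurableT_comp h; exact: measurable_powR.
  by apply/funext => x /=; rewrite powR_inv1 ?addr_ge0 ?sqr_ge0.
case: hu => u1 u2; split.
  rewrite (_ : (fun x => _) = fun x => complex.Re (u x) *
    (complex.Re (u x) ^+ 2 + complex.Im (u x) ^+ 2)^-1).
    exact: measurable_funM.
  by apply/funext => x; case: (u x) => a b.
rewrite (_ : (fun x => _) = fun x => - complex.Im (u x) *
  (complex.Re (u x) ^+ 2 + complex.Im (u x) ^+ 2)^-1).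
  by apply: measurable_funM => //; exact: measurable_funN.
by apply/funext => x; case: (u x) => a b /=; rewrite mulNr.
Qed.

Lemma measurable_Re_div u v : measurableC_fun u -> measurableC_fun v ->
  measurable_fun setT (fun x => complex.Re (u x / v x) : MR).
Proof. by move=> hu hv; have [] := measurableC_funM hu (measurableC_funV hv). Qed.

End measurable_complex.

Lemma measurableC_comp d d' (T : measurableType d) (T' : measurableType d')
    (g : T' -> T) (u : T -> C) :
  measurable_fun setT g -> measurableC_fun u -> measurableC_fun (fun x => u (g x)).
Proof.
move=> mg [u1 u2]; split; first exact: (measurableT_comp u1 mg).
exact: (measurableT_comp u2 mg).
Qed.

Lemma measurableC_continuous (u : MR -> C) : continuous (u : R -> C) -> measurableC_fun u.
Proof.
move=> cu; split; apply: continuous_measurable_fun; first exact: (cont_Re cu).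
exact: (cont_Im cu).
Qed.

Definition cpt (p : MR * MR) : C := p.1 +i* p.2.

Lemma measurableC_cpt : measurableC_fun cpt.
Proof. by split; [exact: measurable_fst|exact: measurable_snd]. Qed.
End PowerIntegrals.

(** * The truncated weight and its integrals *)

Section WeightIntegrals.
Variable R : realType.
Local Notation C := R[i].
Implicit Types z w : C.

Local Notation MR := (measurableTypeR R).
Local Notation mu := (@lebesgue_measure R).
Local Notation m2 := (mu \x mu)%E.
Local Open Scope ereal_scope.
Local Notation pos := (`]0%R, +oo[%classic : set MR).

Let posE (x : MR) : (x \in pos) = (0 < x)%R.
Proof. by apply/idP/idP => [/set_mem|h]; rewrite ?inE /= in_itv/= andbT. Qed.

Lemma integralJ_cst (c : R) : \int[mu]_(t in @J R) c%:E = (c * (pi *+ 2))%:E.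
Proof.
by rewrite (integral_cst mu (@measurableJ R) c%:E) EFinM; congr (_ * _); exact: measureJ.
Qed.

Lemma cpt_polar (b : C) (s t : R) :
  (cpt ((complex.Re b + s * cos t)%R, (complex.Im b + s * sin t)%R) = b + s%:C * cis t)%R.
Proof. by apply: eqRI; rewrite ?cReD ?cImD ?cReM ?cImM /= !mul0r ?subr0 ?addr0. Qed.

(** The integrand in polar coordinates about b, angle first, extended by 0 so that it is defined on
    the whole plane of (t, s). *)
Definition polar_at (b : C) (g : MR * MR -> \bar R) : MR * MR -> \bar R :=
  polar_integrand (fun p => g ((complex.Re b + p.1)%R, (complex.Im b + p.2)%R))
    \_ [set p | @J R p.1 /\ pos p.2].

Let polar_dom : set (MR * MR) := [set p | @J R p.1 /\ pos p.2].

Let mpolar_dom : measurable polar_dom.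
Proof.
apply: (@measurableI _ _ [set p | @J R p.1] [set p | pos p.2]).
  by rewrite -[X in measurable X]setTI; apply: measurable_fst => //; exact: measurableJ.
by rewrite -[X in measurable X]setTI; apply: measurable_snd => //; exact: measurable_itv.
Qed.

Let shiftfun (b : C) (p : MR * MR) : MR * MR := ((complex.Re b + p.1)%R, (complex.Im b + p.2)%R).

Let measurable_shift (b : C) : measurable_fun setT (shiftfun b).
Proof.
by apply: measurable_fun_pair; apply: measurable_funD;
  [exact: measurable_cst|exact: measurable_fst|exact: measurable_cst|exact: measurable_snd].
Qed.

Lemma measurable_polar_at b g : measurable_fun setT g -> measurable_fun setT (polar_at b g).
Proof.
move=> mg; apply: (measurable_restrictT _ mpolar_dom).1; apply: measurable_funTS.
by apply: measurable_polar_integrand; exact: measurableT_comp mg (measurable_shift b).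
Qed.

Lemma polar_at_ge0 b g : (forall p, 0 <= g p) -> forall p, 0 <= polar_at b g p.
Proof.
move=> g0 p; rewrite /polar_at patchE; case: ifPn => // /set_mem[_ /=].
by rewrite in_itv/= andbT => s0; rewrite mule_ge0// lee_fin ltW.
Qed.

Lemma polar_atE b g (t s : R) : polar_at b g (t, s) =
  if (t \in @J R) && (0 < s)%R then g (shiftfun b ((s * cos t)%R, (s * sin t)%R)) * s%:E else 0.
Proof.
rewrite /polar_at patchE (_ : (_ \in _) = (t \in @J R) && (0 < s)%R)//.
rewrite -posE; apply/idP/andP => [/set_mem[h1 h2]|[/set_mem h1 /set_mem h2]].
  by split; exact: mem_set.
exact: mem_set.
Qed.

Lemma polar_ge0 b g : measurable_fun setT g -> (forall p, 0 <= g p) ->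
  \int[m2]_p g p = \int[m2]_p polar_at b g p.
Proof.
move=> mg g0.
rewrite (fubini_tonelli1 _ (measurable_polar_at b mg) (polar_at_ge0 b g0)).
rewrite (polar (complex.Re b) (complex.Im b) mg g0) integral_mkcond.
apply: eq_integral => t _; rewrite patchE; case: ifPn => tJ; last first.
  by rewrite /fubini_F integral0_eq// => s _; rewrite polar_atE (negbTE tJ).
rewrite /ray integral_mkcond; apply: eq_integral => s _.
by rewrite patchE posE polar_atE tJ.
Qed.

Lemma polar_at_pos b g p : (polar_at b g)^\+ p = polar_at b g^\+ p.
Proof.
case: p => t s; rewrite funeposE !polar_atE.
by case: ifPn => [/andP[_ s0]|_]; rewrite ?maxxx// funeposE maxe_pMl ?lee_fin ?ltW// mul0e.
Qed.

Lemma polar_at_neg b g p : (polar_at b g)^\- p = polar_at b g^\- p.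
Proof.
case: p => t s; rewrite funenegE !polar_atE.
by case: ifPn => [/andP[_ s0]|_]; rewrite ?oppe0 ?maxxx// funenegE maxe_pMl ?lee_fin ?ltW// mul0e mulNe.
Qed.

(** The polar formula is for nonnegative integrands, but the pole kernel changes sign; positive and
    negative parts extend it to integrable functions. *)
Lemma polar_signed b g : m2.-integrable setT g ->
  m2.-integrable setT (polar_at b g) /\ \int[m2]_p g p = \int[m2]_p polar_at b g p.
Proof.
move=> ig; have mg := measurable_int _ ig.
have mgp := measurable_funepos mg; have mgn := measurable_funeneg mg.
have gp0 p : 0 <= g^\+ p by [].
have gn0 p : 0 <= g^\- p by [].
have Ep := polar_ge0 b mgp gp0; have En := polar_ge0 b mgn gn0.
have E : \int[m2]_p g p = \int[m2]_p polar_at b g p.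
  rewrite integralE [RHS]integralE Ep En; congr (_ - _); apply: eq_integral => p _.
    by rewrite polar_at_pos.
  by rewrite polar_at_neg.
split => //; apply/integrableP; split; first exact: measurable_polar_at.
have mga : measurable_fun setT (abse \o g) by exact: measurableT_comp.
have ga0 p : 0 <= (abse \o g) p by exact: abse_ge0.
move/integrableP : ig => [_]; rewrite (polar_ge0 b mga ga0); congr (_ < _).
apply: eq_integral => -[t s] _; rewrite !polar_atE.
by case: ifPn => [/andP[_ s0]|_]; rewrite ?abse0// abseM /= gtr0_norm.
Qed.

Section weight.
Variables (al dl : R) (b : C).
Hypotheses (al0 : (0 < al)%R) (dl0 : (0 < dl)%R).

Definition cdist z (p : MR * MR) : R := normc (cpt p - z)%R.

Lemma measurable_cdist z : measurable_fun setT (cdist z : _ -> MR).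
Proof. exact: (measurable_normc (measurableC_funB (measurableC_cpt R) (measurableC_cst _ z))). Qed.

(** This becomes the weight of the area integral for [al = lambda * 2]. *)
Definition area_density (p : MR * MR) : R := (cdist b p `^ (- al - 2))%R.

Lemma measurable_area_density : measurable_fun setT (area_density : _ -> MR).
Proof.
have h : measurable_fun setT (fun x : MR => x `^ (- al - 2) : MR)%R by exact: measurable_powR.
exact: (measurableT_comp h (measurable_cdist b)).
Qed.

(** In polar coordinates the density becomes s ^ (- al - 1), not integrable at s = 0; without the
    disk of radius [dl] it is bounded and has a finite integral. *)
Definition weight (p : MR * MR) : R := if (dl < cdist b p)%R then area_density p else 0%R.

Lemma weight_ge0 p : (0 <= weight p)%R.
Proof. by rewrite /weight; case: ifP => // _; exact: powR_ge0. Qed.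

Lemma measurable_weight : measurable_fun setT (weight : _ -> MR).
Proof.
apply: measurable_fun_ifT.
- by apply: measurable_fun_ltr; [exact: measurable_cst|exact: measurable_cdist].
- exact: measurable_area_density.
- exact: measurable_cst.
Qed.

Lemma weight_le p : (weight p <= dl `^ (- al - 2))%R.
Proof.
rewrite /weight; case: ifPn => [h|_]; last exact: powR_ge0.
rewrite /area_density (_ : - al - 2 = - (al + 2))%R; last by ring.
have h0 : (0 < cdist b p)%R := lt_trans dl0 h.
have a2 : (0 <= al + 2)%R by rewrite addr_ge0// ltW.
rewrite !powRN lef_pV2 ?posrE ?powR_gt0//.
by apply: ge0_ler_powR => //; rewrite ?nnegrE ltW.
Qed.

Lemma cdist_polar z (s t : R) : (0 < s)%R ->
  cdist z (shiftfun z ((s * cos t)%R, (s * sin t)%R)) = s.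
Proof.
move=> s0; rewrite /cdist cpt_polar addrAC subrr add0r normcM normcR normc_cis mulr1.
exact: gtr0_norm.
Qed.

Lemma weight_polar (s t : R) : (0 < s)%R ->
  (weight (shiftfun b ((s * cos t)%R, (s * sin t)%R)) * s =
   if dl < s then s `^ (- al - 1) else 0)%R.
Proof.
move=> s0; rewrite /weight /area_density cdist_polar//; case: ifP => _; last by rewrite mul0r.
rewrite -{2}(powRr1 (ltW s0)) -powRD; last by rewrite (gt_eqF s0) implybT.
by congr powR; ring.
Qed.

Lemma integral_weight : \int[m2]_p (weight p)%:E = (dl `^ (- al) / al * (pi *+ 2))%:E.
Proof.
have mw : measurable_fun setT (fun p => (weight p)%:E) by apply/measurable_EFinP; exact: measurable_weight.
rewrite (polar (complex.Re b) (complex.Im b) mw); last by move=> p; rewrite lee_fin weight_ge0.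
rewrite -integralJ_cst; apply: eq_integral => t _.
rewrite -(integral_powR_pinfty al0 dl0) /ray integral_mkcond.
rewrite -integral_itv_obnd_cbnd; last first.
  apply/measurable_EFinP; apply: measurable_funTS; exact: measurable_powR.
rewrite [RHS]integral_mkcond; apply: eq_integral => s _; rewrite !patchE posE.
rewrite (_ : (s \in `]dl, +oo[%classic) = (dl < s)%R); last first.
  by apply/idP/idP => [/set_mem|h]; rewrite ?inE /= in_itv/= andbT.
case: ifPn => s0; last by rewrite ifN// -leNgt (le_trans _ (ltW dl0))// leNgt.
by rewrite /polar_integrand -EFinM weight_polar//; case: ifP.
Qed.

(** A simple pole is locally integrable in the plane: the polar factor s cancels it. *)
Lemma integral_dist_inv z :
  \int[m2]_p (if cdist z p < 1 then (cdist z p)^-1 else 0)%R%:E = (pi *+ 2)%:E.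
Proof.
have mw : measurable_fun setT (fun p => (if cdist z p < 1 then (cdist z p)^-1 else 0)%R%:E : \bar R).
  apply/measurable_EFinP; apply: measurable_fun_ifT.
  - by apply: measurable_fun_ltr; [exact: measurable_cdist|exact: measurable_cst].
  - under eq_fun do rewrite -powR_inv1 ?normc_ge0//.
    have h : measurable_fun setT (fun x : MR => x `^ (-1) : MR)%R by exact: measurable_powR.
    exact: (measurableT_comp h (measurable_cdist z)).
  - exact: measurable_cst.
rewrite (polar (complex.Re z) (complex.Im z) mw); last first.
  by move=> p; rewrite lee_fin; case: ifP => // _; rewrite invr_ge0 normc_ge0.
rewrite -[RHS](_ : (1 * (pi *+ 2))%:E = _); last by rewrite mul1r.
rewrite -integralJ_cst; apply: eq_integral => t _.
have m01 : measurable (`]0%R, 1%R[%classic : set MR) by exact: measurable_itv.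
transitivity (\int[mu]_(s in `]0%R, 1%R[) (cst 1%:E) s); last first.
  rewrite (integral_cst mu m01 1%:E) mul1e; apply: (eq_trans (lebesgue_measure_itv _)).
  by rewrite /= lte_fin ltr01 sube0.
rewrite /ray integral_mkcond [RHS]integral_mkcond; apply: eq_integral => s _; rewrite !patchE posE.
rewrite (_ : (s \in `]0%R, 1%R[%classic) = (0 < s < 1)%R); last first.
  by apply/idP/idP => [/set_mem|h]; rewrite ?inE /= in_itv/=.
case: ifPn => s0 //=; rewrite /polar_integrand -EFinM cdist_polar//.
by case: ifP => _; rewrite ?mul0r// mulVf// gt_eqF.
Qed.

(** The first term is the maximum of the weight times the integral of 1 / |w - z| over the unit disk
    about z; the second is the total weight, as 1 / |w - z| <= 1 elsewhere. The bound is the same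
    for all poles z. *)
Definition weight_bound : R := (dl `^ (- al - 2) * (pi *+ 2) + dl `^ (- al) / al * (pi *+ 2))%R.

Lemma weight_bound_ge0 : (0 <= weight_bound)%R.
Proof.
have p2 : (0 <= pi *+ 2 :> R)%R by rewrite mulrn_wge0// pi_ge0.
have q0 : (0 <= dl `^ (- al) / al)%R by apply: divr_ge0; [exact: powR_ge0|exact: ltW].
by apply: addr_ge0; apply: mulr_ge0 => //; exact: powR_ge0.
Qed.

Lemma measurable_weight_div z : measurable_fun setT (fun p => (weight p / cdist z p)%R%:E : \bar R).
Proof.
apply/measurable_EFinP; apply: measurable_funM; first exact: measurable_weight.
under eq_fun do rewrite -powR_inv1 ?normc_ge0//.
have h : measurable_fun setT (fun x : MR => x `^ (-1) : MR)%R by exact: measurable_powR.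
exact: (measurableT_comp h (measurable_cdist z)).
Qed.

Lemma weight_div_ge0 z p : (0 <= weight p / cdist z p)%R.
Proof. by rewrite mulr_ge0 ?weight_ge0// invr_ge0 normc_ge0. Qed.

Lemma integral_weight_div z : \int[m2]_p (weight p / cdist z p)%R%:E <= weight_bound%:E.
Proof.
pose k p := (if cdist z p < 1 then (cdist z p)^-1 else 0)%R.
have k0 p : (0 <= k p)%R by rewrite /k; case: ifP => // _; rewrite invr_ge0 normc_ge0.
have mk : measurable_fun setT (fun p => (k p)%:E).
  apply/measurable_EFinP; apply: measurable_fun_ifT.
  - by apply: measurable_fun_ltr; [exact: measurable_cdist|exact: measurable_cst].
  - under eq_fun do rewrite -powR_inv1 ?normc_ge0//.
    have h : measurable_fun setT (fun x : MR => x `^ (-1) : MR)%R by exact: measurable_powR.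
    exact: (measurableT_comp h (measurable_cdist z)).
  - exact: measurable_cst.
have mw : measurable_fun setT (fun p => (weight p)%:E).
  by apply/measurable_EFinP; exact: measurable_weight.
apply: (@le_trans _ _ (\int[m2]_p ((dl `^ (- al - 2))%:E * (k p)%:E + (weight p)%:E))).
  apply: ge0_le_integral => //.
  - by move=> p _; rewrite lee_fin weight_div_ge0.
  - exact: measurable_weight_div.
  - apply: emeasurable_funD => //; apply: emeasurable_funM => //; exact: measurable_cst.
  move=> p _; rewrite -EFinM -EFinD lee_fin /k; case: ifPn => h.
    by rewrite ler_wpDr ?weight_ge0// ler_wpM2r ?weight_le// invr_ge0 normc_ge0.
  rewrite mulr0 add0r; rewrite -leNgt in h.
  rewrite ler_pdivrMr; last exact: lt_le_trans h.
  by rewrite ler_peMr// weight_ge0.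
have mck : measurable_fun setT (fun p => (dl `^ (- al - 2))%:E * (k p)%:E).
  by apply: emeasurable_funM => //; exact: measurable_cst.
have ck0 p : setT p -> 0 <= (dl `^ (- al - 2))%:E * (k p)%:E.
  by move=> _; rewrite mule_ge0// lee_fin ?powR_ge0.
have w0 p : setT p -> 0 <= (weight p)%:E by move=> _; rewrite lee_fin weight_ge0.
rewrite (ge0_integralD m2 measurableT ck0 mck w0 mw) ge0_integralZl//; last 2 first.
- by move=> p _; rewrite lee_fin.
- by rewrite lee_fin powR_ge0.
by rewrite integral_dist_inv integral_weight /weight_bound EFinD EFinM.
Qed.
End weight.
End WeightIntegrals.

(** * Integrating a pole against the weight *)

Section PoleIntegrals.
Variable R : realType.
Local Notation C := R[i].
Implicit Types z w : C.

Local Notation MR := (measurableTypeR R).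
Local Notation mu := (@lebesgue_measure R).
Local Notation m2 := (mu \x mu)%E.

Lemma contC_pole (c z : C) (s : R) : (forall t, z - s%:C * cis t != 0) ->
  continuous (fun t => c / (z - s%:C * cis t)).
Proof.
move=> h.
have cd : continuous (fun t => z - s%:C * cis t).
  have e : (fun t => z - s%:C * cis t) = (fun t => z + (- s%:C) * cis t).
    by apply/funext => t; rewrite mulNr.
  rewrite e; exact: (contC_D (@contC_cst R z) (@contC_Z R _ _ (@continuous_cis R))).
exact: (contC_M (@contC_cst R c) (contC_V cd h)).
Qed.

Lemma pole_neq0 (z : C) (s t : R) : 0 < s -> s != normc z -> z - s%:C * cis t != 0.
Proof.
move=> s0 /eqP sz; rewrite subr_eq0; apply/eqP => zE; apply: sz.
by rewrite zE normcM normcR normc_cis mulr1 gtr0_norm.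
Qed.

Lemma CI_pole_out (c z : C) (s : R) : 0 < s < normc z ->
  CI (fun t => c / (z - s%:C * cis t)) = (pi *+ 2)%:C * (c / z).
Proof.
move=> sz; have hu : andisk (normc z) (fun w => c / (z - w)).
  move=> w wz; apply: (an_div (an_cst c w) (an_B (an_cst z w) (an_id w))).
  by rewrite subr_eq0; apply/eqP => zE; move: wz; rewrite zE ltxx.
by rewrite (CI_mean (andisk_hol hu) sz) subr0.
Qed.

Lemma CI_pole_in (c z : C) (s : R) : z != 0 -> normc z < s ->
  CI (fun t => c / (z - s%:C * cis t)) = 0.
Proof.
move=> z0 zs; have s0 : 0 < s := le_lt_trans (normc_ge0 z) zs.
have nz t : s%:C * cis t - z != 0.
  by rewrite -oppr_eq0 opprB pole_neq0// gt_eqF.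
have E : (fun t => c / (z - s%:C * cis t)) = (fun t => (- (c / z)) * (kern s z t - 1)).
  apply/funext => t; rewrite /kern.
  have h := nz t; have h' : z - s%:C * cis t != 0 by rewrite -oppr_eq0 opprB.
  by field; rewrite h h' z0.
have ck := contC_kern zs.
have cB : continuous (fun t => kern s z t - 1).
  exact: (contC_D ck (@contC_cst R (- 1))).
rewrite E (@CI_Z R _ _ cB) (CI_B ck (@contC_cst R 1)) CI_kern1//.
have -> : CI (fun=> 1) = (pi *+ 2)%:C :> C.
  have h : normc 0 < s by rewrite normc0.
  rewrite -(CI_kern1 h); apply: eq_CI => t; rewrite /kern subr0 divff// mulf_neq0 ?cis_neq0//.
  by rewrite fmorph_eq0 gt_eqF.
by rewrite subrr mulr0.
Qed.

Lemma integralJ_Re (v : R -> C) : continuous v ->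
  (\int[mu]_(t in @J R) (complex.Re (v t))%:E = (complex.Re (CI v))%:E)%E.
Proof.
move=> cv; rewrite /CI /= /Rintegral fineK//.
exact: (integrable_fin_num (@measurableJ R) (integrableJ (cont_Re cv))).
Qed.

Section kernel.
Variables (al dl : R) (b z c : C).
Hypotheses (al0 : 0 < al) (dl0 : 0 < dl).
Local Notation W := (weight al dl b).

(** With z a point of the curve and c its speed, this is the weight at w times the real part of the
    integrand of the winding integral about w. *)
Definition weight_kernel (p : MR * MR) : \bar R := (W p * complex.Re (c / (z - cpt p)))%:E.

Lemma measurable_weight_kernel : measurable_fun setT weight_kernel.
Proof.
apply/measurable_EFinP; apply: measurable_funM; first exact: measurable_weight.
have h1 := measurableC_cst (MR * MR)%type c.
have h2 := measurableC_funB (measurableC_cst (MR * MR)%type z) (measurableC_cpt R).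
exact: (measurable_Re_div h1 h2).
Qed.

Lemma weight_kernel_le p :
  (`|weight_kernel p| <= (normc c)%:E * (W p / cdist z p)%:E)%E.
Proof.
rewrite -EFinM lee_fin normrM ger0_norm ?weight_ge0// mulrCA; apply: ler_wpM2l.
  exact: weight_ge0.
apply: le_trans (Re_le_normc _) _.
by rewrite normcM normcV /cdist (normcB (cpt p)).
Qed.

Lemma weight_kernel_bound :
  (\int[m2]_p `|weight_kernel p| <= (normc c * weight_bound al dl)%:E)%E.
Proof.
have mk := measurable_weight_kernel.
apply: (@le_trans _ _ (\int[m2]_p ((normc c)%:E * (W p / cdist z p)%:E))%E).
  apply: ge0_le_integral => //.
  - exact: measurableT_comp.
  - apply: emeasurable_funM; first exact: measurable_cst.
    exact: measurable_weight_div.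
  - by move=> p _; exact: weight_kernel_le.
have w0 (p : MR * MR) : setT p -> (0 <= (W p / cdist z p)%:E)%E.
  by move=> _; rewrite lee_fin weight_div_ge0.
have c0 : (0 <= (normc c)%:E)%E by rewrite lee_fin normc_ge0.
rewrite (ge0_integralZl m2 measurableT (measurable_weight_div al dl b z) w0 c0).
by rewrite EFinM; apply: lee_wpmul2l => //; exact: integral_weight_div.
Qed.

Lemma integrable_weight_kernel : m2.-integrable setT weight_kernel.
Proof.
apply/integrableP; split; first exact: measurable_weight_kernel.
exact: le_lt_trans weight_kernel_bound (ltry _).
Qed.

(* The mean of c / (z - w) over the circle |w - b| = s is c / (z - b) for
   s < |z - b| and 0 for s > |z - b|. *)
Lemma integral_weight_kernel : dl < normc (z - b) ->
  (\int[m2]_p weight_kernel p =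
   ((pi *+ 2) * complex.Re (c / (z - b)) * ((dl `^ (- al) - normc (z - b) `^ (- al)) / al))%:E)%E.
Proof.
move=> dz; have z0 : z - b != 0 by rewrite -normc_gt0 (lt_trans dl0).
have [iQ ->] := polar_signed b integrable_weight_kernel.
pose rho := normc (z - b); pose K := (pi *+ 2) * complex.Re (c / (z - b)).
rewrite -(integral21_prod_meas1 iQ).
have mG := measurable_fubini_G iQ.
have mD (D : set MR) : measurable_fun D (fubini_G mu (polar_at b weight_kernel)).
  exact: measurable_funTS mG.
(* The circle through the pole z, of radius rho about b, is removed: the means over circles are
   computed only off it. *)
have mT1 : measurable ([set: MR] `\ rho) by exact: measurableD.
rewrite -(integral_setD1 mT1 (mD _)).
rewrite [in RHS]EFinM -(integral_powR_itv al0 dl0 dz) -/rho -/K.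
have mp (D : set MR) : measurable_fun D (fun s : R => (s `^ (- al - 1))%:E).
  by apply/measurable_EFinP; apply: measurable_funTS; exact: measurable_powR.
have mI : measurable (`[dl, rho]%classic : set MR) by exact: measurable_itv.
have iI : mu.-integrable `[dl, rho] (fun s : R => (s `^ (- al - 1))%:E).
  apply/integrableP; split; first exact: mp.
  under eq_integral do rewrite gee0_abs ?lee_fin ?powR_ge0//.
  by rewrite (integral_powR_itv al0 dl0 dz) ltry.
rewrite -(integralZl mI iI).
have mK : measurable_fun `]dl, rho[ (fun s : R => (K%:E * (s `^ (- al - 1))%:E)%E).
  by apply: emeasurable_funM; [exact: measurable_cst|exact: mp].
rewrite (@integral_itv_bndoo R dl rho _ true false mK).
rewrite integral_mkcond [RHS]integral_mkcond; apply: eq_integral => s _.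
rewrite !patchE.
have [->|srho] := eqVneq (s : R) rho.
  rewrite ifN ?ifN//; first by rewrite notin_setE /= in_itv/= ltxx andbF.
  by rewrite notin_setE /= => -[].
rewrite ifT; last by rewrite inE /=; split => // sE; move: srho; rewrite sE eqxx.
rewrite (_ : (s \in `]dl, rho[%classic) = (dl < s < rho)); last first.
  by apply/idP/idP => [/set_mem|h]; rewrite ?inE /= in_itv/=.
have [s0|s0] := lerP (s : R) 0.
  rewrite ifN; last by rewrite ltNge (le_trans s0 (ltW dl0)).
  by rewrite /fubini_G integral0_eq// => t _; rewrite polar_atE [(0 < s)]ltNge s0 andbF.
pose ws := if dl < s then (s : R) `^ (- al - 1) else 0.
transitivity (\int[mu]_(t in @J R) (complex.Re ((ws%:C * c) / (z - b - s%:C * cis t)))%:E)%E.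
  rewrite /fubini_G [RHS]integral_mkcond; apply: eq_integral => t _.
  rewrite polar_atE s0 andbT patchE; case: ifPn => // tJ.
  rewrite -EFinM mulrAC (weight_polar al dl b t s0) -/ws; congr EFin.
  rewrite cpt_polar [in LHS]opprD addrA.
  have E (x : C) : complex.Re (ws%:C * x) = ws * complex.Re x by rewrite cReM /= mul0r subr0.
  by rewrite -[in RHS](mulrA ws%:C) E.
have nz t : z - b - s%:C * cis t != 0 by exact: pole_neq0.
rewrite (integralJ_Re (@contC_pole (ws%:C * c) _ _ nz)).
have [ls|ls] := ltrP (s : R) rho; last first.
  rewrite andbF CI_pole_in//.
  by rewrite lt_neqAle ls andbT eq_sym.
rewrite andbT CI_pole_out ?s0//.
have E (u v : R) (x : C) : complex.Re (u%:C * (v%:C * x)) = u * complex.Re x * v.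
  by rewrite mulrCA !cReM /= !mul0r !subr0 mulrC.
rewrite -mulrA E -/K /ws; case: ifPn => _; last by rewrite mulr0.
by rewrite -EFinM.
Qed.
End kernel.
End PoleIntegrals.

Section AreaFormula.
Variable R : realType.
Local Notation C := R[i].
Implicit Types z w : C.

Local Notation MR := (measurableTypeR R).
Local Notation mu := (@lebesgue_measure R).
Local Notation m2 := (mu \x mu)%E.

Lemma pder_lip_seg (v v' : R -> C) (M s t : R) : s <= t ->
  (forall x, s <= x <= t -> pder v x (v' x)) ->
  (forall x, s <= x <= t -> normc (v' x) <= M) ->
  `|complex.Re (v t) - complex.Re (v s)| <= M * (t - s) /\
  `|complex.Im (v t) - complex.Im (v s)| <= M * (t - s).
Proof.
move=> st dv vM.
have oo x : x \in `]s, t[ -> s <= x <= t by rewrite in_itv/= => /andP[/ltW -> /ltW ->].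
have cc x : x \in `[s, t] -> s <= x <= t by rewrite in_itv.
have ts0 : 0 <= t - s by rewrite subr_ge0.
split.
  have [||c /cc cst ->] := @MVT_segment R (fun t => complex.Re (v t)) (fun t => complex.Re (v' t)) s t st.
  - by move=> x /oo hx; have /pder_ReIm[] := dv x hx.
  - apply: continuous_in_subspaceT => x /set_mem /= /cc hx.
    exact: (continuous_comp (pder_continuous (dv x hx)) (@continuous_Re R _)).
  rewrite normrM (ger0_norm ts0) ler_wpM2r//.
  exact: le_trans (Re_le_normc _) (vM _ cst).
have [||c /cc cst ->] := @MVT_segment R (fun t => complex.Im (v t)) (fun t => complex.Im (v' t)) s t st.
- by move=> x /oo hx; have /pder_ReIm[] := dv x hx.
- apply: continuous_in_subspaceT => x /set_mem /= /cc hx.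
  exact: (continuous_comp (pder_continuous (dv x hx)) (@continuous_Im R _)).
rewrite normrM (ger0_norm ts0) ler_wpM2r//.
exact: le_trans (Im_le_normc _) (vM _ cst).
Qed.

(* The curve is covered by about n squares of side O(1/n). *)
Lemma curve_negligible (v v' : R -> C) (M : R) : 0 < M -> (forall t, pder v t (v' t)) ->
  (forall t, J t -> normc (v' t) <= M) ->
  m2.-negligible [set p | exists2 t, J t & v t = cpt p].
Proof.
move=> M0 dv vM; have pi0 := @pi_gt0 R.
pose h n : R := pi *+ 2 / n.+1%:R.
have h0 n : 0 < h n by rewrite divr_gt0// mulrn_wgt0.
pose tk n k : R := - (pi / 2) + k%:R * h n.
pose a n : R := M * h n; have a0 n : 0 < a n by rewrite mulr_gt0.
pose sq x n : set MR := `[x - a n, x + a n]%classic.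
have msq x n : measurable (sq x n) by exact: measurable_itv.
have muq x n : (mu (sq x n) = (2 * a n)%:E)%E.
  rewrite /sq; apply: (eq_trans (lebesgue_measure_itv _)); rewrite /= lte_fin ifT.
    by rewrite -EFinD; congr EFin; ring.
  by have := a0 n; lra.
pose S n k : set (MR * MR) := sq (complex.Re (v (tk n k))) n `*` sq (complex.Im (v (tk n k))) n.
have mS n k : measurable (S n k) by exact: measurableX.
have muS n k : m2 (S n k) = ((2 * a n) ^+ 2)%:E.
  rewrite (@product_measure1E _ _ MR MR R mu mu _ _ (msq _ _) (msq _ _)).
  by rewrite expr2 EFinM; congr (_ * _)%E; exact: muq.
(* The right end of [J] may be rounded to the index n + 1, hence n + 2 squares. Their total area is
   of order 1 / n, by n + 2 <= 2 (n + 1). *)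
pose U n := \big[setU/set0]_(k < n.+2) S n k.
have mU n : measurable (U n) by exact: bigsetU_measurable.
pose c := 8 * (M * pi *+ 2) ^+ 2.
have muU n : (m2 (U n) <= (c / n.+1%:R)%:E)%E.
  apply: (le_trans (content_subadditive m2 (fun k _ => mS n k) (mU n) (@subset_refl _ (U n)))).
  apply: (@le_trans _ _ (\sum_(k < n.+2) ((2 * a n) ^+ 2)%:E)%E).
    by apply: lee_sum => k _; rewrite le_eqVlt; apply/orP; left; apply/eqP; exact: muS.
  rewrite sumEFin lee_fin sumr_const card_ord -[leLHS]mulr_natr.
  have n0 : 0 < n.+1%:R :> R by [].
  have E : (2 * a n) ^+ 2 = (c / 2) / n.+1%:R / n.+1%:R.
    by rewrite /a /h /c; field; rewrite addrC natr1 gt_eqF.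
  have c0 : 0 <= (c / 2) / n.+1%:R / n.+1%:R by rewrite -E sqr_ge0.
  have n2 : n.+2%:R <= 2 * n.+1%:R :> R by rewrite -natrM ler_nat mul2n -addnn addSn ltnS leq_addl.
  rewrite E; apply: (le_trans (ler_wpM2l c0 n2)); rewrite le_eqVlt; apply/orP; left.
  by apply/eqP; field; rewrite addrC natr1 gt_eqF.
exists (\bigcap_n U n); split; first exact: bigcapT_measurable.
- apply/eqP; rewrite eq_le measure_ge0 andbT; apply/lee_addgt0Pr => e e0; rewrite add0e.
  have [n nP] : exists n, c / n.+1%:R <= e.
    exists (Num.truncn (c / e)); rewrite ler_pdivrMr// mulrC -ler_pdivrMr//.
    have c0 : 0 <= c / e by apply: divr_ge0; [apply: mulr_ge0 => //; exact: sqr_ge0|exact: ltW].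
    by have /andP[_ /ltW] := truncn_itv c0.
  apply: le_trans (le_trans (muU n) _); last by rewrite lee_fin.
  apply: le_measure; rewrite ?inE//; first exact: bigcapT_measurable.
  exact: bigcap_inf.
move=> p [t tJ vt] n _; rewrite /U -bigcup_mkord.
have tn : 0 <= t + pi / 2 by move: tJ; rewrite /J /= in_itv/= => /andP[]; lra.
have tx : t + pi / 2 <= pi *+ 2 by move: tJ; rewrite /J /= in_itv/= => /andP[]; lra.
have q0 : 0 <= (t + pi / 2) / h n by rewrite divr_ge0// ltW.
pose k := Num.truncn ((t + pi / 2) / h n).
have /andP[k1 k2] := truncn_itv q0; rewrite -/k in k1 k2.
have kn : (k < n.+2)%N.
  rewrite ltnS -(ler_nat R); apply: (le_trans k1).
  rewrite ler_pdivrMr// /h mulrCA divff ?mulr1//.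
have e1 : tk n k <= t by move: k1; rewrite ler_pdivlMr// /tk; lra.
have e2 : t - tk n k <= h n.
  have E : k.+1%:R * h n = k%:R * h n + h n by rewrite -[in LHS]natr1 mulrDl mul1r.
  by move: k2; rewrite ltr_pdivrMr// E /tk; lra.
have tkJ : J (tk n k).
  rewrite /J /= in_itv/=; apply/andP; split.
    by rewrite /tk lerDl mulr_ge0// ltW.
  by apply: (le_trans e1); move: tJ; rewrite /J /= in_itv/= => /andP[].
have inJ x : tk n k <= x <= t -> J x.
  move: tkJ tJ; rewrite /J /= !in_itv/= => /andP[a1 _] /andP[_ a2] /andP[x1 x2].
  by rewrite (le_trans a1 x1) (le_trans x2 a2).
have [r1 r2] := pder_lip_seg e1 (fun x _ => dv x) (fun x hx => vM x (inJ x hx)).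
have e3 : M * (t - tk n k) <= a n by rewrite /a ler_wpM2l// ltW.
exists k => //; split; rewrite /sq /= in_itv/=.
  move: (le_trans r1 e3); rewrite vt ler_norml /= => /andP[g1 g2].
  by apply/andP; split; lra.
move: (le_trans r2 e3); rewrite vt ler_norml /= => /andP[g1 g2].
by apply/andP; split; lra.
Qed.

(* Lebesgue measure on the plane under a name of its own, because the library infers
   the sigma-finiteness of mu \x mu only for subprobabilities. *)
Definition plane_measure : set (MR * MR) -> \bar R := (mu \x mu)%E.

Let plane_measure_sigma_finite : sigma_finite setT plane_measure.
Proof.
pose I n : set MR := `[- n%:R, n%:R]%classic.
have mI n : measurable (I n) by exact: measurable_itv.
have II (x : R) n : `|x| <= n%:R -> I n x by rewrite /I /= in_itv/= ler_norml.
exists (fun n => I n `*` I n).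
  apply/esym/seteqP; split => // -[x y] _.
  exists (maxn (Num.truncn `|x|).+1 (Num.truncn `|y|).+1) => //.
  have /andP[_ /ltW hx] := truncn_itv (normr_ge0 x).
  have /andP[_ /ltW hy] := truncn_itv (normr_ge0 y).
  split; apply: II; [apply: le_trans hx _|apply: le_trans hy _];
    by rewrite ler_nat ?leq_maxl ?leq_maxr.
move=> n; split; first exact: measurableX.
rewrite /plane_measure (@product_measure1E _ _ MR MR R mu mu _ _ (mI n) (mI n)).
have E : (mu (I n) < +oo)%E.
  have -> : mu (I n) = (n%:R *+ 2 : R)%:E; last exact: ltry.
  apply: (eq_trans (lebesgue_measure_itv _)); rewrite /= lte_fin.
  case: ifPn => [_|h]; first by rewrite -EFinB opprK mulr2n.
  suff -> : n = 0%N by rewrite mul0rn.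
  by apply/eqP; rewrite -leqn0 leqNgt -(ltr_nat R); apply: contra h => h; lra.
by apply: lte_mul_pinfty => //; rewrite ge0_fin_numE.
Qed.

HB.instance Definition _ := Measure.copy plane_measure (mu \x mu)%E.
HB.instance Definition _ := @Measure_isSigmaFinite.Build _ _ _ plane_measure plane_measure_sigma_finite.

Section area.
Variables (F : C -> C) (al r : R).
Hypothesis al0 : 0 < al.
Hypothesis hF : andisk 1 F.
Hypothesis Finj : forall z w, normc z < 1 -> normc w < 1 -> F z = F w -> z = w.
Hypothesis dF0 : forall z, normc z < 1 -> derive1 F z != 0.
Hypothesis r01 : 0 < r < 1.

Local Notation zc := (wcurve F r).
Local Notation zs := (wspeed F r).

(** The winding integral is meaningful only off the curve, so everything below holds almost
    everywhere. *)
Lemma offcurve_ae : m2.-negligible [set p | ~ offcurve F r (cpt p)].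
Proof.
have /andP[r0 r1] := r01.
have n1 t : normc (r%:C * cis t) < 1 by rewrite normcM normcR normc_cis mulr1 gtr0_norm.
have dz t : pder zc t (zs t * 'i).
  have dc : pder (fun s => r%:C * cis s) t (r%:C * ('i * cis t)).
    rewrite (_ : (fun s => r%:C * cis s) = (fun s => 0 + r%:C * cis s)).
      exact: (@pder_affine R 0 r%:C (@cis R) t _ (@pder_cis R t)).
    by apply/funext => s; rewrite add0r.
  have d := @pder_comp R F (fun s => r%:C * cis s) t _ _ (an_is_derive (hF (n1 t))) dc.
  rewrite (_ : zs t * 'i = derive1 F (r%:C * cis t) * (r%:C * ('i * cis t))) //.
  by rewrite /wspeed; ring.
have [M MP] := J_bounded (contC_wspeed hF r01).
have M0 : 0 < `|M| + 1 by rewrite ltr_pwDr.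
have b t : J t -> normc (zs t * 'i) <= `|M| + 1.
  move=> /MP h; rewrite normcM (_ : normc 'i = 1 :> R) ?mulr1; last first.
    by rewrite /= expr0n expr1n add0r sqrtr1.
  by rewrite (le_trans h)// (le_trans (ler_norm M))// lerDl.
have [A [mA A0 AP]] := curve_negligible M0 dz b.
exists A; split => // p /= np; apply: AP => /=; apply: contrapT => nt; apply: np => z zr.
have [t tJ tz] := circle_param r0 zr.
by apply/eqP => E; apply: nt; exists t => //; rewrite /wcurve -tz.
Qed.

Let S : R := (\int[mu]_(t in @J R) (normc (zc t - F 0) `^ (- al) *
  complex.Re (zs t / (zc t - F 0))))%R.

Section fubini.
Variable dl : R.
Hypothesis dl0 : 0 < dl.
Hypothesis dlP : forall t, dl < normc (zc t - F 0).
Local Notation W := (weight al dl (F 0)).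

(** The double integrand on plane times angle, extended by 0 outside [J]. *)
Let G (q : (MR * MR) * MR) : \bar R :=
  if q.2 \in @J R then weight_kernel al dl (F 0) (zc q.2) (zs q.2) q.1 else 0%E.

Let mG : measurable_fun setT G.
Proof.
apply: measurable_fun_ifT; last exact: measurable_cst.
  have h : measurable_fun setT (fun t : MR => t \in @J R).
    by apply: measurable_fun_bool; rewrite setTI; have := @measurableJ R; congr (measurable _);
      apply/seteqP; split => x /= h; [exact: mem_set|exact: set_mem].
  exact: (measurableT_comp h measurable_snd).
apply/measurable_EFinP; apply: measurable_funM.
  exact: (measurableT_comp (measurable_weight al dl (F 0)) measurable_fst).
have h1 := measurableC_comp (@measurable_snd _ _ (MR * MR)%type MR)
  (measurableC_continuous (contC_wspeed hF r01)).
have h2 := measurableC_comp (@measurable_snd _ _ (MR * MR)%type MR)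
  (measurableC_continuous (contC_wcurve hF r01)).
have h3 := measurableC_comp (@measurable_fst _ _ (MR * MR)%type MR) (measurableC_cpt R).
exact: (measurable_Re_div h1 (measurableC_funB h2 h3)).
Qed.

(** Absolute integrability rests on [weight_bound] being independent of the pole, which moves along
    the curve. *)
Let iG : (plane_measure \x mu)%E.-integrable setT G.
Proof.
apply/(integrable21ltyP plane_measure mu mG).
have [M MP] := J_bounded (contC_wspeed hF r01).
have M0 : 0 <= `|M| * weight_bound al dl by rewrite mulr_ge0// weight_bound_ge0.
have mJ := @measurableJ R.
apply: (@le_lt_trans _ _ (\int[mu]_(t in @J R) (`|M| * weight_bound al dl)%:E)%E); last first.
  by rewrite integralJ_cst ltry.
rewrite [leRHS]integral_mkcond; apply: ge0_le_integral => //.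
- by move=> t _; exact: integral_ge0.
- apply: (measurable_fun_fubini_tonelli_G (m1 := plane_measure) (fun q => `|G q|%E)) => //; exact: measurableT_comp.
- by apply: (measurable_restrictT _ mJ).1; exact: measurable_cst.
move=> t _; rewrite patchE /G /=; case: ifPn => tJ; last first.
  by under eq_integral do rewrite abse0; rewrite integral0.
apply: le_trans (weight_kernel_bound _ _ _ al0 dl0) _; rewrite lee_fin ler_wpM2r ?weight_bound_ge0//.
by apply: le_trans (MP t (set_mem tJ)) (ler_norm _).
Qed.

Let N p : \bar R := fubini_F mu G p.

Let NE p : offcurve F r (cpt p) -> N p = (W p * complex.Re (windint F r (cpt p)))%:E.
Proof.
move=> op; have cw := contC_wkernel hF r01 op.
have E (x : C) : W p * complex.Re x = complex.Re ((W p)%:C * x) by rewrite cReM /= mul0r subr0.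
rewrite /windint E -(@CI_Z R _ _ cw) -(integralJ_Re (@contC_Z R _ _ cw)) /N /fubini_F.
rewrite [RHS]integral_mkcond; apply: eq_integral => t _; rewrite /G /= patchE.
by case: ifP => // _; rewrite -E.
Qed.

(** Integrating over the plane first: at each t the pole formula applies, and the term with dl
    multiplies the winding integral about F 0, which is 2 pi. *)
Let intN : (\int[m2]_p N p = ((pi *+ 2) / al * (dl `^ (- al) * (pi *+ 2) - S))%:E)%E.
Proof.
have o0 : offcurve F r (F 0).
  have /andP[r0 _] := r01; move=> z zr; have [t _ ->] := circle_param r0 zr.
  rewrite -subr_eq0 -normc_gt0; exact: lt_trans dl0 (dlP t).
have cw := cont_Re (contC_wkernel hF r01 o0).
have cp : continuous (fun t => normc (zc t - F 0) `^ (- al)).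
  move=> t; have cn : {for t, continuous (fun t => normc (zc t - F 0))}.
    have h := contC_D (contC_wcurve hF r01) (@contC_cst R (- F 0)).
    exact: (continuous_comp (h t) (@continuous_normc R _)).
  have cq := @continuous_powR_gt0 R (- al) _ (lt_trans dl0 (dlP t)).
  exact: (continuous_comp cn cq).
rewrite /N (integral12_prod_meas1 iG) -(integral21_prod_meas1 iG).
transitivity (\int[mu]_(t in @J R) (((pi *+ 2) / al) * (dl `^ (- al) *
   complex.Re (zs t / (zc t - F 0)) - normc (zc t - F 0) `^ (- al) *
  complex.Re (zs t / (zc t - F 0))))%:E)%E.
  rewrite [RHS]integral_mkcond; apply: eq_integral => t _; rewrite patchE /fubini_G /G /=.
  case: ifPn => tJ; last by rewrite integral0.
  rewrite (integral_weight_kernel _ al0 dl0 (dlP t)); congr EFin.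
  by field; rewrite gt_eqF.
pose c2 := (fun t => normc (zc t - F 0) `^ (- al) * complex.Re (zs t / (zc t - F 0))).
have cc2 : continuous c2 by move=> t; exact: (continuousM (cp t) (cw t)).
pose c1 := (fun t => dl `^ (- al) * complex.Re (zs t / (zc t - F 0))).
have cc1 : continuous c1 by exact: (@cont_Z R _ _ cw).
have cB : continuous (fun t => c1 t - c2 t).
  by move=> t; exact: (continuousB (cc1 t) (cc2 t)).
have cZ : continuous (fun t => ((pi *+ 2) / al) * (c1 t - c2 t)) by exact: (@cont_Z R _ _ cB).
transitivity (\int[mu]_(t in @J R) (((pi *+ 2) / al) * (c1 t - c2 t)))%:E.
  by rewrite /Rintegral fineK//; exact: (integrable_fin_num (@measurableJ R) (integrableJ cZ)).
congr EFin; rewrite (IJ_Z _ cB) (IJ_B cc1 cc2) /c1 (IJ_Z _ cw) -/S; congr (_ * (_ * _ - _)).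
have /andP[r0 _] := r01.
have := windint_in hF Finj dF0 r01 (z0 := 0); rewrite normc0 => /(_ r0)/(congr1 (@complex.Re R)).
by rewrite /windint /CI /=.
Qed.

Hypothesis dlD : forall w, normc (w - F 0) <= dl -> exists2 z, normc z < r & F z = w.

(* Integrate the winding number against the weight |w - b| ^ (- al - 2): it is 1 inside
   and 0 outside the curve, and Fubini turns the integral into one along the curve. *)
Lemma area_formula_aux : exists E : set (MR * MR), [/\ measurable E,
  forall p, offcurve F r (cpt p) -> (E p <-> ~ exists2 z, normc z < r & F z = cpt p) &
  (\int[m2]_(p in E) (area_density al (F 0) p)%:E = (S / al)%:E)%E].
Proof.
have p0 : 0 < pi *+ 2 :> R by rewrite mulrn_wgt0// pi_gt0.
have iN : m2.-integrable setT N := integrable_fubini_F iG.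
have mN := measurable_int _ iN.
have mW : measurable_fun setT (fun p => (W p)%:E).
  by apply/measurable_EFinP; exact: measurable_weight.
have iW : m2.-integrable setT (fun p => (W p)%:E).
  apply/integrableP; split => //.
  under eq_integral do rewrite gee0_abs ?lee_fin ?weight_ge0//.
  by rewrite (integral_weight (F 0) al0 dl0) ltry.
(* Defined through [N] rather than through the image, so that it is measurable by construction; off
   the curve it is the complement of the image. *)
pose E : set (MR * MR) := [set p | dl < cdist (F 0) p] `&` [set p | N p = 0%E].
have mE : measurable E.
  apply: measurableI.
    have h : measurable_fun setT (fun p => dl < cdist (F 0) p).
      by apply: measurable_fun_ltr; [exact: measurable_cst|exact: measurable_cdist].
    have := h measurableT [set true] I; rewrite setTI; congr (measurable _).
  have := mN measurableT _ (@emeasurable_set1 R 0%E); rewrite setTI.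
  by congr (measurable _).
have Wgt0 p : dl < cdist (F 0) p -> 0 < W p.
  move=> h; rewrite /weight h /area_density powR_gt0// (lt_trans dl0)//.
have Eoff p : offcurve F r (cpt p) ->
    (E p /\ N p = 0%E /\ ~ (exists2 z, normc z < r & F z = cpt p)) \/
    (~ E p /\ N p = (W p * (pi *+ 2))%:E /\ exists2 z, normc z < r & F z = cpt p).
  move=> op; have := NE op.
  have [[ex ->]|[nex ->]] := windint_dichotomy hF Finj dF0 r01 op; last first.
    rewrite mulr0 => N0; left; split => //; split => //=.
    by rewrite ltNge; apply/negP => /dlD.
  move=> Np; right; split => //= -[/= /Wgt0 w0]; rewrite Np => -[/eqP].
  by rewrite mulf_eq0 !gt_eqF.
exists E; split => //.
  by move=> p /Eoff[[h [_ h']]|[h [_ h']]]; split.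
have mD : measurable_fun setT (fun p => (area_density al (F 0) p)%:E).
  by apply/measurable_EFinP; exact: measurable_area_density.
rewrite integral_mkcond.
have iZ : m2.-integrable setT (fun p => ((pi *+ 2)^-1)%:E * N p)%E by exact: integrableZl.
(* Off the curve N / (2 pi) is the weight on the image and 0 elsewhere, so the difference is the
   weight on the complement. There the cutoff is invisible, and in the integrals the terms with dl
   cancel. *)
transitivity (\int[m2]_p ((W p)%:E - ((pi *+ 2)^-1)%:E * N p))%E.
  apply: ae_eq_integral => //.
  - by apply: (measurable_restrictT _ mE).1; exact: measurable_funTS.
  - by apply: emeasurable_funB => //; exact: measurable_int iZ.
  have [A [mA A0 AP]] := offcurve_ae.
  exists A; split => // p /= np; apply: AP => /= op; apply: np => _.
  rewrite patchE; have [[h [-> _]]|[h [-> _]]] := Eoff _ op.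
    rewrite mem_set// mule0 sube0; case: h => /= h _.
    by rewrite /weight h.
  rewrite memNset// -EFinM -EFinB; congr EFin.
  by rewrite [W p * _]mulrC mulKf ?subrr// gt_eqF.
rewrite (integralB measurableT iW iZ) (integralZl measurableT iN) intN (integral_weight (F 0) al0 dl0).
rewrite -EFinM -EFinB; congr EFin.
have pn : pi != 0 :> R by rewrite gt_eqF ?pi_gt0.
have an : al != 0 by rewrite gt_eqF.
move: pn; generalize (@pi R) => q pn.
by field; rewrite an pn.
Qed.
End fubini.

Lemma area_formula : exists E : set (MR * MR), [/\ measurable E,
  forall p, offcurve F r (cpt p) -> (E p <-> ~ exists2 z, normc z < r & F z = cpt p) &
  (\int[m2]_(p in E) (area_density al (F 0) p)%:E = (S / al)%:E)%E].
Proof.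
have [dl dl0 [h1 h2]] := wdisk hF Finj dF0 r01.
exact: area_formula_aux dl0 h1 h2.
Qed.
End area.
End AreaFormula.

(** * Letting the radius tend to 1 *)

Section AreaLimit.
Variable R : realType.
Local Notation C := R[i].
Implicit Types z w : C.

Local Notation MR := (measurableTypeR R).
Local Notation mu := (@lebesgue_measure R).
Local Notation m2 := (mu \x mu)%E.

Definition curve_integral (F : C -> C) (al r : R) : R :=
  \int[mu]_(t in @J R) (normc (wcurve F r t - F 0) `^ (- al) *
    complex.Re (wspeed F r t / (wcurve F r t - F 0))).

(** The shift by 2 makes already the first radius positive. *)
Definition radseq (n : nat) : R := 1 - n.+2%:R^-1.

Lemma radseq01 n : 0 < radseq n < 1.
Proof.
have h : 0 < n.+2%:R^-1 :> R by rewrite invr_gt0.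
by rewrite /radseq subr_gt0 invf_lt1// ltr1n /= ltrBlDr ltrDl.
Qed.

Lemma radseq_nd m n : (m <= n)%N -> radseq m <= radseq n.
Proof. by move=> mn; rewrite lerD2l lerN2 lef_pV2 ?posrE// ler_nat !ltnS. Qed.

Lemma radseq_cvg x : x < 1 -> exists n, x < radseq n.
Proof.
move=> x1; have d0 : 0 < 1 - x by rewrite subr_gt0.
exists (Num.truncn (1 - x)^-1); rewrite ltrBrDl -ltrBrDr -[ltRHS]invrK ltf_pV2 ?posrE ?invr_gt0//.
have h0 : 0 <= (1 - x)^-1 by rewrite invr_ge0 ltW.
have /andP[_ h] := truncn_itv h0.
by apply: (lt_trans h); rewrite ltr_nat.
Qed.

Section limit.
Variables (F : C -> C) (al : R).
Hypothesis al0 : 0 < al.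
Hypothesis hF : andisk 1 F.
Hypothesis Finj : forall z w, normc z < 1 -> normc w < 1 -> F z = F w -> z = w.
Hypothesis dF0 : forall z, normc z < 1 -> derive1 F z != 0.

(** Off a null set the sets [E n] decrease to the complement of the full image, and dominated
    convergence with the density on [E 0] as bound gives the limit. It vanishes only if the
    complement is null, because the density is positive there. *)
Lemma area_limit : exists I : R, [/\
  curve_integral F al (radseq n) / al @[n --> \oo] --> I &
  I = 0 <-> m2.-negligible [set p | ~ exists2 z, normc z < 1 & F z = cpt p]].
Proof.
have /choice[E EP] n := area_formula al0 hF Finj dF0 (radseq01 n).
have mE n : measurable (E n) by have [] := EP n.
have offE n p : offcurve F (radseq n) (cpt p) ->
    (E n p <-> ~ exists2 z, normc z < radseq n & F z = cpt p) by have [_ h _] := EP n; exact: h.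
pose den p : \bar R := (area_density al (F 0) p)%:E.
have den0 p : (0 <= den p)%E by rewrite lee_fin powR_ge0.
have mden : measurable_fun setT den by apply/measurable_EFinP; exact: measurable_area_density.
have mres A : measurable A -> measurable_fun setT (den \_ A).
  by move=> mA; apply: (measurable_restrictT _ mA).1; exact: measurable_funTS.
have intE n : (\int[m2]_p (den \_ (E n)) p = (curve_integral F al (radseq n) / al)%:E)%E.
  by rewrite -integral_mkcond; have [] := EP n.
(* Points on none of the countably many curves, where every [E n] is the complement of the
   corresponding image. *)
pose good := [set p | forall n, offcurve F (radseq n) (cpt p)].
have [M [mM M0 MP]] : m2.-negligible (~` good).
  apply: (negligibleS _ (negligible_bigcup (fun n => offcurve_ae hF (radseq01 n)))).
  by move=> p /= /existsNP[n np]; exists n.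
have mono p m n : good p -> (m <= n)%N -> E n p -> E m p.
  move=> gp mn /(offE _ _ (gp n)) h; apply/(offE _ _ (gp m)) => -[z zm zp]; apply: h.
  by exists z => //; exact: lt_le_trans zm (radseq_nd mn).
pose K := [set p | ~ exists2 z, normc z < 1 & F z = cpt p].
pose K' := \bigcap_n E n.
have mK' : measurable K' by exact: bigcapT_measurable.
have KK' p : good p -> (K p <-> K' p).
  move=> gp; split=> [h n _|h [z z1 zp]].
    apply/(offE _ _ (gp n)) => -[z zn zp]; apply: h; exists z => //.
    by apply: lt_trans zn _; have /andP[] := radseq01 n.
  have [n zn] := radseq_cvg z1.
  by have /(offE _ _ (gp n)) := h n I; apply; exists z.
have ig : m2.-integrable setT (den \_ (E 0%N)).
  apply/integrableP; split; first exact: mres.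
  under eq_integral do rewrite gee0_abs ?erestrict_ge0//.
  by rewrite intE ltry.
have [ic _ lim] : [/\ m2.-integrable setT (den \_ K'),
    [sequence \int[m2]_(p in setT) `|(den \_ (E n)) p - (den \_ K') p|]_n @ \oo --> 0 &
    [sequence \int[m2]_(p in setT) (den \_ (E n)) p]_n @ \oo --> \int[m2]_(p in setT) (den \_ K') p]%E.
  apply: (@dominated_convergence _ _ _ _ _ _ _ _ (den \_ (E 0%N))) => //.
  - by move=> n; exact: mres.
  - exact: mres.
  - exists M; split => // p /= np; apply: MP => /= gp; apply: np => _.
    have [h|h] := pselect (K' p).
      rewrite patchE mem_set// (_ : (fun n => _) = (fun=> den p)); first exact: cvg_cst.
      by apply/funext => n; rewrite patchE mem_set//; exact: h.
    rewrite patchE memNset//; have /existsNP[m /not_implyP[_ hm]] := h.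
    apply: cvg_near_cst; exists m => // n /= mn.
    rewrite patchE memNset// => hn; apply: hm; exact: mono gp mn hn.
  - exists M; split => // p /= np; apply: MP => /= gp; apply: np => n _.
    rewrite gee0_abs ?erestrict_ge0// !patchE; case: ifPn => [/set_mem h|_].
      by rewrite mem_set//; exact: mono gp _ h.
    by case: ifP.
pose I : R := fine (\int[m2]_p (den \_ K') p).
have IE : (\int[m2]_p (den \_ K') p)%E = I%:E.
  by rewrite /I fineK//; exact: integrable_fin_num ic.
exists I; split.
  move: lim; rewrite IE => /fine_cvg; apply: cvg_trans.
  by apply: near_eq_cvg; near=> n => /=; rewrite intE.
split=> [I0|[A [mA A0 AK]]].
  have h : ae_eq m2 setT (den \_ K') (cst 0%E).
    apply/(ae_eq_integral_abs m2 measurableT (mres _ mK')).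
    under eq_integral do rewrite gee0_abs ?erestrict_ge0//.
    by rewrite IE I0.
  apply: (negligibleS _ (negligibleU (ex_intro _ M (And3 mM M0 MP)) h)) => p Kp.
  have [gp|] := pselect (good p); last by left.
  (* At a point of the complement the density is nonzero, since F 0 itself is attained. *)
  right => /= /(_ Logic.I); rewrite patchE mem_set; last exact/KK'.
  move/eqP; rewrite eqe gt_eqF// powR_gt0// normc_gt0 subr_eq0.
  have /andP[r0 _] := radseq01 0.
  have := KK' _ gp; case=> /(_ Kp)/(_ 0%N Logic.I)/(offE _ _ (gp 0%N)) h0 _.
  apply/eqP => pF; apply: h0; exists 0 => //; by rewrite normc0.
apply/EFin_inj; rewrite -IE -integral_mkcond.
apply: null_set_integral => //.
- exact: measurable_funTS.
- apply/(negligibleP _ mK'); exists (A `|` M); split.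
  + exact: measurableU.
  + exact: null_set_setU.
  + move=> p Kp; have [gp|h] := pselect (good p); [left; apply: AK|right; exact: MP].
    exact/KK'.
Unshelve. all: by end_near. Qed.
End limit.
End AreaLimit.

(** * Coefficients of the transformed quotient *)

Section Jets.
Variable R : realType.
Local Notation C := R[i].
Implicit Types z w : C.

Definition Opow (N : nat) (u : C -> C) := exists K e : R, [/\ 0 <= K, 0 < e &
  forall z, normc z < e -> normc (u z) <= K * normc z ^+ N].

Lemma Opow_D N u v : Opow N u -> Opow N v -> Opow N (fun z => u z + v z).
Proof.
move=> [K [e [K0 e0 H]]] [K' [e' [K'0 e'0 H']]].
exists (K + K'), (Num.min e e'); split; [exact: addr_ge0|by rewrite lt_min e0|].
move=> z; rewrite lt_min => /andP[/H h /H' h'].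
by apply: le_trans (normcD _ _) _; rewrite mulrDl lerD.
Qed.

Lemma Opow_M M N u v : Opow M u -> Opow N v -> Opow (M + N) (fun z => u z * v z).
Proof.
move=> [K [e [K0 e0 H]]] [K' [e' [K'0 e'0 H']]].
exists (K * K'), (Num.min e e'); split; [exact: mulr_ge0|by rewrite lt_min e0|].
move=> z; rewrite lt_min => /andP[/H h /H' h'].
rewrite normcM exprD mulrACA; apply: ler_pM => //; exact: normc_ge0.
Qed.

Lemma eq_Opow N u v : u =1 v -> Opow N u -> Opow N v.
Proof. by move=> /funext ->. Qed.

Lemma Opow_cst (c : C) : Opow 0 (fun=> c).
Proof.
by exists (normc c), 1; split => //; [exact: normc_ge0|move=> z _; rewrite expr0 mulr1].
Qed.

Lemma Opow_N N u : Opow N u -> Opow N (fun z => - u z).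
Proof. by move=> h; apply: (eq_Opow _ (Opow_M (Opow_cst (-1)) h)) => z; rewrite mulN1r. Qed.

Lemma Opow_sum N n (F : nat -> C -> C) : (forall k, Opow N (F k)) ->
  Opow N (fun z => \sum_(k < n) F k z).
Proof.
move=> h; elim: n => [|n IH].
  exists 0, 1; split => // z _; by rewrite big_ord0 normc0 mul0r.
by apply: (eq_Opow _ (Opow_D IH (h n))) => z; rewrite big_ord_recr.
Qed.

Lemma Opow_X N : Opow N (fun z => z ^+ N).
Proof. by exists 1, 1; split => // z _; rewrite normcX mul1r. Qed.

Lemma poly_bounded (P : {poly C}) :
  exists2 B : R, 0 <= B & forall z, normc z <= 1 -> normc P.[z] <= B.
Proof.
elim/poly_ind: P => [|P c [B B0 H]]; first by exists 0 => // z _; rewrite horner0 normc0.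
exists (B + normc c); first by rewrite addr_ge0 ?normc_ge0.
move=> z z1; rewrite hornerMXaddC; apply: le_trans (normcD _ _) _; rewrite lerD2r normcM.
by rewrite -[B]mulr1; apply: ler_pM; [exact: normc_ge0|exact: normc_ge0|exact: H|].
Qed.

Lemma Opow_poly (P : {poly C}) : Opow 0 (fun z => P.[z]).
Proof.
have [B B0 H] := poly_bounded P; exists B, 1; split => // z z1.
by rewrite expr0 mulr1; apply: H; exact: ltW.
Qed.

(** Small real arguments show that the constant term vanishes; dividing by z reduces N by one. This
    division is why the bound is asked only for z != 0. *)
Lemma poly_Opow_coef N (D : {poly C}) (K e : R) : 0 <= K -> 0 < e ->
  (forall z, z != 0 -> normc z < e -> normc D.[z] <= K * normc z ^+ N) ->
  forall i, (i < N)%N -> D`_i = 0.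
Proof.
move=> K0 e0; elim: N D => // N IH D.
elim/poly_ind: D => [|D c _] H i iN; first by rewrite coef0.
have [B B0 BP] := poly_bounded D.
have c0 : c = 0.
  apply/eqP; rewrite -normc_eq0 eq_le normc_ge0 andbT leNgt; apply/negP => c0.
  have Q0 : 0 < K + B + 1 by rewrite ltr_pwDr// addr_ge0.
  (* As d <= 1, the bounds give |c| <= (K + B) d, against (K + B + 1) d <= |c|. *)
  pose d := Num.min (Num.min (e / 2) 1) (normc c / (K + B + 1)).
  have d0 : 0 < d by rewrite !lt_min ltr01 !divr_gt0.
  have de : d < e by apply: (@le_lt_trans _ _ (e / 2)); [rewrite !ge_min lexx|lra].
  have d1 : d <= 1 by rewrite !ge_min lexx orbT.
  have dc : d <= normc c / (K + B + 1) by rewrite !ge_min lexx orbT.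
  have nd : normc d%:C = d by rewrite normcR gtr0_norm.
  have dz : d%:C != 0 :> C by rewrite -normc_gt0 nd.
  have := H _ dz; rewrite nd => /(_ de); rewrite hornerMXaddC => h.
  have h2 : normc c <= K * d ^+ N.+1 + B * d.
    rewrite -[c](addKr (D.[d%:C] * d%:C)) addrC; apply: le_trans (normcD _ _) _.
    rewrite normcN normcM nd; apply: lerD => //; apply: ler_wpM2r (ltW d0) _ _ _.
    by apply: BP; rewrite nd.
  have h3 : K * d ^+ N.+1 <= K * d.
    apply: ler_wpM2l K0 _ _ _; rewrite exprS ler_piMr ?(ltW d0)//.
    by rewrite exprn_ile1// ltW.
  move: dc; rewrite ler_pdivlMr// => dc; nra.
case: i iN => [|i] iN; first by rewrite coefD coefMX coefC c0 add0r.
rewrite coefD coefMX coefC addr0 /=; apply: IH => // z z0 ze.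
have nz : 0 < normc z by rewrite normc_gt0.
by have := H z z0 ze; rewrite hornerMXaddC c0 addr0 normcM exprSr mulrA ler_pM2r.
Qed.

(** [P] represents u modulo z ^ N. Products of expansions thus become products of polynomials, and
    their coefficients are read off without rearranging series. *)
Definition jet (N : nat) (u : C -> C) (P : {poly C}) := Opow N (fun z => u z - P.[z]).

Lemma jet_unique N u P Q : jet N u P -> jet N u Q -> forall i, (i < N)%N -> P`_i = Q`_i.
Proof.
move=> hP hQ i iN; apply/eqP; rewrite -subr_eq0 -coefB; apply/eqP.
have [K [e [K0 e0 H]]] := Opow_D hQ (Opow_N hP).
apply: (poly_Opow_coef K0 e0 _ iN) => z _ /H.
by rewrite hornerD hornerN (_ : _ - _ - _ = P.[z] - Q.[z])//; ring.
Qed.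

Lemma jet_D N u v P Q : jet N u P -> jet N v Q -> jet N (fun z => u z + v z) (P + Q).
Proof.
by move=> hP hQ; apply: (eq_Opow _ (Opow_D hP hQ)) => z; rewrite hornerD; ring.
Qed.

Lemma jet_bounded N u P : jet N u P -> Opow 0 u.
Proof.
move=> [K [e [K0 e0 H]]]; have [B B0 BP] := poly_bounded P.
exists (K + B), (Num.min e 1); split; [exact: addr_ge0|by rewrite lt_min e0 /=|].
move=> z; rewrite lt_min => /andP[/H h /ltW z1]; rewrite expr0 mulr1.
rewrite -[u z](subrK P.[z]); apply: le_trans (normcD _ _) _; apply: lerD; last exact: BP.
by apply: (le_trans h); rewrite ler_piMr// exprn_ile1// normc_ge0.
Qed.

Lemma jet_M N u v P Q : jet N u P -> jet N v Q -> jet N (fun z => u z * v z) (P * Q).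
Proof.
move=> hP hQ.
have h1 := Opow_M hP (jet_bounded hQ); have h2 := Opow_M (Opow_poly P) hQ.
rewrite addn0 in h1.
by apply: (eq_Opow _ (Opow_D h1 h2)) => z; rewrite hornerM; ring.
Qed.

Lemma jet_poly N (P : {poly C}) : jet N (fun z => P.[z]) P.
Proof.
by exists 0, 1; split => // z _; rewrite subrr normc0 mul0r.
Qed.

Lemma jet_Z N c u P : jet N u P -> jet N (fun z => c * u z) (c *: P).
Proof.
move=> h; have := jet_M (jet_poly N c%:P) h; rewrite mul_polyC.
by apply: eq_Opow => z; rewrite hornerC.
Qed.

Lemma jet_sum N n (F : nat -> C -> C) (P : nat -> {poly C}) : (forall k, jet N (F k) (P k)) ->
  jet N (fun z => \sum_(k < n) F k z) (\sum_(k < n) P k).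
Proof.
move=> h; apply: (eq_Opow _ (Opow_sum n h)) => z.
by rewrite sumrB horner_sum.
Qed.

Lemma eq_jet N u v P (e : R) : 0 < e -> (forall z, normc z < e -> u z = v z) -> jet N v P -> jet N u P.
Proof.
move=> e0 uv [K [e' [K0 e'0 H]]]; exists K, (Num.min e e'); split => //; first by rewrite lt_min e0.
by move=> z; rewrite lt_min => /andP[/uv -> /H].
Qed.

Lemma jet_pconv N a rho u : 0 < rho -> pconv a rho u -> jet N u (\poly_(i < N) a i).
Proof.
move=> r0 /(pconv_trunc N r0)[K [e [K0 e0 H]]]; exists K, e; split => //; first exact: ltW.
by move=> z /H; rewrite normcB horner_poly.
Qed.

Lemma jet_coef N a rho u P : 0 < rho -> pconv a rho u -> jet N u P ->
  forall n, (n < N)%N -> a n = P`_n.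
Proof.
move=> r0 hu hP n nN; have := jet_unique (jet_pconv N r0 hu) hP nN.
by rewrite coef_poly nN.
Qed.
End Jets.

(** * Binomial series *)

Section BinomialSeries.
Variable R : realType.
Local Notation C := R[i].
Implicit Types z w : C.

Lemma gbinom0 (al : R) : gbinom al 0 = 1.
Proof. by rewrite /gbinom big_ord0 fact0 divr1. Qed.

Lemma gbinomS (al : R) n : n.+1%:R * gbinom al n.+1 = gbinom al n * (al - n%:R).
Proof.
rewrite /gbinom big_ord_recr /= factS natrM.
have h : n.+1%:R != 0 :> R by rewrite pnatr_eq0.
have h' : n`!%:R != 0 :> R by rewrite pnatr_eq0 -lt0n fact_gt0.
rewrite invfM; set A := \prod_(_ < _) _.
by rewrite [RHS]mulrAC mulrCA !mulrA mulfK// mulrC mulrA.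
Qed.

(** For m = j - k the upper index k + m - 1 is the j - 1 that appears in [Acoef]. *)
Lemma gbinomN k m : gbinom (- k%:R : R) m = (-1) ^+ m * gbinom ((k + m)%:R - 1) m.
Proof.
rewrite /gbinom mulrA; congr (_ / _).
rewrite (reindex_inj rev_ord_inj) /= -[X in (-1) ^+ X](card_ord m) -prodr_const -big_split /=.
apply: eq_bigr => i _; rewrite natrD (natrB _ (ltn_ord i)) -natr1; ring.
Qed.

Lemma one_cz_neq0 (c z : C) : normc c < 1 -> normc z < 1 -> 0 < complex.Re (1 + c * z).
Proof.
move=> c1 z1; rewrite cReD /=.
have h : normc (c * z) < 1.
  by rewrite normcM mulr_ilt1 ?normc_ge0.
have := le_lt_trans (Re_le_normc (c * z)) h; rewrite ltr_norml => /andP[h1 _]; lra.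
Qed.

Lemma ode_coef (al c : C) (rho : R) (y : nat -> C) (u : C -> C) : 0 < rho -> pconv y rho u ->
  (forall z, normc z < rho -> (1 + c * z) * derive1 u z = al * u z) ->
  forall n, n.+1%:R * y n.+1 + c * (n%:R * y n) = al * y n.
Proof.
move=> r0 hy H n.
have hd := pconv_derive1 hy.
have j1 := jet_pconv n.+1 r0 hd; have j2 := jet_Z al (jet_pconv n.+1 r0 hy).
have j3 := jet_M (jet_poly n.+1 (1 + c *: 'X)) j1.
have j4 : jet n.+1 (fun z => al * u z) ((1 + c *: 'X) * \poly_(i < n.+1) dcoef y i).
  apply: (eq_jet r0 _ j3) => z zr; rewrite -H//.
  by rewrite hornerD hornerZ hornerX hornerC.
have := jet_unique j4 j2 (ltnSn n); rewrite mulrDl mul1r -scalerAl coefD !coefZ coefXM !coef_poly ltnSn => <-.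
congr (_ + c * _); case: n {j1 j2 j3 j4} => [|n] /=; first by rewrite mul0r.
by rewrite ltnS leqnSn.
Qed.

(** The equation (1 + c z) u' = al c u with u 0 = 1 determines (1 + c z) ^ al, and its recurrence is
    that of the binomial coefficients. Inverse integer powers and real powers are covered at
    once. *)
Lemma binomial_coef (al : R) (c : C) (rho : R) (y : nat -> C) (u : C -> C) : 0 < rho ->
  pconv y rho u -> u 0 = 1 ->
  (forall z, normc z < rho -> (1 + c * z) * derive1 u z = al%:C * c * u z) ->
  forall n, y n = (gbinom al n)%:C * c ^+ n.
Proof.
move=> r0 hy u0 H; elim=> [|n IH].
  by rewrite (pconv_coef0 r0 hy) u0 gbinom0 mulr1.
have n0 : n.+1%:R != 0 :> C by rewrite pnatr_eq0.
apply: (mulfI n0); have := ode_coef r0 hy H n; rewrite IH.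
move=> /(congr1 (fun x => x - c * (n%:R * ((gbinom al n)%:C * c ^+ n)))); rewrite addrK => ->.
have : n.+1%:R * (gbinom al n.+1)%:C = (gbinom al n)%:C * (al%:C - n%:R) :> C.
  have /(congr1 (fun x : R => x%:C)) := gbinomS al n.
  by rewrite !(rmorphM (real_complex R)) (rmorphB (real_complex R)) /= !(rmorph_nat (real_complex R)).
move=> E; rewrite [RHS]mulrA E exprS; ring.
Qed.

Section powers.
Variable c : C.
Hypothesis c1 : normc c < 1.

Let nz z : normc z < 1 -> 1 + c * z != 0.
Proof. by move=> z1; apply: Re_gt0_neq0; exact: one_cz_neq0. Qed.

Let an_lin z : an (fun z => 1 + c * z) z.
Proof. exact: (an_D (an_cst 1 z) (an_Z c (an_id z))). Qed.

Lemma is_derive_lin (e : C) z : is_derive z 1 (fun z => e + c * z) c.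
Proof.
apply/is_deriveCP => d d0; exists 1 => // w _.
by rewrite (_ : _ - _ = 0) ?normc0 ?mulr_ge0 ?normc_ge0 ?ltW//; ring.
Qed.

Definition invpow (k : nat) z : C := ((1 + c * z) ^+ k)^-1.

Lemma andisk_invpow k : andisk 1 (invpow k).
Proof. by move=> z z1; apply: (an_V (an_X k (an_lin z))); rewrite expf_neq0 ?nz. Qed.

Lemma invpow_coef k y : pconv y 1 (invpow k) ->
  forall m, y m = (gbinom ((k + m)%:R - 1) m)%:C * (- c) ^+ m.
Proof.
move=> hy m; rewrite (@binomial_coef (- k%:R) c 1 y (invpow k))//; first last.
- move=> z z1; have h := nz z1.
  have hk : (1 + c * z) ^+ k != 0 by rewrite expf_neq0.
  have d0 := is_derive_compC (is_derive_lin 1 z) (expr_is_derive (1 + c * z) k).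
  have d := @is_deriveVC R (fun w => (1 + c * w) ^+ k) z _ hk d0.
  rewrite /invpow (derive1_val d) rmorphN /= rmorph_nat.
  case: (k) hk => [|j] hk; first by rewrite !(mul0r, oppr0, mulr0).
  move: h hk; rewrite [_ ^+ j.+1]exprS /=.
  move: (1 + c * z) => X h; rewrite mulf_eq0 negb_or => /andP[_].
  move: (X ^+ j) (j.+1%:R : C) => Y k' hY.
  by field; rewrite h hY.
- by rewrite /invpow mulr0 addr0 expr1n invr1.
rewrite gbinomN (rmorphM (real_complex R)) (rmorphXn (real_complex R)) /=.
rewrite (rmorphN1 (real_complex R)) [(- c) ^+ m]exprNn; ring.
Qed.

Definition cpower (lambda : R) z : C := Cexp (lambda%:C * Lg (1 + c * z)).

Lemma andisk_cpower lambda : andisk 1 (cpower lambda).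
Proof.
move=> z z1; apply: (an_comp _ (an_Cexp _)); apply: an_Z.
exact: (an_comp (an_lin z) (an_Lg (one_cz_neq0 c1 z1))).
Qed.

Lemma cpower_coef lambda y : pconv y 1 (cpower lambda) ->
  forall m, y m = (gbinom lambda m)%:C * c ^+ m.
Proof.
move=> hy; apply: (@binomial_coef lambda c 1 y (cpower lambda)) => //.
  by rewrite /cpower mulr0 addr0 Lg1 mulr0 Cexp0.
move=> z z1; have h := nz z1.
have d1 := is_derive_compC (is_derive_lin 1 z) (is_derive_Lg (one_cz_neq0 c1 z1)).
have d2 : is_derive z 1 (fun z => lambda%:C * Lg (1 + c * z)) (lambda%:C * ((1 + c * z)^-1 * c)).
  have := is_deriveMC (an_is_derive (an_cst lambda%:C z)) d1.
  have -> : derive1 (fun=> lambda%:C) z = 0 :> C by rewrite derive1_cst.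
  by rewrite mulr0 addr0.
have d := is_derive_compC d2 (is_derive_Cexp _).
by rewrite /cpower (derive1_val d); field.
Qed.
End powers.
End BinomialSeries.

(** * Disk automorphisms *)

Section Mobius.
Variable R : realType.
Local Notation C := R[i].
Implicit Types z w : C.

(** Written as zeta plus a term that vanishes at z = 0, ready for substitution into an expansion
    about zeta; [mobiusE] gives the usual form on the disk. *)
Definition mobius (zeta z : C) : C := zeta + (1 - normc zeta ^+ 2)%:C * z / (1 + zeta^* * z).

Lemma mobius0 zeta : mobius zeta 0 = zeta.
Proof. by rewrite /mobius mulr0 mul0r addr0. Qed.

Section mobius.
Variable zeta : C.
Hypothesis zeta1 : normc zeta < 1.

Lemma mobius_den z : normc z < 1 -> 1 + zeta^* * z != 0.
Proof. by move=> z1; apply/Re_gt0_neq0/one_cz_neq0 => //; rewrite normc_conj. Qed.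

Lemma mobiusE z : normc z < 1 -> mobius zeta z = (z + zeta) / (1 + zeta^* * z).
Proof.
move=> z1; have h := mobius_den z1.
rewrite /mobius rmorphB rmorph1 /= -mul_conjc; field; exact: h.
Qed.

Lemma mobius_lt1 z : normc z < 1 -> normc (mobius zeta z) < 1.
Proof.
move=> z1; rewrite mobiusE// normcM normcV ltr_pdivrMr ?mul1r; last by rewrite normc_gt0 mobius_den.
rewrite -(@ltr_pXn2r _ 2) ?nnegrE ?normc_ge0// -subr_gt0.
have -> : normc (1 + zeta^* * z) ^+ 2 - normc (z + zeta) ^+ 2 =
    (1 - normc z ^+ 2) * (1 - normc zeta ^+ 2).
  by rewrite !normcE2; case: (z) => a b; case: (zeta) => c d /=; ring.
by rewrite mulr_gt0// subr_gt0 exprn_ilt1 ?normc_ge0.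
Qed.

Lemma mobius_inj z w : normc z < 1 -> normc w < 1 -> mobius zeta z = mobius zeta w -> z = w.
Proof.
move=> z1 w1; have hz := mobius_den z1; have hw := mobius_den w1.
have s0 : (1 - normc zeta ^+ 2)%:C != 0 :> C.
  by rewrite fmorph_eq0 subr_eq0 eq_sym lt_eqF// exprn_ilt1 ?normc_ge0.
rewrite /mobius -!mulrA => /addrI/(mulfI s0) /(congr1 (fun x => x * ((1 + zeta^* * z) * (1 + zeta^* * w)))).
have -> : z / (1 + zeta^* * z) * ((1 + zeta^* * z) * (1 + zeta^* * w)) = z * (1 + zeta^* * w).
  by field; exact: hz.
have -> : w / (1 + zeta^* * w) * ((1 + zeta^* * z) * (1 + zeta^* * w)) = w * (1 + zeta^* * z).
  by field; exact: hw.
rewrite !mulrDr !mulr1 => E; apply: (addIr (z * (zeta^* * w))); rewrite E; congr (_ + _); ring.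
Qed.

Lemma an_mobius z : normc z < 1 -> an (mobius zeta) z.
Proof.
move=> z1; have h := mobius_den z1.
have h1 : an (fun z => (1 - normc zeta ^+ 2)%:C * z) z by exact: (an_Z _ (an_id z)).
have h2 : an (fun z => 1 + zeta^* * z) z by exact: (an_D (an_cst 1 z) (an_Z zeta^* (an_id z))).
exact: (an_D (an_cst zeta z) (an_div h1 h2 h)).
Qed.

Lemma is_derive_mobius z : normc z < 1 ->
  is_derive z 1 (mobius zeta) ((1 - normc zeta ^+ 2)%:C / (1 + zeta^* * z) ^+ 2).
Proof.
move=> z1; have h := mobius_den z1; set s : C := (_ - _)%:C.
have d1 : is_derive z 1 (fun z => 0 + s * z) s := is_derive_lin s 0 z.
have d2 := @is_deriveVC R (fun z => 1 + zeta^* * z) z _ h (is_derive_lin zeta^* 1 z).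
have d3 := is_deriveMC d1 d2.
have d4 : is_derive z 1 (fun w => zeta + 1 * ((0 + s * w) / (1 + zeta^* * w)))
   (1 * ((0 + s * z) * (- zeta^* / (1 + zeta^* * z) ^+ 2) + (1 + zeta^* * z)^-1 * s)).
  exact: (is_derive_compC d3 (is_derive_lin 1 zeta _)).
have E : mobius zeta = (fun w => zeta + 1 * ((0 + s * w) / (1 + zeta^* * w))).
  by apply/funext => w; rewrite mul1r add0r.
rewrite E (_ : s / _ = 1 * ((0 + s * z) * (- zeta^* / (1 + zeta^* * z) ^+ 2) + (1 + zeta^* * z)^-1 * s))//.
by field; exact: h.
Qed.

End mobius.

Lemma mobius_surj zeta w : normc zeta < 1 -> normc w < 1 ->
  exists2 z, normc z < 1 & mobius zeta z = w.
Proof.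
move=> z1 w1; have nz1 : normc (- zeta) < 1 by rewrite normcN.
(* The inverse automorphism has parameter - zeta. *)
exists (mobius (- zeta) w); first exact: mobius_lt1.
rewrite (mobiusE z1 (mobius_lt1 nz1 w1)) (mobiusE nz1 w1).
have h := mobius_den nz1 w1; rewrite rmorphN /= in h *.
have s0 : 1 - zeta * zeta^* != 0.
  rewrite mul_conjc -(rmorph1 (real_complex R)) -rmorphB fmorph_eq0 subr_eq0 eq_sym lt_eqF//.
  by rewrite exprn_ilt1 ?normc_ge0.
have E1 : (w + - zeta) / (1 + - zeta^* * w) + zeta = w * (1 - zeta * zeta^*) / (1 + - zeta^* * w).
  by field; exact: h.
have E2 : 1 + zeta^* * ((w + - zeta) / (1 + - zeta^* * w)) = (1 - zeta * zeta^*) / (1 + - zeta^* * w).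
  by field; exact: h.
by rewrite E1 E2; field; rewrite s0 h.
Qed.
End Mobius.

(** * The analytic power h and its coefficients *)

Section TransformPower.
Variable R : realType.
Local Notation C := R[i].
Implicit Types z w : C.

(** Take the antiderivative l of q' / q with l 0 = 0; then q exp (- l) has derivative 0 and value 1
    at 0. *)
Lemma analytic_log (rho : R) (q : C -> C) : 0 < rho -> andisk rho q ->
  (forall z, normc z < rho -> q z != 0) -> q 0 = 1 ->
  exists l, [/\ andisk rho l, l 0 = 0, forall z, normc z < rho -> Cexp (l z) = q z &
    forall z, normc z < rho -> is_derive z 1 l (derive1 q z / q z)].
Proof.
move=> r0 hq q0 q1.
have hp : andisk rho (fun z => derive1 q z / q z).
  by move=> z zr; exact: (an_div (an_derive1 (hq _ zr)) (hq _ zr) (q0 _ zr)).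
have [l [hl l0 dl]] := antiderivative r0 hp.
have dN z : normc z < rho -> is_derive z 1 (fun z => - l z) (- (derive1 q z / q z)).
  move=> zr; have := is_deriveMC (an_is_derive (an_cst (-1) z)) (dl _ zr).
  rewrite derive1_cst mulr0 addr0 mulN1r.
  by rewrite (_ : (fun w => -1 * l w) = (fun w => - l w))//; apply/funext => w; rewrite mulN1r.
exists l; split => // z zr.
have hw : andisk rho (fun z => q z * Cexp (- l z)).
  by move=> w wr; exact: (an_M (hq _ wr) (an_comp (an_N (hl _ wr)) (an_Cexp _))).
have := andisk_const hw _ zr; rewrite q1 l0 oppr0 Cexp0 mulr1 CexpN => H.
apply/esym/divr1_eq; apply: H => w wr.
have d := is_deriveMC (an_is_derive (hq _ wr)) (is_derive_compC (dN _ wr) (is_derive_Cexp _)).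
rewrite (_ : 0 = q w * (Cexp (- l w) * - (derive1 q w / q w)) + Cexp (- l w) * derive1 q w)//.
by field; exact: q0.
Qed.

Lemma Cexp_eq1 z : Cexp z = 1 -> `|complex.Im z| < pi -> z = 0.
Proof.
move=> E zpi; have re0 : complex.Re z = 0.
  have := congr1 (@normc R) E; rewrite normc_Cexp normcR normr1 => h.
  by apply: expR_inj; rewrite h expR0.
apply: eqRI => //; move: E; rewrite /Cexp re0 expR0 mul1r => /(congr1 (@complex.Im R)) /= s0.
move: zpi; rewrite ltr_norml => /andP[h1 h2].
have [h|h|//] := ltgtP (complex.Im z) 0.
  have : 0 < sin (- complex.Im z) by apply: sin_gt0_pi; rewrite oppr_gt0 h /= ltrNl h1.
  by rewrite sinN s0 oppr0 ltxx.
have : 0 < sin (complex.Im z) by apply: sin_gt0_pi; rewrite h h2.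
by rewrite s0 ltxx.
Qed.

Variables (lambda : R) (f : C -> C) (zeta : C).
Hypothesis hf : forall z, normc z < 1 -> an f z.
Hypothesis df0 : forall z, normc z < 1 -> derive1 f z != 0.
Hypothesis zeta1 : normc zeta < 1.

Local Notation T := (mobius zeta).
Local Notation s := ((1 - normc zeta ^+ 2)%:C).
Local Notation c := (zeta^*).

Let c1 : normc c < 1. Proof. by rewrite normc_conj. Qed.

Definition transform z := f (T z).
Local Notation F := transform.

Let s0 : s != 0.
Proof. by rewrite fmorph_eq0 subr_eq0 eq_sym lt_eqF// exprn_ilt1 ?normc_ge0. Qed.

Lemma andisk_transform : andisk 1 F.
Proof. by move=> z z1; exact: (an_comp (an_mobius zeta1 z1) (hf (mobius_lt1 zeta1 z1))). Qed.

Lemma derive1_transform z : normc z < 1 ->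
  derive1 F z = derive1 f (T z) * (s / (1 + c * z) ^+ 2).
Proof.
move=> z1; apply: derive1_val.
exact: (is_derive_compC (is_derive_mobius zeta1 z1) (an_is_derive (hf (mobius_lt1 zeta1 z1)))).
Qed.

Lemma derive1_transform_neq0 z : normc z < 1 -> derive1 F z != 0.
Proof.
move=> z1; rewrite derive1_transform// mulf_neq0 ?df0 ?mobius_lt1//.
by rewrite mulf_neq0// invr_neq0// expf_neq0// mobius_den.
Qed.

Lemma ddiff_transform z : normc z < 1 -> ddiff F 0 z = ddiff f zeta (T z) * (s / (1 + c * z)).
Proof.
move=> z1; have h := mobius_den zeta1 z1.
have [->|z0] := eqVneq z 0.
  rewrite {1}/ddiff eqxx derive1_transform ?normc0// mobius0 /ddiff eqxx mulr0 addr0.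
  by rewrite expr1n.
rewrite {1}/ddiff (negbTE z0) subr0 /transform mobius0 ddiffM.
have -> : T z - zeta = s * z / (1 + c * z) by rewrite /mobius addrAC subrr add0r.
by field; rewrite z0 h.
Qed.

(** The same function as [diff_quotient f zeta], but visibly analytic at zeta. *)
Let Q w := derive1 f zeta / ddiff f zeta w.
Let Qz : Q zeta = 1. Proof. by rewrite /Q /ddiff eqxx divff// df0. Qed.
Let anQ : an Q zeta.
Proof.
apply: (an_div (an_cst _ _) (an_ddiff_self (hf zeta1))).
by rewrite /ddiff eqxx df0.
Qed.
Let ReQ : 0 < complex.Re (Q zeta). Proof. by rewrite Qz /=. Qed.

Let g w := Cexp (lambda%:C * Lg (Q w)).
Let an_g : an g zeta.
Proof. exact: (an_comp (an_Z _ (an_comp anQ (an_Lg ReQ))) (an_Cexp _)). Qed.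

Let QE w : diff_quotient f zeta w = Q w.
Proof.
rewrite /diff_quotient /Q /ddiff; case: (eqVneq w zeta) => [_|h]; first by rewrite divff// df0.
by rewrite invf_div mulrA.
Qed.

Let Q_near : exists2 e : R, 0 < e & forall w, normc (w - zeta) < e -> 0 < complex.Re (Q w).
Proof.
have [e e0 eP] := Re_gt0_near ReQ.
have /continuousC/(_ _ e0)[d d0 dP] := an_continuous anQ.
by exists d => // w /dP /eP.
Qed.

(** The power is analytic at zeta, so an expansion exists and the choice in [Phi] returns one
    instead of its default value. *)
Lemma Phi_expansion : has_expansion g zeta (Phi lambda f zeta).
Proof.
have [e e0 eP] := Q_near.
have E w : normc (w - zeta) < e -> Cpow (diff_quotient f zeta w) lambda = g w.
  by move=> /eP h; rewrite QE Cpow_Cexp// Re_gt0_neq0.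
have [a ha] : an (fun w => Cpow (diff_quotient f zeta w) lambda) zeta.
  exact: (eq_an e0 E an_g).
have : has_expansion (fun w => Cpow (diff_quotient f zeta w) lambda) zeta (Phi lambda f zeta).
  exact: (@xgetPex _ _ [set a | has_expansion _ zeta a] (ex_intro _ a ha)).
move=> /has_expansionP[d d0 H]; apply/has_expansionP; exists (Num.min d e); first by rewrite lt_min d0.
by move=> w; rewrite lt_min => /andP[/H h /E <-].
Qed.

(** Since T z - zeta = s z / (1 + c z), the k-th term of the expansion of g becomes a multiple of z
    ^ k (1 + c z) ^ (- k), whose coefficient at z ^ j is the inner binomial factor of [Acoef]. As T
    z - zeta = O(z), the terms from N on are O(z ^ N). *)
Lemma jet_Phi (N : nat) : exists P : {poly C}, jet N (fun z => g (T z)) P /\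
  forall j, (j < N)%N -> P`_j = \sum_(k < j.+1) Phi lambda f zeta k * s ^+ k *
    ((gbinom (j%:R - 1) (j - k))%:C * (- c) ^+ (j - k)).
Proof.
have /choice[y hy] k : exists y, pconv y 1 (invpow c k).
  by apply: (andisk_pconv ltr01); exact: andisk_invpow.
pose t z := s * z / (1 + c * z).
have [e e0 He] := (has_expansion_pconv _ _ _).1 Phi_expansion.
have [K [d [K0 d0 Hd]]] := pconv_trunc N e0 He.
have t1 : Opow 1 t.
  have h : Opow 0 (invpow c 1) by exact: jet_bounded (jet_pconv 0 ltr01 (hy 1%N)).
  apply: (eq_Opow _ (Opow_M (Opow_M (Opow_cst s) (@Opow_X R 1)) h)) => z.
  by rewrite /t /invpow expr1.
pose P := \sum_(k < N) (Phi lambda f zeta k * s ^+ k) *: ('X^k * \poly_(i < N) y k i).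
exists P; split; last first.
  move=> j jN; rewrite coef_sum (big_ord_widen N (fun k => Phi lambda f zeta k * s ^+ k *
    ((gbinom (j%:R - 1) (j - k))%:C * (- c) ^+ (j - k))))// [RHS]big_mkcond; apply: eq_bigr => k _.
  rewrite coefZ coefXnM [X in _ = if X then _ else _]ltnS; case: (leqP k j) => [kj|_]; last by rewrite mulr0.
  rewrite coef_poly (leq_ltn_trans (leq_subr _ _) jN) (invpow_coef c1 (hy k)).
  by rewrite subnKC.
have h1 : Opow N (fun z => g (T z) - psum (Phi lambda f zeta) (t z) N).
  have [K' [d' [K'0 d'0 H']]] := t1.
  exists (K * K' ^+ N), (Num.min d' (d / (K' + 1))); split.
  - by rewrite mulr_ge0 ?exprn_ge0// ltW.
  - by rewrite lt_min d'0 divr_gt0// ltr_pwDr.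
  move=> z; rewrite lt_min => /andP[/H' h]; rewrite expr1 in h.
  rewrite ltr_pdivlMr ?ltr_pwDr// => h2.
  have h3 : normc (t z) < d.
    apply: le_lt_trans h _; apply: le_lt_trans h2; rewrite mulrC ler_wpM2l ?normc_ge0//.
    by rewrite lerDl.
  rewrite normcB (_ : T z = t z + zeta); last by rewrite addrC.
  apply: (le_trans (Hd _ h3)); rewrite -mulrA -exprMn ler_wpM2l ?(ltW K0)//.
  by apply: lerXn2r => //; rewrite nnegrE ?normc_ge0 ?mulr_ge0 ?normc_ge0.
have h2 : jet N (fun z => psum (Phi lambda f zeta) (t z) N) P.
  pose G k z := (Phi lambda f zeta k * s ^+ k) * (('X^k : {poly C}).[z] * invpow c k z).
  pose G' k := (Phi lambda f zeta k * s ^+ k) *: ('X^k * \poly_(i < N) y k i).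
  have hG k : jet N (G k) (G' k).
    exact: (jet_Z _ (jet_M (jet_poly N 'X^k) (jet_pconv N ltr01 (hy k)))).
  have h : jet N (fun z => \sum_(k < N) G k z) P := @jet_sum R N N G G' hG.
  apply: (eq_jet ltr01 _ h) => z _; apply: eq_bigr => k _.
  by rewrite /G hornerXn /t /invpow !exprMn exprVn !mulrA.
by apply: (eq_Opow _ (Opow_D h1 h2)) => z; rewrite addrA subrK.
Qed.

(** The outer sum of [Acoef] is the Cauchy product with the series of (1 + c z) ^ lambda. *)
Lemma Acoef_poly n yl (P : {poly C}) : pconv yl 1 (cpower c lambda) ->
  (forall j, (j < n.+1)%N -> P`_j = \sum_(k < j.+1) Phi lambda f zeta k * s ^+ k *
    ((gbinom (j%:R - 1) (j - k))%:C * (- c) ^+ (j - k))) ->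
  Acoef lambda f n zeta = ((\poly_(i < n.+1) yl i) * P)`_n.
Proof.
move=> hyl PE; rewrite coefMr; apply: eq_bigr => j _.
rewrite coef_poly ltnS leq_subr (cpower_coef c1 hyl) (PE _ (ltn_ord j)) !mulr_sumr.
apply: eq_bigr => k _.
have -> : (n - k = (n - j) + (j - k))%N.
  by rewrite addnBA ?subnK// -ltnS ltn_ord.
rewrite exprD [(- c) ^+ (n - j)]exprNn.
(* The sign (-1) ^ (n - j) in [Acoef] cancels the one contained in (- c) ^ (n - j), as (1 + c z) ^
   lambda contributes c ^ (n - j) without sign. *)
have sg : (-1) ^+ (n - j) * (-1) ^+ (n - j) = 1 :> C by rewrite -exprMn mulrNN mulr1 expr1n.
have aux (A1 A2 A3 A4 A5 A6 A7 : C) : A1 * A1 = 1 ->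
    A1 * A2 * (A3 * (A1 * A4 * A5) * A6 * A7) = A2 * A4 * (A7 * A6 * (A3 * A5)).
  by move=> e; transitivity (A1 * A1 * (A2 * A4 * (A7 * A6 * (A3 * A5)))); [ring|rewrite e mul1r].
exact: aux.
Qed.

(** Both sides come from logarithms of the same quotient. The difference m of these logarithms
    satisfies exp m = 1 and m 0 = 0, so by continuity it vanishes near 0; equality near 0 is enough
    to compare coefficients. *)
Lemma transform_power_near (rho : R) (l : C -> C) : andisk rho l -> 0 < rho -> l 0 = 0 ->
  (forall z, normc z < rho -> Cexp (l z) = derive1 F 0 / ddiff F 0 z) ->
  exists2 e : R, 0 < e & forall z, normc z < e ->
    Cexp (lambda%:C * l z) = cpower c lambda z * g (T z).
Proof.
move=> hl r0 l0 El.
have n0 : normc (0 : C) < 1 by rewrite normc0.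
have n0' : normc (0 : C) < rho by rewrite normc0.
pose m z := l z - (Lg (1 + c * z) + Lg (Q (T z))).
have an_m : an m 0.
  have a1 : an (fun z => Lg (1 + c * z)) 0.
    apply: (an_comp (an_D (an_cst 1 0) (an_Z c (an_id 0))) (an_Lg _)).
    by rewrite mulr0 addr0.
  have a2 : an (fun z => Lg (Q (T z))) 0.
    have a3 : an Q (T 0) by rewrite mobius0.
    apply: (an_comp (an_comp (an_mobius zeta1 n0) a3) (an_Lg _)); by rewrite mobius0.
  exact: (an_B (hl _ n0') (an_D a1 a2)).
have m0 : m 0 = 0 by rewrite /m l0 mulr0 addr0 Lg1 mobius0 Qz Lg1 addr0 subr0.
have [e1 e10 P1] := Q_near.
have /continuousC/(_ _ e10)[e2 e20 P2] := an_continuous (an_mobius zeta1 n0).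
have /continuousC/(_ _ (@pi_gt0 R))[e3 e30 P3] := an_continuous an_m.
exists (Num.min (Num.min rho 1) (Num.min e2 e3)); first by rewrite !lt_min r0 ltr01 e20 e30.
move=> z; rewrite !lt_min => /andP[/andP[zr z1] /andP[z2 z3]].
have h2 := P2 z; rewrite subr0 mobius0 in h2; have /P1 reQ := h2 z2.
have h3 := P3 z; rewrite subr0 m0 subr0 in h3.
have Tz1 := mobius_lt1 zeta1 z1; have dn := mobius_den zeta1 z1.
have E : Cexp (m z) = 1.
  rewrite /m CexpD CexpN CexpD El// (Cexp_Lg reQ) Cexp_Lg; last exact: one_cz_neq0.
  rewrite ddiff_transform// derive1_transform// mobius0 mulr0 addr0 expr1n divr1 /Q.
  have Q0 := Re_gt0_neq0 reQ; rewrite /Q mulf_eq0 negb_or invr_eq0 in Q0.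
  case/andP: Q0 => q1 q2.
  move: s0 q1 q2 dn; move: (ddiff f zeta (T z)) (derive1 f zeta) (1 + c * z) s.
  by move=> B A D S hS hA hB hD; field; rewrite hS hA hB hD.
have mz : m z = 0.
  by apply: Cexp_eq1 => //; apply: le_lt_trans (Im_le_normc _) (h3 z3).
move/eqP: mz; rewrite subr_eq0 => /eqP ->.
by rewrite mulrDr CexpD.
Qed.

Section disk.
Variable rho : R.
Hypothesis rho01 : 0 < rho <= 1.
Hypothesis Fne : forall z, z != 0 -> normc z < rho -> F z != F 0.

Let r0 : 0 < rho. Proof. by case/andP: rho01. Qed.
Let r1 z : normc z < rho -> normc z < 1.
Proof. by move=> h; apply: (lt_le_trans h); case/andP: rho01. Qed.

(* h is (F'(0) z / (F z - F 0)) ^ lambda, written as exp (lambda l) with l a logarithm of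
   the nonvanishing quotient. *)
Theorem transform_power : exists h, [/\ andisk rho h, h 0 = 1,
  pconv (fun n => Acoef lambda f n zeta) rho h,
  forall z, normc z < rho ->
    normc (h z) * normc (F z - F 0) `^ lambda = (normc (derive1 F 0) * normc z) `^ lambda &
  forall z, normc z < rho -> h z != 0 /\
    z * derive1 h z * (F z - F 0) = lambda%:C * h z * (F z - F 0 - z * derive1 F z)].
Proof.
have F1 := andisk_transform.
have k0 z : normc z < rho -> ddiff F 0 z != 0.
  move=> zr; rewrite /ddiff; case: (eqVneq z 0) => [_|z0].
    by apply: derive1_transform_neq0; rewrite normc0.
  by rewrite mulf_neq0 ?subr_eq0 ?Fne// invr_neq0// subr0.
have an0 : an F 0 by apply: F1; rewrite normc0.
pose a := derive1 F 0; pose q z := a / ddiff F 0 z.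
have a0 : a != 0 by apply: derive1_transform_neq0; rewrite normc0.
have hq : andisk rho q.
  move=> z zr; exact: (an_div (an_cst a z) (an_ddiff an0 (F1 _ (r1 zr))) (k0 _ zr)).
have q0 z : normc z < rho -> q z != 0.
  by move=> zr; rewrite mulf_neq0// invr_neq0// k0.
have q1 : q 0 = 1 by rewrite /q /ddiff eqxx divff.
have [l [hl l0 El dl]] := analytic_log r0 hq q0 q1.
pose h z := Cexp (lambda%:C * l z).
have hh : andisk rho h by move=> z zr; exact: (an_comp (an_Z _ (hl _ zr)) (an_Cexp _)).
have h01 : h 0 = 1 by rewrite /h l0 mulr0 Cexp0.
have pconv_Acoef : pconv (fun n => Acoef lambda f n zeta) rho h.
  have [y hy] := andisk_pconv r0 hh.
  suff -> : (fun n => Acoef lambda f n zeta) = y by [].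
  apply/funext => n; have [e e0 hE] := transform_power_near hl r0 l0 El.
  have [yl hyl] := andisk_pconv ltr01 (andisk_cpower c1 lambda).
  have [P [jP PE]] := jet_Phi n.+1.
  have j1 := eq_jet e0 hE (jet_M (jet_pconv n.+1 ltr01 hyl) jP).
  rewrite (jet_coef r0 hy j1 (ltnSn n)); exact: Acoef_poly hyl PE.
have qF z : normc z < rho -> q z * (F z - F 0) = a * z.
  by move=> zr; rewrite ddiffM subr0 /q mulrA divfK// k0.
exists h; split => //.
- move=> z zr; rewrite /h normc_Cexp cReM /= mul0r subr0.
  rewrite -normcM -qF// normcM powRM ?normc_ge0//; congr (_ * _).
  by rewrite -El// normc_Cexp /powR gt_eqF ?expR_gt0// expRK.
- move=> z zr; split; first exact: Cexp_neq0.
  have dlam : is_derive z 1 (fun z => lambda%:C * l z) (lambda%:C * (derive1 q z / q z)).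
    have := is_deriveMC (an_is_derive (an_cst lambda%:C z)) (dl _ zr).
    by rewrite derive1_cst mulr0 addr0.
  have dh := derive1_val (is_derive_compC dlam (is_derive_Cexp _)).
  have dq : derive1 q z * (F z - F 0) + q z * derive1 F z = a.
    have d1 := is_deriveMC (an_is_derive (hq _ zr)) (an_is_derive (an_B (F1 _ (r1 zr)) (an_cst (F 0) z))).
    have dF : derive1 (fun w => F w - F 0) z = derive1 F z.
      apply: derive1_val; have /is_deriveCP H := an_is_derive (F1 _ (r1 zr)).
      apply/is_deriveCP => e /H[d d0 dP]; exists d => // w /dP.
      by rewrite (_ : F w - F 0 - (F z - F 0) = F w - F z)//; ring.
    rewrite dF in d1.
    have d2 : is_derive z 1 (fun w => 0 + a * w) a := is_derive_lin a 0 z.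
    have zr' : 0 < rho - normc z by rewrite subr_gt0.
    have d3 := is_derive_near (f := fun w => 0 + a * w) zr' _ d1.
    have E3 : forall w, normc (w - z) < rho - normc z -> 0 + a * w = q w * (F w - F 0).
      move=> w wz; rewrite add0r qF//.
      rewrite -[w](subrK z); apply: (le_lt_trans (normcD _ _)); lra.
    have e1 := derive1_val (d3 E3); have e2 := derive1_val d2.
    rewrite e2 in e1; rewrite [RHS]e1 addrC; congr (_ + _); exact: mulrC.
  have qz := q0 _ zr; rewrite dh -/(h z).
  have aux (A D dF' dq' qq x : C) : qq != 0 -> dq' * D + qq * dF' = A -> qq * D = A * x ->
      D - x * dF' = x * dq' / qq * D.
    by move=> qq0 <- E; apply: (mulfI qq0); rewrite mulrBr E; field.
  rewrite (aux _ _ _ _ _ _ qz dq (qF _ zr)).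
  move: (h z) (derive1 q z) ((q z)^-1) (F z - F 0) => A1 A2 A3 A4; ring.
Qed.
End disk.
End TransformPower.

(** * Parseval and Abel summation *)

Section Parseval.
Variable R : realType.
Local Notation C := R[i].
Implicit Types z w : C.

Local Notation MR := (measurableTypeR R).
Local Notation mu := (@lebesgue_measure R).
Local Notation m2 := (mu \x mu)%E.
(* A Tauberian converse of Abel's theorem, valid as the terms are eventually nonnegative. *)
Lemma abel_nonneg (x : nat -> R) (n0 : nat) (q s : nat -> R) (S : R) :
  (forall k, (n0 <= k)%N -> 0 <= x k) -> (forall m, 0 < q m < 1) -> q m @[m --> \oo] --> (1 : R) ->
  (forall m, \sum_(k < n) x k * q m ^+ k @[n --> \oo] --> s m) -> s m @[m --> \oo] --> S ->
  \sum_(k < n) x k @[n --> \oo] --> S.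
Proof.
move=> x0 q01 q1 hs hS.
pose P n := \sum_(k < n) x k; pose Pq m n := \sum_(k < n) x k * q m ^+ k.
have q0 m : 0 <= q m by have /andP[/ltW] := q01 m.
have Pq1 n : Pq m n @[m --> \oo] --> P n.
  rewrite /Pq /P; elim: n => [|n IH].
    rewrite big_ord0 (_ : (fun m => _) = (fun=> 0)); first exact: cvg_cst.
    by apply/funext => m; rewrite big_ord0.
  rewrite big_ord_recr (_ : (fun m => _) = (fun m => \sum_(k < n) x k * q m ^+ k + x n * q m ^+ n)); last first.
    by apply/funext => m; rewrite big_ord_recr.
  apply: cvgD => //; rewrite -[X in _ --> X]mulr1; apply: cvgM; first exact: cvg_cst.
  rewrite -(expr1n R n); elim: (n) => [|j IHj].
    by rewrite expr0; apply: cvg_cst.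
  rewrite exprS (_ : (fun m => _) = (fun m => q m * q m ^+ j)); first exact: cvgM.
  by apply/funext => m; rewrite exprS.
have Pqs m n : (n0 <= n)%N -> Pq m n <= s m.
  move=> n0n; apply: (ler_cvg_to (cvg_cst (Pq m n)) (hs m)); exists n => // j /= nj.
  rewrite /Pq -(subnK nj) addnC big_split_ord /= lerDl; apply: sumr_ge0 => k _.
  by rewrite mulr_ge0 ?exprn_ge0// x0// (leq_trans n0n)// leq_addr.
have PS n : (n0 <= n)%N -> P n <= S.
  by move=> n0n; apply: (ler_cvg_to (Pq1 n) hS); exists 0%N => // m _; exact: Pqs.
pose u n := P (n + n0)%N.
have nd : nondecreasing_seq u.
  apply/nondecreasing_seqP => n; rewrite /u /P addSn big_ord_recr /= lerDl x0//.
  exact: leq_addl.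
have ub : has_ubound (range u) by exists S => _ [n _ <-]; apply: PS; exact: leq_addl.
have cu := nondecreasing_cvgn nd ub.
set L := sup _ in cu.
have uL n : u n <= L by apply: ub_le_sup => //; exists n.
have LS : L = S.
  apply/eqP; rewrite eq_le; apply/andP; split.
    by apply: (ler_cvg_to cu (cvg_cst S)); exists 0%N => // n _; apply: PS; exact: leq_addl.
  (* Damping by q m <= 1 can only lower the terms from n0 on, and the finitely many earlier ones are
     kept exactly; they cancel as m grows. *)
  have h m : s m <= Pq m n0 - P n0 + L.
    apply: (ler_cvg_to (hs m) (cvg_cst _)); exists n0 => // j /= nj.
    apply: (@le_trans _ _ (Pq m n0 - P n0 + P j)).
      rewrite /Pq /P -(subnK nj) addnC !big_split_ord /= addrA subrK lerD2l.
      apply: ler_sum => k _; rewrite ler_piMr ?x0 ?leq_addr// exprn_ile1//.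
      by have /andP[_ /ltW] := q01 m.
    by rewrite lerD2l -(subnK nj); exact: uL.
  have c : Pq m n0 - P n0 + L @[m --> \oo] --> L.
    rewrite -[X in _ --> X]add0r -(subrr (P n0)); apply: cvgD; last exact: cvg_cst.
    by apply: cvgB; [exact: Pq1|exact: cvg_cst].
  by apply: (ler_cvg_to hS c); exists 0%N.
by rewrite -(cvg_shiftn n0) -LS.
Qed.

(** Only u is expanded. On the circle conj (z ^ k) = r ^ (2 k) z ^ (- k), so each term is a Cauchy
    coefficient of v. *)
Lemma parseval (a b : nat -> C) (rho r : R) (u v : C -> C) : 0 < r < rho ->
  pconv a rho u -> pconv b rho v ->
  \sum_(k < n) (pi *+ 2) * complex.Re (conjc (a k) * b k) * (r ^+ 2) ^+ k @[n --> \oo] -->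
  complex.Re (CI (fun t => conjc (u (r%:C * cis t)) * v (r%:C * cis t))).
Proof.
move=> /andP[r0 rr] hu hv; have r0' : 0 <= r < rho by rewrite ltW.
have rr0 : 0 < rho := lt_trans r0 rr.
pose z t : C := r%:C * cis t.
have zr t : normc (z t) = r by rewrite normcM normcR normc_cis mulr1 gtr0_norm.
have zn t : z t != 0 by rewrite -normc_gt0 zr.
have cz : continuous z := @contC_circ R r.
have cu := contC_circle (pconv_hol hu) r0'; have cv := contC_circle (pconv_hol hv) r0'.
have [M [q [M0 q01 Hq]]] := pconv_tail r0' hu.
have [B BP] := J_bounded cv.
pose G k t := conjc (a k * z t ^+ k) * v (z t).
have cG k : continuous (G k).
  have c1 : continuous (fun t => z t ^+ k) := @contC_X R z k cz.
  have c2 : continuous (fun t => a k * z t ^+ k) := @contC_Z R _ _ c1.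
  exact: (contC_M (contC_conj c2) cv).
have cw := contC_M (contC_conj cu) cv.
have bd t n : J t -> normc (\sum_(k < n) G k t - conjc (u (z t)) * v (z t)) <= (M * `|B|) * q ^+ n.
  move=> tJ; rewrite /G -mulr_suml -mulrBl -rmorph_sum -rmorphB /= normcM normc_conj mulrAC.
  apply: ler_pM; [exact: normc_ge0|exact: normc_ge0| |].
    by apply: Hq; rewrite zr.
  exact: le_trans (BP _ tJ) (ler_norm _).
have cc : ccoef v r = b.
  have rr' := ccoef_pconv (pconv_hol hv) rr.
  by apply: (pconv_coef_unique r0 rr0 r0 rr' hv).
have EG k : CI (G k) = conjc (a k) * ((r ^+ 2) ^+ k)%:C * ((pi *+ 2)%:C * b k).
  have cV : continuous (fun t => v (z t) * (z t)^-1 ^+ k).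
    have cz' := contC_V cz zn.
    exact: (contC_M cv (@contC_X R _ k cz')).
  rewrite -cc /ccoef mulVKf ?pi2C_neq0// -(@CI_Z R _ _ cV); apply: eq_CI => t.
  have E : conjc (z t ^+ k) = ((r ^+ 2) ^+ k)%:C * (z t)^-1 ^+ k.
    rewrite (rmorphXn (real_complex R)) rmorphXn /= -exprMn; congr (_ ^+ k).
    by rewrite -[in RHS](zr t) -mul_conjc mulrAC divff ?zn// mul1r.
  have EC : conjc (a k * z t ^+ k) = conjc (a k) * conjc (z t ^+ k) by rewrite rmorphM.
  rewrite /G EC E -/(z t).
  move: (conjc (a k)) (v (z t)) ((r ^+ 2) ^+ k)%:C ((z t)^-1 ^+ k) => A1 A2 A3 A4; ring.
have ER k : complex.Re (CI (G k)) = pi *+ 2 * complex.Re (conjc (a k) * b k) * (r ^+ 2) ^+ k.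
  have aux (x y : R) w1 w2 : complex.Re (w1 * x%:C * (y%:C * w2)) = y * complex.Re (w1 * w2) * x.
    by rewrite !(cReM, cImM) /= !(mul0r, mulr0, subr0, addr0); ring.
  by rewrite EG aux.
apply/cvgrPdist_lt => e e0.
have [N NP] := CI_series q01 cG cw bd e0.
exists N => // n /= /NP h; apply: le_lt_trans h; rewrite distrC.
apply: le_trans (Re_le_normc _); rewrite cReB cRe_sum.
have EE : \sum_(k < n) pi *+ 2 * complex.Re (conjc (a k) * b k) * (r ^+ 2) ^+ k =
    \sum_(k < n) complex.Re (CI (G k)) by apply: eq_bigr => k _; rewrite ER.
rewrite EE; exact: lexx.
Qed.
End Parseval.

(** * The series as lambda minus a weighted area *)

Section AreaSum.
Variable R : realType.
Local Notation C := R[i].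
Implicit Types z w : C.

Local Notation MR := (measurableTypeR R).
Local Notation mu := (@lebesgue_measure R).
Local Notation m2 := (mu \x mu)%E.
Lemma cvg_radseq : radseq R n @[n --> \oo] --> (1 : R).
Proof.
rewrite -[X in _ --> X]subr0; apply: cvgB; first exact: cvg_cst.
by have := @cvg_harmonic R; rewrite -(cvg_shiftn 1); apply: cvg_trans; apply: near_eq_cvg;
  near=> n; rewrite /harmonic /= addn1.
Unshelve. all: by end_near. Qed.

Lemma cvg_sum_from1 (x : nat -> R) (l : R) :
  (\sum_(1 <= n < N) x n @[N --> \oo] --> l) <-> (\sum_(k < N) x k @[N --> \oo] --> x 0%N + l).
Proof.
have E N : \sum_(k < N + 1) x k = x 0%N + \sum_(1 <= n < N + 1) x n.
  by rewrite addn1 -(big_mkord xpredT) big_ltn.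
split=> [h|h].
  rewrite -(cvg_shiftn 1) (_ : [sequence _]_n = fun N => x 0%N + \sum_(1 <= n < N + 1) x n).
    apply: cvgD; first exact: cvg_cst.
    by rewrite (cvg_shiftn 1 (fun N => \sum_(1 <= n < N) x n)).
  by apply/funext => N /=; rewrite E.
rewrite -(cvg_shiftn 1) (_ : [sequence _]_n = fun N => - x 0%N + \sum_(k < N + 1) x k).
  rewrite -[l](addKr (x 0%N)); apply: cvgD; first exact: cvg_cst.
  by rewrite (cvg_shiftn 1 (fun N => \sum_(k < N) x k)).
by apply/funext => N /=; rewrite E addKr.
Qed.

Variables (lambda : R) (f : C -> C) (zeta : C).
Hypothesis lambda0 : 0 < lambda.
Hypothesis hf : forall z, normc z < 1 -> an f z.
Hypothesis df0 : forall z, normc z < 1 -> derive1 f z != 0.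
Hypothesis zeta1 : normc zeta < 1.

Local Notation F := (transform f zeta).
Local Notation A n := (Acoef lambda f n zeta).
Let a : R := normc (derive1 F 0).
Let x n : R := (n%:R - lambda) * normc (A n) ^+ 2.

Let F1 : andisk 1 F. Proof. exact: andisk_transform. Qed.
Let dF0 z : normc z < 1 -> derive1 F z != 0.
Proof. exact: derive1_transform_neq0. Qed.
Let a0 : 0 < a. Proof. by rewrite normc_gt0 dF0// normc0. Qed.

Let pi2_gt0 : 0 < pi *+ 2 :> R. Proof. by rewrite mulrn_wgt0// pi_gt0. Qed.

Section univalent_case.
Hypothesis Finj : forall z w, normc z < 1 -> normc w < 1 -> F z = F w -> z = w.

Let Fne z : z != 0 -> normc z < 1 -> F z != F 0.
Proof.
by move=> z0 z1; apply/eqP => /Finj E; move/eqP: z0; apply; apply: E => //; rewrite normc0.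
Qed.

Let one01 : 0 < (1 : R) <= 1. Proof. by rewrite ltr01 lexx. Qed.

Lemma A0_eq1 : A 0 = 1.
Proof.
have [h [_ h0 hA _ _]] := transform_power lambda hf df0 zeta1 one01 Fne.
by rewrite (pconv_coef0 ltr01 hA).
Qed.

(** Parseval is applied to h and v = h - z h' / lambda, whose coefficients are (1 - n / lambda) A_n.
    On the circle conj h times v is |h| ^ 2 z F' / (F - F 0), and |h| ^ 2 is (a r) ^ (2 lambda) |F -
    F 0| ^ (- 2 lambda). *)
Lemma curve_integral_series r : 0 < r < 1 ->
  \sum_(k < n) x k * (r ^+ 2) ^+ k @[n --> \oo] -->
  - (lambda / (pi *+ 2)) * ((a * r) `^ (lambda * 2) * curve_integral F (lambda * 2) r).
Proof.
move=> r01; have /andP[r0 r1] := r01.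
have [h [hh h0 hA hn hd]] := transform_power lambda hf df0 zeta1 one01 Fne.
have l0 : lambda != 0 by rewrite gt_eqF.
have lC : lambda%:C != 0 :> C by rewrite fmorph_eq0.
pose v z := h z + (- (lambda%:C)^-1) * (z * derive1 h z).
have hv : andisk 1 v.
  move=> z z1; exact: (an_D (hh _ z1) (an_Z _ (an_M (an_id z) (an_derive1 (hh _ z1))))).
have [b hb] := andisk_pconv ltr01 hv.
have bE n : b n = (1 - n%:R / lambda)%:C * A n.
  have j1 := jet_pconv n.+1 ltr01 hA; have j2 := jet_pconv n.+1 ltr01 (pconv_derive1 hA).
  have j3 := jet_D j1 (jet_Z (- (lambda%:C)^-1) (jet_M (jet_poly n.+1 'X) j2)).
  have j4 : jet n.+1 v (\poly_(i < n.+1) A i + - (lambda%:C)^-1 *: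
     ('X * \poly_(i < n.+1) dcoef (fun n => A n) i)).
    by apply: (eq_jet ltr01 _ j3) => z _; rewrite hornerX.
  rewrite (jet_coef ltr01 hb j4 (ltnSn n)) coefD coefZ coefXM !coef_poly ltnSn.
  rewrite rmorphB rmorph1 (rmorphM (real_complex R)) (fmorphV (real_complex R)) rmorph_nat /=.
  case: n {j1 j2 j3 j4} => [|n] /=; first by rewrite !(mulr0, mul0r, addr0, subr0, mul1r).
  rewrite ltnS leqnSn /dcoef; move: (A n.+1) (n.+1%:R : C) (lambda%:C)^-1 => X Y Z; ring.
have P := parseval r01 hA hb.
pose K := (a * r) `^ (lambda * 2); have K0 : 0 < K by rewrite powR_gt0// mulr_gt0.
have sq (y : R) : y `^ (lambda * 2) = (y `^ lambda) ^+ 2.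
  by rewrite powRrM powR_mulrn// powR_ge0.
pose w t := conjc (h (r%:C * cis t)) * v (r%:C * cis t).
have cw : continuous w.
  have r0' : 0 <= r < 1 by rewrite ltW.
  exact: (contC_M (contC_conj (contC_circle (andisk_hol hh) r0')) (contC_circle (andisk_hol hv) r0')).
have ptw t : normc (wcurve F r t - F 0) `^ (- (lambda * 2)) *
    complex.Re (wspeed F r t / (wcurve F r t - F 0)) = K^-1 * complex.Re (w t).
  rewrite /wcurve /wspeed /w; set z : C := r%:C * cis t.
  have zr : normc z = r by rewrite normcM normcR normc_cis mulr1 gtr0_norm.
  have z1 : normc z < 1 by rewrite zr.
  have z0 : z != 0 by rewrite -normc_gt0 zr.
  have D0 : F z - F 0 != 0 by rewrite subr_eq0 Fne.
  have [hz E] := hd _ z1; have := hn _ z1; rewrite zr -/a => N.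
  have vE : v z = h z * (z * derive1 F z / (F z - F 0)).
    apply: (mulIf D0); rewrite -[RHS]mulrA divfK// /v mulrDl.
    have -> : - (lambda%:C)^-1 * (z * derive1 h z) * (F z - F 0) =
        - (lambda%:C)^-1 * (z * derive1 h z * (F z - F 0)) by rewrite [RHS]mulrA.
    rewrite E; move: (h z) (F z - F 0) (z * derive1 F z) lambda%:C lC => B1 B2 B3 B4 B40.
    by field.
  have hc : conjc (h z) * h z = (normc (h z) ^+ 2)%:C by rewrite mulrC mul_conjc.
  have Eaux (y : R) (u : C) : complex.Re (y%:C * u) = y * complex.Re u.
    by rewrite cReM /= mul0r subr0.
  rewrite vE [conjc _ * _]mulrA hc Eaux [RHS]mulrA; congr (_ * _).
  rewrite powRN sq /K sq -N.
  have Y0 : normc (F z - F 0) `^ lambda != 0 by rewrite gt_eqF// powR_gt0// normc_gt0.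
  have H0 : normc (h z) != 0 by rewrite gt_eqF// normc_gt0.
  move: Y0 H0; move: (normc (F z - F 0) `^ lambda) (normc (h z)) => Y H Y0 H0.
  by field; rewrite Y0 H0.
have CE : curve_integral F (lambda * 2) r = K^-1 * complex.Re (CI w).
  rewrite /curve_integral (_ : (fun t => _) = (fun t => K^-1 * complex.Re (w t))).
    by rewrite (IJ_Z _ (cont_Re cw)).
  by apply/funext => t; rewrite ptw.
rewrite CE -/K mulVKf ?gt_eqF//.
rewrite (_ : (fun n => _) = (fun n => - (lambda / (pi *+ 2)) *
  \sum_(k < n) (pi *+ 2) * complex.Re (conjc (A k) * b k) * (r ^+ 2) ^+ k)).
  by apply: cvgM; [exact: cvg_cst|exact: P].
apply/funext => n; rewrite mulr_sumr; apply: eq_bigr => k _; rewrite mulrA; congr (_ * _).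
have aux (y : R) (X : C) : complex.Re (conjc X * (y%:C * X)) = y * normc X ^+ 2.
  by rewrite mulrCA [conjc X * X]mulrC mul_conjc -rmorphM.
rewrite bE aux /x.
move: (pi *+ 2) pi2_gt0 => p /lt0r_neq0 p0.
by field; rewrite l0 p0.
Qed.

(** The term of index 0 equals - lambda, since A_0 = 1; dropping it produces the constant lambda. *)
Lemma area_sum : exists I : R, \sum_(1 <= n < N) x n @[N --> \oo] --> lambda - I /\
  (I = 0 <-> m2.-negligible [set p | ~ exists2 z, normc z < 1 & F z = cpt p]).
Proof.
have l2 : 0 < lambda * 2 by rewrite mulr_gt0.
have [I [cI nI]] := area_limit l2 F1 Finj dF0.
(* The limit factor of [curve_integral_series], times the 2 lambda by which [area_limit] divides. It
   is positive, so it does not change when the area vanishes. *)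
pose c := lambda / (pi *+ 2) * (a `^ (lambda * 2) * (lambda * 2)).
have c0 : 0 < c by rewrite !mulr_gt0// ?invr_gt0// powR_gt0.
exists (c * I); split; last first.
  rewrite -nI; split=> [/eqP|->]; last by rewrite mulr0.
  by rewrite mulf_eq0 gt_eqF//= => /eqP.
apply/cvg_sum_from1.
have -> : x 0%N + (lambda - c * I) = - (c * I).
  by rewrite /x A0_eq1 normcR normr1 expr1n; ring.
pose s m := - (lambda / (pi *+ 2)) * ((a * radseq R m) `^ (lambda * 2) *
  curve_integral F (lambda * 2) (radseq R m)).
(* The terms are nonnegative from the first integer above lambda on; the series is in powers of r ^
   2, hence the squared radii. *)
apply: (@abel_nonneg R x (Num.truncn lambda).+1 (fun m => radseq R m ^+ 2) s).
- move=> k kn; rewrite mulr_ge0 ?sqr_ge0// subr_ge0.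
  have /andP[_ /ltW h] := truncn_itv (ltW lambda0).
  by apply: (le_trans h); rewrite ler_nat.
- by move=> m; have /andP[h1 h2] := radseq01 R m; rewrite exprn_gt0//= exprn_ilt1// ltW.
- rewrite -(mulr1 (1 : R)) (_ : (fun m => _) = (fun m => radseq R m * radseq R m)).
    by apply: cvgM; exact: cvg_radseq.
  by apply/funext => m; rewrite expr2.
- by move=> m; apply: curve_integral_series; exact: radseq01.
have cp : (a * radseq R m) `^ (lambda * 2) @[m --> \oo] --> a `^ (lambda * 2).
  have ca : a * radseq R m @[m --> \oo] --> a.
    by rewrite -[X in _ --> X]mulr1; apply: cvgM; [exact: cvg_cst|exact: cvg_radseq].
  exact: (cvg_comp _ _ ca (@continuous_powR_gt0 R (lambda * 2) _ a0)).
have -> : - (c * I) = - (lambda / (pi *+ 2)) * (a `^ (lambda * 2) * (I * (lambda * 2))).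
  by rewrite /c; ring.
rewrite /s; apply: cvgM; first exact: cvg_cst.
apply: cvgM => //.
rewrite (_ : (fun m => _) = (fun m => curve_integral F (lambda * 2) (radseq R m) / (lambda * 2) * (lambda * 2))).
  by apply: cvgM => //; exact: cvg_cst.
by apply/funext => m; rewrite divfK// gt_eqF.
Qed.
End univalent_case.
End AreaSum.

(** * Univalence from bounded coefficients *)

Section Converse.
Variable R : realType.
Local Notation C := R[i].
Implicit Types z w : C.

Local Notation MR := (measurableTypeR R).
Local Notation mu := (@lebesgue_measure R).
Local Notation m2 := (mu \x mu)%E.
Lemma andisk_bounded (u : C -> C) (sg : R) : andisk 1 u -> 0 <= sg < 1 ->
  exists2 M : R, 0 < M & forall z, normc z <= sg -> normc (u z) <= M.
Proof.
move=> hu sg01; have [d hd] := andisk_pconv ltr01 hu.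
have [M [q [M0 _ H]]] := pconv_tail sg01 hd.
exists M => // z /H /(_ 0%N).
by rewrite /psum big_ord0 sub0r normcN expr0 mulr1.
Qed.

(** The factor 2 comes from applying the mean value theorem to the real and imaginary parts
    separately. *)
Lemma radial_lip (F : C -> C) (u : C) (s t M : R) : andisk 1 F -> normc u = 1 ->
  0 <= s <= t -> t < 1 -> (forall z, normc z <= t -> normc (derive1 F z) <= M) ->
  normc (F (t%:C * u) - F (s%:C * u)) <= M * (t - s) *+ 2.
Proof.
move=> hF u1 /andP[s0 st] t1 HM.
have nx x : s <= x <= t -> normc (x%:C * u) = x.
  by move=> /andP[sx _]; rewrite normcM u1 mulr1 normcR ger0_norm// (le_trans s0).
have dx x : s <= x <= t -> pder (fun x => F (x%:C * u)) x (derive1 F (x%:C * u) * u).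
  move=> hx; have /andP[_ xt] := hx.
  have dc : pder (fun x : R => x%:C * u) x u.
    move=> e e0; exists 1 => // y _.
    have -> : y%:C * u - x%:C * u - u * (y - x)%:C = 0 by rewrite rmorphB /=; ring.
    by rewrite normc0 mulr_ge0 ?(ltW e0).
  have x1 : normc (x%:C * u) < 1 by rewrite nx// (le_lt_trans xt).
  exact: (@pder_comp R F (fun x : R => x%:C * u) x _ _ (an_is_derive (hF _ x1)) dc).
have bx x : s <= x <= t -> normc (derive1 F (x%:C * u) * u) <= M.
  move=> hx; rewrite normcM u1 mulr1; apply: HM; rewrite nx//.
  by case/andP: hx.
have [h1 h2] := pder_lip_seg st dx bx.
by apply: (le_trans (normcRe_Im _)); rewrite cReB cImB mulr2n lerD.
Qed.

Variables (lambda : R) (f : C -> C) (zeta : C).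
Hypothesis lambda0 : 0 < lambda.
Hypothesis hf : forall z, normc z < 1 -> an f z.
Hypothesis df0 : forall z, normc z < 1 -> derive1 f z != 0.
Hypothesis zeta1 : normc zeta < 1.

Local Notation F := (transform f zeta).
Local Notation A n := (Acoef lambda f n zeta).

(** The terms of a convergent series are eventually below 1, and the factor n - lambda is at least 1
    for large n. Partial sums within 1 / 2 of the limit are what makes a single term less than 1. *)
Lemma Acoef_bounded (l : R) :
  \sum_(1 <= n < N) (n%:R - lambda) * normc (A n) ^+ 2 @[N --> \oo] --> l ->
  exists2 B : R, 0 < B & forall n, normc (A n) <= B.
Proof.
move=> /cvgrPdist_lt /(_ (1 / 2)) []; first by rewrite divr_gt0.
move=> N _ HN; pose n1 := maxn (N + 1) (Num.truncn (lambda + 1)).+1.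
have big n : (n1 <= n)%N -> normc (A n) <= 1.
  rewrite geq_max => /andP[h1 h2].
  have n0 : (1 <= n)%N by apply: leq_trans h1; rewrite addn1.
  have h3 := HN n; have h4 := HN n.+1; rewrite /= in h3 h4.
  have {}h3 := h3 (leq_trans (leq_addr 1 N) h1).
  have {}h4 := h4 (leqW (leq_trans (leq_addr 1 N) h1)).
  rewrite big_nat_recr//= in h4.
  have x1 : (n%:R - lambda) * normc (A n) ^+ 2 < 1.
    move: h3 h4; rewrite !ltr_norml; set S := \sum_(_ <= _ < _) _ => /andP[_ h3] /andP[h4 _]; lra.
  have ln : lambda + 1 <= n%:R.
    have /andP[_ /ltW h] := truncn_itv (addr_ge0 (ltW lambda0) ler01).
    by apply: (le_trans h); rewrite ler_nat.
  have A2 : normc (A n) ^+ 2 <= 1.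
    apply: le_trans (ltW x1); rewrite ler_peMl ?sqr_ge0//; lra.
  by rewrite -(@ler_pXn2r _ 2) ?nnegrE ?normc_ge0 ?ler01// expr1n.
exists (1 + \sum_(k < n1) normc (A k)); first by rewrite ltr_pwDl// sumr_ge0// => k _; exact: normc_ge0.
move=> n; have [h|h] := leqP n1 n.
  by apply: (le_trans (big _ h)); rewrite lerDl sumr_ge0// => k _; exact: normc_ge0.
rewrite (bigD1 (Ordinal h))//= addrCA lerDl addr_ge0// sumr_ge0// => k _; exact: normc_ge0.
Qed.

(* Up to the smallest modulus rho of another zero of F - F 0, the bounded function h
   satisfies |h| |F - F 0| ^ lambda = |F'(0) z| ^ lambda, which keeps F - F 0 away from 0
   near the circle of radius rho and contradicts the radial Lipschitz bound. *)
Lemma bounded_zero_free (B : R) : 0 < B -> (forall n, normc (A n) <= B) ->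
  forall z, z != 0 -> normc z < 1 -> F z != F 0.
Proof.
move=> B0 HB z1 z10 z11; apply/eqP => Fz1.
have F1 := andisk_transform hf zeta1.
have n01 : normc (0 : C) < 1 by rewrite normc0.
have a0 : 0 < normc (derive1 F 0) by rewrite normc_gt0 derive1_transform_neq0.
pose Z : set R := [set x | exists z, [/\ z != 0, normc z < 1, F z = F 0 & x = normc z]].
have Z1 : Z (normc z1) by exists z1.
have dd0 : ddiff F 0 0 != 0 by rewrite /ddiff eqxx -normc_gt0.
(* F'(0) != 0 keeps the other zeros of F - F 0 at distance at least e from 0, so their infimum
   modulus rho is positive. *)
have [e e0 eP] := near_neq0 (an_continuous (an_ddiff_self (F1 _ n01))) dd0.
have Ze x : Z x -> e <= x.
  move=> [z [z0 z1' Fz ->]]; rewrite leNgt; apply/negP => ze.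
  have := eP z; rewrite subr0 => /(_ ze); rewrite /ddiff (negbTE z0) Fz subrr mul0r eqxx.
  by [].
have hI : has_inf Z by split; [exists (normc z1)|exists e => x /Ze].
pose rho := inf Z.
have rhoe : e <= rho by apply: lb_le_inf; [exists (normc z1)|move=> x /Ze].
have rho0 : 0 < rho := lt_le_trans e0 rhoe.
have rhoz x : Z x -> rho <= x by move=> h; apply: ge_inf => //; exists e => y /Ze.
have rho1 : rho < 1 := le_lt_trans (rhoz _ Z1) z11.
have rho01 : 0 < rho <= 1 by rewrite rho0 ltW.
have Fne z : z != 0 -> normc z < rho -> F z != F 0.
  move=> z0 zr; apply/eqP => Fz; have := zr; rewrite ltNge rhoz//.
  by exists z; split => //; exact: lt_trans zr rho1.
have [h [hh h0 hA hn _]] := transform_power lambda hf df0 zeta1 rho01 Fne.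
(* The sum of the geometric series B rho ^ n, which bounds h on the whole open disk of radius
   rho. *)
pose H := B / (1 - rho); have H0 : 0 < H by rewrite divr_gt0// subr_gt0.
have hH z : normc z < rho -> normc (h z) <= H.
  move=> zr; have zn : 0 <= normc z < 1 by rewrite normc_ge0 (lt_trans zr).
  have [|w hw bw] := @pser_geom R (fun n => A n) z B (normc z) (ltW B0) zn.
    by move=> n; rewrite normcM normcX ler_wpM2r ?exprn_ge0 ?normc_ge0.
  have -> : h z = w by exact: pser_unique (hA _ zr) hw.
  have := bw 0%N; rewrite /psum big_ord0 sub0r normcN expr0 mulr1 => /le_trans; apply.
  apply: ler_wpM2l; first exact: ltW.
  by rewrite lef_pV2 ?posrE ?subr_gt0 ?(lt_trans zr)// lerD2l lerN2 ltW.
(* On rho / 2 <= |z| < rho the modulus identity of h and |h| <= H give |F z - F 0| ^ lambda >= k1,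
   that is |F z - F 0| >= kap. *)
pose k1 := (normc (derive1 F 0) * (rho / 2)) `^ lambda / H.
have k10 : 0 < k1 by rewrite divr_gt0// powR_gt0// mulr_gt0// divr_gt0.
pose kap := k1 `^ lambda^-1; have kap0 : 0 < kap by rewrite powR_gt0.
have low z : rho / 2 <= normc z -> normc z < rho -> kap <= normc (F z - F 0).
  move=> z2 zr; rewrite leNgt; apply/negP => lt.
  have : normc (F z - F 0) `^ lambda < k1.
    have -> : k1 = kap `^ lambda by rewrite /kap -powRrM mulVf ?gt_eqF// powRr1// ltW.
    by apply: gt0_ltr_powR; rewrite ?nnegrE ?normc_ge0 ?(ltW kap0).
  rewrite /k1 ltr_pdivlMr// ltNge => /negP; apply.
  apply: (@le_trans _ _ ((normc (derive1 F 0) * normc z) `^ lambda)).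
    by apply: ge0_ler_powR; rewrite ?nnegrE ?mulr_ge0 ?normc_ge0 ?divr_ge0 ?ler_wpM2l ?normc_ge0 ?(ltW rho0) ?(ltW lambda0).
  by rewrite -hn// mulrC ler_wpM2l ?powR_ge0 ?hH.
pose sg := (1 + rho) / 2.
have sg01 : 0 <= sg < 1 by rewrite /sg; apply/andP; split; lra.
have dF1 : andisk 1 (derive1 F) by move=> z /F1; exact: an_derive1.
have [M M0 HM] := andisk_bounded dF1 sg01.
(* The three bounds keep rho - ep at least rho / 2, keep the segment inside |z| <= sg where |F'| <=
   M, and make the Lipschitz estimate at most 4 M ep <= kap / 2. *)
pose ep := Num.min (Num.min (rho / 2) (sg - rho)) (kap / (8 * M)).
have ep0 : 0 < ep.
  rewrite !lt_min !divr_gt0 ?mulr_gt0// /sg; lra.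
have ep1 : ep <= rho / 2 by rewrite !ge_min lexx.
have ep2 : ep <= sg - rho by rewrite !ge_min lexx orbT.
have ep3 : ep <= kap / (8 * M) by rewrite !ge_min lexx orbT.
(* A zero with modulus within ep of the infimum is enough; it is compared with the point of modulus
   rho - ep on the same radius. *)
have [x [z [z0 zlt Fz ->]] zep] := inf_adherent ep0 hI.
have rz : rho <= normc z by apply: rhoz; exists z.
have zn0 : normc z != 0 by rewrite gt_eqF// normc_gt0.
pose u : C := z / (normc z)%:C.
have u1 : normc u = 1 by rewrite normcM normcV normcR ger0_norm ?normc_ge0// divff.
have zu : z = (normc z)%:C * u by rewrite /u mulrCA divff ?mulr1// fmorph_eq0.
pose t := rho - ep.
have t0 : 0 <= t by rewrite /t; lra.
have tz : 0 <= t <= normc z by rewrite t0 /t; lra.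
have HM' w : normc w <= normc z -> normc (derive1 F w) <= M.
  move=> wz; apply: HM; apply: (le_trans wz); apply: (le_trans (ltW zep)).
  by rewrite -/rho; lra.
have := radial_lip F1 u1 tz zlt HM'; rewrite -zu Fz => lip.
have nt : normc (t%:C * u) = t by rewrite normcM u1 mulr1 normcR ger0_norm.
have := low (t%:C * u); rewrite nt normcB => /(_ _ _)/le_trans-/(_ _ _ _ lip).
have c1 : rho / 2 <= t by rewrite /t; lra.
have c2 : t < rho by rewrite /t; lra.
move=> /(_ c1 c2); apply/negP; rewrite -ltNge.
have b1 : normc z - t <= 2 * ep.
  rewrite /t; have : normc z < rho + ep by exact: zep.
  lra.
have b2 : M * (normc z - t) <= M * (2 * ep) by rewrite ler_wpM2l// ltW.
have b3 : M * ep <= kap / 8.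
  move: ep3; rewrite ler_pdivlMr ?mulr_gt0// => ep3.
  by rewrite ler_pdivlMr//; move: ep3; rewrite mulrA [ep * 8]mulrC; nra.
rewrite mulr2n; nra.
Qed.
End Converse.

Theorem theorem2p9 (R : realType) (lambda : R) (f : R[i] -> R[i])
    (lambda_gt0 : 0 < lambda) (f_lu : locally_univalent f) :
  (univalent f /\ full_mapping f) <->
  (forall zeta : R[i], unit_disk zeta ->
    (\sum_(1 <= n < N) (n%:R - lambda) * Normc.normc (Acoef lambda f n zeta) ^+ 2)
      @[N --> \oo] --> lambda).
Proof.
case: f_lu => hf df0.
(* The automorphism is onto the disk, so f and its transform have the same image. *)
have full zeta : normc zeta < 1 ->
    [set p : R * R | ~ (f @` @unit_disk R) (p.1 +i* p.2)] =
    [set p | ~ exists2 z, normc z < 1 & transform f zeta z = cpt p].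
  move=> zeta1; apply/seteqP; split => p /= np; apply: contra_not np.
    by move=> [z z1 zp]; exists (mobius zeta z) => //; exact: mobius_lt1.
  move=> [w w1 wp]; have [z z1 zw] := mobius_surj zeta1 w1.
  by exists z => //; rewrite /transform zw.
split=> [[uf ff] zeta zeta1|H].
  have Finj z w : normc z < 1 -> normc w < 1 -> transform f zeta z = transform f zeta w -> z = w.
    move=> z1 w1 /uf E; apply: (mobius_inj zeta1 z1 w1); apply: E; rewrite inE;
      exact: mobius_lt1.
  have [I [cI I0]] := area_sum lambda_gt0 hf df0 zeta1 Finj.
  suff I00 : I = 0 by rewrite I00 subr0 in cI.
  by apply/I0; rewrite -full.
have ne zeta : normc zeta < 1 -> forall z, z != 0 -> normc z < 1 ->
    transform f zeta z != transform f zeta 0.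
  move=> zeta1; have [B B0 HB] := Acoef_bounded lambda_gt0 (H _ zeta1).
  exact: (bounded_zero_free lambda_gt0 hf df0 zeta1 B0 HB).
have uf : univalent f.
  move=> z w; rewrite !inE => z1 w1 E.
  (* Moving z to the origin turns f z = f w into a zero of F - F 0 at the preimage x of w, which
     must then be 0. *)
  have [x x1 xw] := mobius_surj z1 w1.
  have [x0|x0] := eqVneq x 0; first by rewrite -xw x0 mobius0.
  by have := ne _ z1 _ x0 x1; rewrite /transform xw mobius0 E eqxx.
split => //.
(* With univalence established, the sum at zeta = 0 is also lambda - I; uniqueness of limits gives I
   = 0, hence fullness. *)
have n0 : normc (0 : R[i]) < 1 by rewrite normc0.
have Finj z w : normc z < 1 -> normc w < 1 -> transform f 0 z = transform f 0 w -> z = w.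
  move=> z1 w1 /uf E; apply: (mobius_inj n0 z1 w1); apply: E; rewrite inE; exact: mobius_lt1.
have [I [cI I0]] := area_sum lambda_gt0 hf df0 n0 Finj.
have I00 : I = 0.
  have := cvg_unique _ cI (H _ n0).
  by move=> /(_ (@Rhausdorff R)) E; apply/eqP; rewrite -oppr_eq0 -(addKr lambda (- I)) E addNr.
by rewrite /full_mapping (full 0 n0); apply/I0.
Qed.
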